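(* Let $n\geq 3$ and let $B_1\subset\mathbf{R}^n$ be the open unit ball centered at the origin. There exists a positive constant $k(n)$, depending only on $n$, such that the following holds. Assume that $c\in L^{\frac n2}(B_1)$ and that $u\in H^1(B_1)$ is a weak solution of $$\begin{cases}-\Delta u(x)+c(x)u(x)\geq 0 & \text{in } B_1,\\ u(x)\geq 0 & \text{on }\partial B_1.\end{cases}$$ If $\|c^-\|_{L^{\frac n2}(B_1)}\leq k(n)$, where $c^-(x)=-\min\{c(x),0\}$, then $u(x)\geq 0$ in $B_1$.
   Context: The inequality $-\Delta u+cu\ge 0$ in $B_1$ holds in the weak sense if $\int_{B_1}\nabla u\cdot\nabla\varphi\,dx+\int_{B_1}c\,u\,\varphi\,dx\geq 0$ for all nonnegative $\varphi\in C_0^\infty(B_1)$ (equivalently, by density, for all nonnegative $\varphi\in H_0^1(B_1)$). The condition $u\geq0$ on $\partial B_1$ is in the trace sense, i.e. $u^-=-\min\{u,0\}\in H_0^1(B_1)$. The inequality $u\ge0$ in $B_1$ is understood almost everywhere. *)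

(* Defs.v *)
From HB Require Import structures.
From mathcomp Require Import all_boot all_order all_algebra.
From mathcomp Require Import all_classical all_reals all_analysis.

Set Implicit Arguments.
Unset Strict Implicit.
Unset Printing Implicit Defensive.

Import Order.TTheory GRing.Theory Num.Theory.
Import numFieldNormedType.Exports.

Local Open Scope classical_set_scope.
Local Open Scope ring_scope.

(* Row vectors carry the sigma-algebra generated by the coordinates, as the
   library does for tuples; on 'rV[R]_n this is the Borel sigma-algebra. *)

Definition rV_display : measure_display -> measure_display.
Proof. exact. Qed.

Section measurable_rV.
Context {d : measure_display} {T : sigmaRingType d} {n : nat}.

Definition rV_coord (i : 'I_n) (x : 'rV[T]_n) : T := x ord0 i.

Let rV_set0 : g_sigma_preimage rV_coord set0.
Proof. exact: sigma_algebra0. Qed.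

Let rV_setC A : g_sigma_preimage rV_coord A -> g_sigma_preimage rV_coord (~` A).
Proof. exact: sigma_algebraC. Qed.

Let rV_bigcup (F : (set 'rV[T]_n)^nat) :
  (forall i, g_sigma_preimage rV_coord (F i)) ->
  g_sigma_preimage rV_coord (\bigcup_i (F i)).
Proof. exact: sigma_algebra_bigcup. Qed.

HB.instance Definition _ := @isMeasurable.Build (rV_display d)
  'rV[T]_n (g_sigma_preimage rV_coord) rV_set0 rV_setC rV_bigcup.

End measurable_rV.

Lemma measurable_rV_coord d (T : measurableType d) n (i : 'I_n) :
  measurable_fun setT (@rV_coord d T n i).
Proof.
move=> _ Y mY; rewrite setTI; apply: sub_sigma_algebra.
rewrite -bigcup_seq; exists i; first by rewrite /= mem_index_enum.
by exists Y => //; rewrite setTI.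
Qed.

Lemma measurable_fun_rVP d1 d (T1 : measurableType d1) (T : measurableType d)
    n (f : T1 -> 'rV[T]_n) :
  measurable_fun setT f <->
  forall i, measurable_fun setT (fun x => f x ord0 i).
Proof.
split=> [mf i|mf].
  exact: (measurableT_comp (@measurable_rV_coord _ _ _ i) mf).
apply: (@measurability _ _ _ _ setT f
  (\big[setU/set0]_(i < n) preimage_set_system setT (@rV_coord d T n i)
     measurable)) => //.
move=> _ [B + <-].
rewrite -bigcup_seq => -[i _] [Y mY <-].
by rewrite setTI -comp_preimage; exact: mf.
Qed.

Section lebesgue_measure_rV.
Context {R : realType}.

Definition rV_cons n (p : measurableTypeR R * 'rV[R]_n) : 'rV[R]_n.+1 :=
  row_mx p.1%:M p.2.
Definition rV_uncons n (x : 'rV[R]_n.+1) : measurableTypeR R * 'rV[R]_n :=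
  (x ord0 ord0, \row_j x ord0 (lift ord0 j)).

Lemma rV_cons0 n (p : measurableTypeR R * 'rV[R]_n) : rV_cons p ord0 ord0 = p.1.
Proof.
rewrite /rV_cons; have -> : ord0 = lshift n (ord0 : 'I_1) by exact: val_inj.
by rewrite (row_mxEl p.1%:M p.2 ord0 ord0) !mxE/= mulr1n.
Qed.

Lemma rV_consS n (p : measurableTypeR R * 'rV[R]_n) j :
  rV_cons p ord0 (lift ord0 j) = p.2 ord0 j.
Proof.
rewrite /rV_cons; have -> : lift ord0 j = rshift 1 j by exact: val_inj.
by rewrite (row_mxEr p.1%:M p.2 ord0 j).
Qed.

Lemma rV_consK n : cancel (@rV_cons n) (@rV_uncons n).
Proof.
move=> [a v]; rewrite /rV_uncons rV_cons0; congr pair.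
by apply/rowP => j; rewrite mxE rV_consS.
Qed.

Lemma measurable_rV_cons n : measurable_fun setT (@rV_cons n).
Proof.
apply/measurable_fun_rVP => i; case: (unliftP ord0 i) => [j ->|->].
- rewrite (_ : (fun _ => _) = @rV_coord _ R n j \o snd); last first.
    by apply/funext => p /=; rewrite rV_consS.
  by apply: measurableT_comp; [exact: measurable_rV_coord|exact: measurable_snd].
- rewrite (_ : (fun _ => _) = fst); first exact: measurable_fst.
  by apply/funext => p /=; rewrite rV_cons0.
Qed.

Lemma measurable_rV_uncons n : measurable_fun setT (@rV_uncons n).
Proof.
apply/measurable_fun_pairP; split => /=.
  exact: (@measurable_rV_coord _ R n.+1 ord0).
apply/measurable_fun_rVP => j.
rewrite (_ : (fun _ => _) = @rV_coord _ R n.+1 (lift ord0 j)).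
  exact: measurable_rV_coord.
by apply/funext => x /=; rewrite mxE.
Qed.

Section step.
Variables (n : nat) (mu : {sigma_finite_measure set 'rV[R]_n -> \bar R}).

Definition lebesgue_rV_step : set 'rV[R]_n.+1 -> \bar R :=
  pushforward (lebesgue_measure \x mu)%E (@rV_cons n).

Let step0 : lebesgue_rV_step set0 = 0%E.
Proof. by rewrite /lebesgue_rV_step /pushforward preimage_set0 measure0. Qed.

Let step_ge0 A : (0 <= lebesgue_rV_step A)%E.
Proof. by apply: measure_ge0; exact: measurable_rV_cons. Qed.

Let step_sigma_additive : semi_sigma_additive lebesgue_rV_step.
Proof.
by apply: measure_semi_sigma_additive; exact: measurable_rV_cons.
Qed.

HB.instance Definition _ := isMeasure.Build _ _ _ lebesgue_rV_step
  step0 step_ge0 step_sigma_additive.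

Let lebesgue_rV_step_sigma_finite : sigma_finite setT lebesgue_rV_step.
Proof.
have /sigma_finiteP[F [FT ndF Ffin]] := sigma_finiteT (@lebesgue_measure R).
have /sigma_finiteP[G [GT ndG Gfin]] := sigma_finiteT mu.
have mFG k : measurable (F k `*` G k).
  by apply: measurableX; [exact: (Ffin k).1|exact: (Gfin k).1].
exists (fun k => @rV_uncons n @^-1` (F k `*` G k)).
  apply/esym/seteqP; split => // x _.
  have [i _ Fi] : (\bigcup_i F i) (rV_uncons x).1 by rewrite -FT.
  have [j _ Gj] : (\bigcup_i G i) (rV_uncons x).2 by rewrite -GT.
  exists (maxn i j) => //; split => /=.
    by move: Fi; exact/subsetPset/ndF/leq_maxl.
  by move: Gj; exact/subsetPset/ndG/leq_maxr.
move=> k; split.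
  by rewrite -[X in measurable X]setTI; exact: measurable_rV_uncons.
rewrite /lebesgue_rV_step /pushforward -comp_preimage.
rewrite (_ : _ \o _ = id); last by apply/funext => p; exact: rV_consK.
rewrite preimage_id product_measure1E//; [|exact: (Ffin k).1|exact: (Gfin k).1].
by rewrite lte_mul_pinfty ?ge0_fin_numE ?(Ffin k).2 ?(Gfin k).2.
Qed.

HB.instance Definition _ := @Measure_isSigmaFinite.Build _ _ _
  lebesgue_rV_step lebesgue_rV_step_sigma_finite.

End step.

(* Lebesgue measure on R^n, by iterated products along R^n.+1 ~ R * R^n *)
Fixpoint lebesgue_rV (n : nat) : {sigma_finite_measure set 'rV[R]_n -> \bar R} :=
  match n with
  | 0 => \d_(0 : 'rV[R]_0)
  | m.+1 => lebesgue_rV_step (lebesgue_rV m)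
  end.

Lemma measurable_rV_box n (A : 'I_n -> set R) : (forall i, measurable (A i)) ->
  measurable [set x : 'rV[R]_n | forall i, A i (x ord0 i)].
Proof.
move=> mA.
rewrite (_ : mkset _ = \big[setI/setT]_(i < n) (@rV_coord _ R n i @^-1` A i)).
  apply: bigsetI_measurable => i _.
  by rewrite -[X in measurable X]setTI; exact: measurable_rV_coord.
rewrite -bigcap_seq; apply/seteqP; split => x /= Ax i.
  by move=> _; exact: Ax.
by apply: Ax => /=; rewrite mem_index_enum.
Qed.

Lemma lebesgue_rV_box n (A : 'I_n -> set R) : (forall i, measurable (A i)) ->
  lebesgue_rV n [set x : 'rV[R]_n | forall i, A i (x ord0 i)] =
  (\prod_(i < n) lebesgue_measure (A i))%E.
Proof.
elim: n A => [|n IH] A mA.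
  rewrite big_ord0 /= diracE mem_set// => -[m ltm0].
  by exfalso; rewrite ltn0 in ltm0.
rewrite big_ord_recl -IH; last by move=> i; exact: mA.
rewrite [LHS]/= /lebesgue_rV_step /pushforward.
transitivity (product_measure1 (@lebesgue_measure R) (lebesgue_rV n)
    (A ord0 `*` [set v : 'rV[R]_n | forall i, A (lift ord0 i) (v ord0 i)])).
  congr (_ _); apply/seteqP; split => [p /= Ap|p /= [A0 AS] i].
    by split=> [|i]; [rewrite -rV_cons0|rewrite -rV_consS]; exact: Ap.
  by case: (unliftP ord0 i) => [j ->|->]; rewrite ?rV_consS ?rV_cons0.
rewrite product_measure1E//; first exact: mA.
exact: (@measurable_rV_box n (fun i => A (lift ord0 i)) (fun i => mA _)).
Qed.

End lebesgue_measure_rV.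

Section sobolev.
Context {R : realType} {n : nat}.
Local Notation V := 'rV[R]_n.
Local Notation leb := (@lebesgue_rV R n).
Implicit Types (D : set V) (u v : V -> R) (g : 'I_n -> V -> R).

(* The norm that the library puts on 'rV[R]_n is the sup norm. *)
Definition enorm (x : V) : R := Num.sqrt (\sum_(i < n) x ord0 i ^+ 2).

Definition unit_ball : set V := [set x | enorm x < 1].

Definition partial (i : 'I_n) (f : V -> R) (x : V) : R :=
  'D_(delta_mx ord0 i) f x.

Definition smooth (f : V -> R) :=
  forall s : seq 'I_n, continuous (foldr partial f s) /\
    forall i x, derivable (foldr partial f s) x (delta_mx ord0 i : V).

(* C_0^oo(D), the functions being extended by 0 outside D *)
Definition test_function D (f : V -> R) :=
  [/\ smooth f, compact (closure [set x | f x != 0]) &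
      closure [set x | f x != 0] `<=` D].

(* Functions on D are represented by total functions on R^n whose values
   outside D are irrelevant. *)
Definition Lnorm_on D (p : R) u : \bar R := 'N[leb]_(p%:E)[EFin \o (u \_ D)]%E.

Definition Lp_on D (p : R) u := u \_ D \in Lfun leb p%:E.

Definition weak_partial D (i : 'I_n) u (w : V -> R) :=
  forall f, test_function D f ->
    \int[leb]_(x in D) (u x * partial i f x) =
    - \int[leb]_(x in D) (w x * f x).

Definition H1_gradient D u g :=
  Lp_on D 2 u /\ forall i, Lp_on D 2 (g i) /\ weak_partial D i u (g i).

Definition H1 D u := exists g, H1_gradient D u g.

(* the H^1 norm of a function u with weak gradient g *)
Definition H1_norm D u g : \bar R :=
  ((Lnorm_on D 2 u `^ 2 + \sum_(i < n) Lnorm_on D 2 (g i) `^ 2) `^ 2^-1)%E.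

(* H^1_0(D), the closure of C_0^oo(D) in H^1(D) *)
Definition H10 D v := exists2 g, H1_gradient D v g &
  forall e : R, 0 < e -> exists2 f, test_function D f &
    (H1_norm D (v \- f)%R (fun i => g i \- partial i f)%R < e%:E)%E.

(* - Delta u + c u >= 0 in D *)
Definition weak_supersolution D (c u : V -> R) :=
  exists2 g, H1_gradient D u g &
    forall f, test_function D f -> (forall x, 0 <= f x) ->
      0 <= \int[leb]_(x in D) (\sum_(i < n) g i x * partial i f x) +
           \int[leb]_(x in D) (c x * u x * f x).

End sobolev.

(* Main.v *)
(* The negative part w of u satisfies, by Kato's inequality,
     \int grad w . grad z <= \int c^- w z   for all test functions z >= 0,
   where w and z lie in L^q, q = 2n/(n-2), so that by Hoelder's inequality the
   right-hand side is at most |c^-|_{n/2} |w|_q |z|_q.  Since w belongs to H^1_0,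
   it is the limit in H^1 of test functions f_j; with
   z_j = sqrt (f_j^2 + e_j^2) - e_j and e_j -> 0, the left-hand side tends to the
   Dirichlet energy E of w, while Sobolev's inequality |f|_q <= g |grad f|_2
   bounds the right-hand side by g^2 |c^-|_{n/2} (2E + o(1)).  If |c^-|_{n/2} is
   small this forces E = 0, and w = 0 by Sobolev's inequality again.

   Kato's inequality is obtained by mollifying u, which gives a classical
   supersolution on smaller balls, and by composing it with
   (sqrt (t^2 + e^2) - t) / 2.  Sobolev's inequality is the
   Gagliardo-Nirenberg one: |f|^g is bounded by the integral of its derivative along
   each coordinate line, and these line integrals are multiplied by means of the
   Loomis-Whitney inequality. *)

Require Import Defs.
From HB Require Import structures.
From mathcomp Require Import all_boot all_order all_algebra.
From mathcomp Require Import all_classical all_reals all_analysis.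
From mathcomp Require Import measurable_realfun ring lra.
Set Implicit Arguments.
Unset Strict Implicit.
Unset Printing Implicit Defensive.
Import Order.TTheory GRing.Theory Num.Theory.
Import numFieldNormedType.Exports.
Local Open Scope classical_set_scope.
Local Open Scope ring_scope.

(** * Translation invariance of the Lebesgue measure *)

(** A weak gradient of the negative part [W] of [u] is supplied only by its membership in [H10].
    Kato's inequality is therefore proved in very weak form, with both derivatives on the test
    function, and the gradient enters when one of them is moved back. The integral of [c u z]
    already needs an argument: boundary control is given for [W] alone, so [u] is placed in L^q only
    locally, by Sobolev's inequality for mollifications of [u] multiplied by a cutoff. The [f_j]
    tending to [W] may change sign, whereas admissible test functions are nonnegative and smooth;
    this is the reason for sqrt (f_j^2 + e_j^2) - e_j, whose gradient is no larger than that of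
    [f_j]. For these gradients a lower bound on the limit of their pairing with the gradient of [W]
    is enough; it follows from their L^2 bound and from the L^2 convergence of the functions. L^q
    bounds are taken at gradient energy 2E + 2d, the factor 2 coming from (a + b)^2 <= 2 a^2 + 2
    b^2. With k = 1 / (8 g^2) and dimension n one arrives at E - n d <= (E + d) / 4 for every d >
    0. *)

Section lebesgue_integral_rV.
Context {R : realType}.
Local Open Scope ereal_scope.
Local Notation leb := (@lebesgue_rV R).
Local Notation mu := (@lebesgue_measure R).

Lemma ge0_integral_rV_cons n (F : 'rV[R]_n.+1 -> \bar R) :
  measurable_fun setT F -> (forall x, 0 <= F x) ->
  \int[leb n.+1]_x F x = \int[mu]_t \int[leb n]_v F (rV_cons (t, v)).
Proof.
move=> mF F0; rewrite /= /lebesgue_rV_step.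
rewrite ge0_integral_pushforward//=; last exact: measurable_rV_cons.
rewrite preimage_setT fubini_tonelli1//.
by apply: measurableT_comp => //; exact: measurable_rV_cons.
Qed.

Lemma measurable_rV_cons_comp n (F : 'rV[R]_n.+1 -> \bar R) :
  measurable_fun setT F ->
  measurable_fun setT (fun p : measurableTypeR R * 'rV[R]_n => F (rV_cons p)).
Proof. by move=> mF; apply: measurableT_comp => //; exact: measurable_rV_cons. Qed.

Lemma ge0_integral_rV_cons2 n (F : 'rV[R]_n.+1 -> \bar R) :
  measurable_fun setT F -> (forall x, 0 <= F x) ->
  \int[leb n.+1]_x F x = \int[leb n]_v \int[mu]_t F (rV_cons (t, v)).
Proof.
move=> mF F0; rewrite ge0_integral_rV_cons//.
have := @fubini_tonelli _ _ _ _ _ mu (leb n)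
  (fun p : measurableTypeR R * 'rV[R]_n => F (rV_cons p)).
by apply => //; exact: measurable_rV_cons_comp.
Qed.

(** By uniqueness of Lebesgue measure it suffices to look at half-open intervals, whose length a
    shift preserves. *)
Lemma lebesgue_measureD (a : R) (A : set R) : measurable A ->
  pushforward mu ((fun t => t + a)%R : _ -> measurableTypeR R) A = mu A.
Proof.
move=> mA; apply/esym.
apply: (@lebesgue_measure_unique _ (pushforward mu ((fun t => t + a)%R : _ -> measurableTypeR R))) => //=.
  exact: measurable_funD.
move=> _ _ [[b c]] _ <-; rewrite /pushforward.
rewrite (_ : _ @^-1` _ = `](b - a)%R, (c - a)%R]%classic); last first.
  by apply/seteqP; split => t /=; rewrite !in_itv/= ltrBlDr lerBrDr.
rewrite !lebesgue_measure_itv/= !lte_fin ltrD2r; case: ifPn => // _.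
by rewrite -!EFinD opprB addrA subrK.
Qed.

Lemma ge0_integral_shift1 (a : R) (F : R -> \bar R) :
  measurable_fun setT F -> (forall x, 0 <= F x) ->
  \int[mu]_t F (t + a)%R = \int[mu]_t F t.
Proof.
move=> mF F0.
have ma : measurable_fun setT ((fun t => t + a)%R : _ -> measurableTypeR R).
  exact: measurable_funD.
transitivity (\int[pushforward mu ((fun t => t + a)%R : _ -> measurableTypeR R)]_t F t).
  by rewrite ge0_integral_pushforward// preimage_setT.
by apply: eq_measure_integral => A mA _; exact: lebesgue_measureD.
Qed.

Lemma measurable_rV_shift n (a : 'rV[R]_n) :
  measurable_fun setT (fun x : 'rV[R]_n => x + a)%R.
Proof.
apply/measurable_fun_rVP => i; under eq_fun do rewrite mxE.
by apply: measurable_funD => //; exact: measurable_rV_coord.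
Qed.

Lemma rV_consD n (t s : R) (v w : 'rV[R]_n) :
  (rV_cons (t, v) + rV_cons (s, w) = rV_cons (t + s, v + w))%R.
Proof.
apply/rowP => i; case: (unliftP ord0 i) => [j ->|->].
  by rewrite mxE !rV_consS /= mxE.
by rewrite mxE !rV_cons0.
Qed.

Lemma rV_unconsK n : cancel (@rV_uncons R n) (@rV_cons R n).
Proof.
move=> x; apply/rowP => i; case: (unliftP ord0 i) => [j ->|->].
  by rewrite rV_consS mxE.
by rewrite rV_cons0.
Qed.

(** Splitting off the first coordinate of the variable and of the shift leaves a one-dimensional
    shift and the induction hypothesis; dimension 0 is a single point. *)
Lemma ge0_integral_shift n (a : 'rV[R]_n) (F : 'rV[R]_n -> \bar R) :
  measurable_fun setT F -> (forall x, 0 <= F x) ->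
  \int[leb n]_x F (x + a)%R = \int[leb n]_x F x.
Proof.
elim: n a F => [|n IH] a F mF F0.
  by apply: eq_integral => x _; congr F; apply/rowP => -[].
have mFa : measurable_fun setT (fun x : 'rV[R]_n.+1 => F (x + a)%R).
  by apply: (measurableT_comp mF); exact: measurable_rV_shift.
rewrite (ge0_integral_rV_cons mFa)//.
rewrite -(rV_unconsK a); case: (rV_uncons a) => s w.
rewrite [RHS](ge0_integral_rV_cons mF F0) -[in RHS](@ge0_integral_shift1 s).
- apply: eq_integral => t _; rewrite -[RHS](IH w)//.
    by apply: eq_integral => v _; rewrite rV_consD.
  apply: (@measurableT_comp _ _ _ _ _ _ _ _ (fun v => (t + s, v))%R
    (measurable_rV_cons_comp mF)) => //; exact: measurable_pair1.
- have := @measurable_fun_fubini_tonelli_F _ _ _ _ _ (leb n)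
    (fun p : measurableTypeR R * 'rV[R]_n => F (rV_cons p)).
  by apply => //; exact: measurable_rV_cons_comp.
- by move=> t; apply: integral_ge0.
Qed.

End lebesgue_integral_rV.

(** * The inequalities of Hoelder and Loomis-Whitney *)

Section ereal_powers.
Context {R : realType}.
Local Open Scope ereal_scope.

Lemma prode_ge0 (I : Type) (r : seq I) (f : I -> \bar R) :
  (forall i, 0 <= f i) -> 0 <= \prod_(i <- r) f i.
Proof. by move=> f0; elim/big_ind : _ => // x y x0 y0; exact: mule_ge0. Qed.

Lemma poweR_prod (I : Type) (r : seq I) (f : I -> \bar R) (a : R) :
  (forall i, 0 <= f i) -> (\prod_(i <- r) f i) `^ a = \prod_(i <- r) f i `^ a.
Proof.
move=> f0; elim: r => [|i r IH]; first by rewrite !big_nil poweR1r.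
by rewrite !big_cons poweRM ?IH// prode_ge0.
Qed.

Lemma le_poweR (a : R) (x y : \bar R) : (0 <= a)%R -> 0 <= x -> x <= y ->
  x `^ a <= y `^ a.
Proof.
move=> a0 x0 xy; apply: (gt0_ler_poweR a0) => //; rewrite in_itv/= leey andbT//.
exact: le_trans xy.
Qed.

Lemma emeasurable_prod d (T : measurableType d) (I : Type) (r : seq I)
    (f : I -> T -> \bar R) :
  (forall i, measurable_fun [set: T] (f i)) ->
  measurable_fun [set: T] (fun x => \prod_(i <- r) f i x).
Proof.
move=> mf; elim: r => [|i r IH].
  by under eq_fun do rewrite big_nil; exact: measurable_cst.
by under eq_fun do rewrite big_cons; exact: emeasurable_funM.
Qed.

Lemma measurable_fun_poweR d (T : measurableType d) (f : T -> \bar R) (a : R) :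
  measurable_fun [set: T] f -> measurable_fun [set: T] (fun x => f x `^ a).
Proof. exact: (measurableT_comp (measurable_poweR _)). Qed.

Lemma measurable_fun_powR d (T : measurableType d) (f : T -> R) (a : R) :
  measurable_fun [set: T] f -> measurable_fun [set: T] (fun x => f x `^ a)%R.
Proof. exact: (@measurableT_comp _ _ _ _ _ _ (@powR R ^~ a)). Qed.

End ereal_powers.

Section hoelder_nonneg.
Context d (T : measurableType d) (R : realType).
Variable m : {measure set T -> \bar R}.
Local Open Scope ereal_scope.

Lemma ae_fin_ge0_integral (f : T -> \bar R) :
  measurable_fun setT f -> (forall x, 0 <= f x) -> \int[m]_x f x < +oo ->
  {ae m, forall x, f x \is a fin_num}.
Proof.
move=> mf f0 fy; have intf : m.-integrable setT f.
  apply/integrableP; split=> //; under eq_integral do rewrite gee0_abs//.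
  exact: fy.
by apply: filterS (integrable_ae measurableT intf) => x; exact.
Qed.

Lemma integral_eq0_ae (f : T -> \bar R) :
  measurable_fun setT f -> (forall x, 0 <= f x) -> \int[m]_x f x = 0 ->
  {ae m, forall x, f x = 0}.
Proof.
move=> mf f0 fE; apply: filterS (_ : ae_eq m setT f (cst 0)).
  by move=> x; exact.
apply/ae_eq_integral_abs => //; rewrite -[RHS]fE; apply: eq_integral => x _.
by rewrite gee0_abs.
Qed.

(** Values in [0, +oo] are allowed because line integrals may be infinite. Once both integrals are
    positive and finite, [f] and [g] are finite almost everywhere, and Hoelder's inequality with
    exponents 1/a and 1/b applies to [f^a] and [g^b]. *)
Lemma ge0_hoelder (f g : T -> \bar R) (a b : R) :
  measurable_fun setT f -> measurable_fun setT g ->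
  (forall x, 0 <= f x) -> (forall x, 0 <= g x) ->
  (0 < a)%R -> (0 < b)%R -> (a + b = 1)%R ->
  \int[m]_x (f x `^ a * g x `^ b) <= (\int[m]_x f x) `^ a * (\int[m]_x g x) `^ b.
Proof.
move=> mf mg f0 g0 a0 b0 ab.
have mfa : measurable_fun setT (fun x => f x `^ a) by exact: measurable_fun_poweR.
have mgb : measurable_fun setT (fun x => g x `^ b) by exact: measurable_fun_poweR.
have mfg : measurable_fun setT (fun x => f x `^ a * g x `^ b).
  exact: emeasurable_funM.
have if0 : 0 <= \int[m]_x f x by exact: integral_ge0.
have ig0 : 0 <= \int[m]_x g x by exact: integral_ge0.
(* The zero cases come before the infinite ones: the integrand then vanishes almost everywhere,
   whatever the other integral is. In the infinite cases below, the other factor is positive and the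
   right-hand side is +oo. *)
have [fE|fn0] := eqVneq (\int[m]_x f x) 0.
  rewrite (ae_eq_integral (cst 0)) ?integral0//.
  - by rewrite mule_ge0 ?poweR_ge0.
  - apply: filterS (integral_eq0_ae mf f0 fE) => x + _ => ->.
    by rewrite poweR0r ?gt_eqF// mul0e.
have [gE|gn0] := eqVneq (\int[m]_x g x) 0.
  rewrite (ae_eq_integral (cst 0)) ?integral0//.
  - by rewrite mule_ge0 ?poweR_ge0.
  - apply: filterS (integral_eq0_ae mg g0 gE) => x + _ => ->.
    by rewrite [X in _ * X]poweR0r ?gt_eqF// mule0.
have [fy|fy] := eqVneq (\int[m]_x f x) +oo.
  by rewrite fy poweRyr ?gt_eqF// gt0_mulye ?leey// poweR_gt0// lt0e gn0.
have [gy|gy] := eqVneq (\int[m]_x g x) +oo.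
  by rewrite gy poweRyr ?gt_eqF// gt0_muley ?leey// poweR_gt0// lt0e fn0.
have ff := ae_fin_ge0_integral mf f0 (etrans (ltey _) fy).
have gf := ae_fin_ge0_integral mg g0 (etrans (ltey _) gy).
have mF : measurable_fun setT (fun x => fine (f x) `^ a)%R.
  by apply: measurable_fun_powR; exact: measurableT_comp.
have mG : measurable_fun setT (fun x => fine (g x) `^ b)%R.
  by apply: measurable_fun_powR; exact: measurableT_comp.
have := @hoelder _ _ _ m _ _ a^-1 b^-1 mF mG.
rewrite !invr_gt0 !invrK => /(_ a0 b0 ab); rewrite Lnorm1 unlock/= !invrK => H.
rewrite (ae_eq_integral
  (fun x => `|(fine (f x) `^ a * fine (g x) `^ b)%:E|)) //; last 2 first.
- by apply: measurableT_comp => //; apply/measurable_EFinP; exact: measurable_funM.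
- apply: filterS2 ff gf => x fx gx _.
  rewrite -[in LHS](fineK fx) -[in LHS](fineK gx) !poweR_EFin -EFinM gee0_abs//.
  by rewrite lee_fin mulr_ge0// powR_ge0.
apply: (le_trans H); rewrite le_eqVlt; apply/orP; left; apply/eqP.
congr (_ `^ _ * _ `^ _); apply: ae_eq_integral => //.
- by apply/measurable_EFinP/measurable_fun_powR; exact: measurableT_comp.
- apply: filterS ff => x fx _ /=; rewrite ger0_norm ?powR_ge0// -powRrM.
  by rewrite mulfV ?gt_eqF// powRr1 ?fine_ge0// fineK.
- by apply/measurable_EFinP/measurable_fun_powR; exact: measurableT_comp.
- apply: filterS gf => x gx _ /=; rewrite ger0_norm ?powR_ge0// -powRrM.
  by rewrite mulfV ?gt_eqF// powRr1 ?fine_ge0// fineK.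
Qed.

(** Induction on the number of factors: Hoelder with weights 1/(k+2) and (k+1)/(k+2) separates the
    first function, and the product of the others is raised to the power that restores the exponent
    1/(k+1). *)
Lemma ge0_hoelder_prod k (f : 'I_k.+1 -> T -> \bar R) :
  (forall i, measurable_fun setT (f i)) -> (forall i x, 0 <= f i x) ->
  \int[m]_x (\prod_i f i x `^ (k.+1%:R^-1)) <=
  \prod_i (\int[m]_x f i x) `^ (k.+1%:R^-1).
Proof.
elim: k f => [|k IH] f mf f0.
  rewrite big_ord1 invr1 poweRe1 ?integral_ge0// le_eqVlt; apply/orP; left.
  by apply/eqP/eq_integral => x _; rewrite big_ord1 poweRe1.
rewrite big_ord_recl; under eq_integral do rewrite big_ord_recl.
pose g x := \prod_(i < k.+1) f (lift ord0 i) x `^ (k.+1%:R^-1).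
have kE : (k.+1%:R^-1 * (k.+1%:R / k.+2%:R) = k.+2%:R^-1 :> R)%R.
  by rewrite mulrA mulVf ?mul1r// pnatr_eq0.
have gE x : g x `^ (k.+1%:R / k.+2%:R) =
    \prod_(i < k.+1) f (lift ord0 i) x `^ (k.+2%:R^-1).
  rewrite poweR_prod//; last by move=> i; exact: poweR_ge0.
  by apply: eq_bigr => i _; rewrite -poweRrM kE.
under eq_integral do rewrite -gE.
apply: (le_trans (ge0_hoelder _ _ _ _ _ _ _)) => //.
- by apply: emeasurable_prod => i; exact: measurable_fun_poweR.
- by move=> x; apply: prode_ge0 => i; exact: poweR_ge0.
- by rewrite -[X in (X + _)%R]mul1r -mulrDl -[1%R]/(1%:R : R)%R -natrD add1n mulfV// pnatr_eq0.
apply: lee_pmul => //; [exact: poweR_ge0|exact: poweR_ge0|].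
apply: (@le_trans _ _ ((\prod_(i < k.+1) (\int[m]_x f (lift ord0 i) x) `^ (k.+1%:R^-1))
   `^ (k.+1%:R / k.+2%:R))).
  apply: le_poweR.
  - by rewrite divr_ge0.
  - by apply: integral_ge0 => x _; apply: prode_ge0 => i; exact: poweR_ge0.
  - exact: (IH (fun i => f (lift ord0 i))).
rewrite poweR_prod; last by move=> i; exact: poweR_ge0.
by under eq_bigr do rewrite -poweRrM kE.
Qed.
End hoelder_nonneg.

(** * The Loomis-Whitney inequality *)

Section loomis_whitney.
Context {R : realType}.
Local Open Scope ereal_scope.
Local Notation leb := (@lebesgue_rV R).
Local Notation mu := (@lebesgue_measure R).

Definition rV_upd n (i : 'I_n) (x : 'rV[R]_n) (t : R) : 'rV[R]_n :=
  (\row_j (if j == i then t else x ord0 j))%R.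

Lemma rV_upd0 n (t s : R) (v : 'rV[R]_n) :
  rV_upd ord0 (rV_cons (s, v)) t = rV_cons (t, v).
Proof.
apply/rowP => i; case: (unliftP ord0 i) => [j ->|->].
  by rewrite mxE !rV_consS eq_sym (negbTE (neq_lift _ _)).
by rewrite mxE eqxx !rV_cons0.
Qed.

Lemma rV_updS n (j : 'I_n) (t s : R) (v : 'rV[R]_n) :
  rV_upd (lift ord0 j) (rV_cons (s, v)) t = rV_cons (s, rV_upd j v t).
Proof.
apply/rowP => i; case: (unliftP ord0 i) => [k ->|->].
  by rewrite mxE !rV_consS /= mxE (inj_eq lift_inj).
by rewrite mxE !rV_cons0 (negbTE (neq_lift _ _)).
Qed.

Lemma measurable_rV_upd n (i : 'I_n) : measurable_fun setT
  (fun p : 'rV[R]_n * measurableTypeR R => rV_upd i p.1 p.2 : 'rV[R]_n).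
Proof.
apply/measurable_fun_rVP => j; under eq_fun do rewrite mxE.
case: (j == i); first exact: measurable_snd.
exact: (measurableT_comp (@measurable_rV_coord _ R n j) measurable_fst).
Qed.

(** The value ignores coordinate [i] of [x]; keeping the whole vector as argument gives all the
    factors of a product the same domain. *)
Definition line_integral n (i : 'I_n) (G : 'rV[R]_n -> \bar R) (x : 'rV[R]_n) :=
  \int[mu]_t G (rV_upd i x t).

Lemma line_integral_ge0 n (i : 'I_n) (G : 'rV[R]_n -> \bar R) x :
  (forall x, 0 <= G x) -> 0 <= line_integral i G x.
Proof. by move=> G0; apply: integral_ge0. Qed.

Lemma measurable_line_integral n (i : 'I_n) (G : 'rV[R]_n -> \bar R) :
  measurable_fun setT G -> (forall x, 0 <= G x) ->
  measurable_fun setT (line_integral i G).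
Proof.
move=> mG G0.
have := @measurable_fun_fubini_tonelli_F _ _ _ _ _ mu
  (fun p : 'rV[R]_n * measurableTypeR R => G (rV_upd i p.1 p.2)).
by apply => //; apply: measurableT_comp => //; exact: measurable_rV_upd.
Qed.

Lemma measurable_integral_cons n (G : 'rV[R]_n.+1 -> \bar R) :
  measurable_fun setT G -> (forall x, 0 <= G x) ->
  measurable_fun setT (fun v : 'rV[R]_n => \int[mu]_t G (rV_cons (t, v))).
Proof.
move=> mG G0.
have := @measurable_fun_fubini_tonelli_G _ _ _ _ _ mu
  (fun p : measurableTypeR R * 'rV[R]_n => G (rV_cons p)).
by apply => //; exact: measurable_rV_cons_comp.
Qed.

Lemma measurable_cons_l n (G : 'rV[R]_n.+1 -> \bar R) (v : 'rV[R]_n) :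
  measurable_fun setT G ->
  measurable_fun setT (fun t : measurableTypeR R => G (rV_cons (t, v))).
Proof.
move=> mG; apply: (measurableT_comp (measurable_rV_cons_comp mG)).
exact: measurable_pair2.
Qed.

Lemma measurable_cons_r n (G : 'rV[R]_n.+1 -> \bar R) (t : R) :
  measurable_fun setT G ->
  measurable_fun setT (fun v : 'rV[R]_n => G (rV_cons (t, v))).
Proof.
move=> mG; apply: (measurableT_comp (measurable_rV_cons_comp mG)).
exact: measurable_pair1.
Qed.

(** Tonelli's theorem in two variables: integrating out the first coordinate turns a line integral
    in a later direction into a line integral one dimension lower. *)
Lemma line_integral_cons n (j : 'I_n) (G : 'rV[R]_n.+1 -> \bar R) (v : 'rV[R]_n) :
  measurable_fun setT G -> (forall x, 0 <= G x) ->
  \int[mu]_s line_integral (lift ord0 j) G (rV_cons (s, v)) =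
  line_integral j (fun w => \int[mu]_s G (rV_cons (s, w))) v.
Proof.
move=> mG G0; rewrite /line_integral.
under eq_integral do under eq_integral do rewrite rV_updS.
have := @fubini_tonelli _ _ _ _ _ mu mu
  (fun p : measurableTypeR R * measurableTypeR R =>
    G (rV_cons (p.1, rV_upd j v p.2))).
apply => //.
apply: (measurableT_comp (measurable_rV_cons_comp mG)) => /=.
apply/measurable_fun_pairP; split => /=; first exact: measurable_fst.
have := measurableT_comp (@measurable_rV_upd n j) (measurable_pair1 v).
by move=> /measurableT_comp; apply; exact: measurable_snd.
Qed.

Lemma ge0_integral_rV1 (F : 'rV[R]_1 -> \bar R) (x : 'rV[R]_1) :
  measurable_fun setT F -> (forall x, 0 <= F x) ->
  \int[leb 1]_x F x = line_integral ord0 F x.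
Proof.
move=> mF F0; rewrite ge0_integral_rV_cons//; apply: eq_integral => t _.
rewrite -(rV_unconsK x); case: (rV_uncons x) => s v; rewrite rV_upd0.
rewrite [LHS]integral_dirac//; last exact: measurable_cons_r.
by rewrite diracT mul1e; congr (F (rV_cons (_, _))); apply/rowP => -[].
Qed.

(** The classical factor independent of coordinate [i] is here a line integral of [G i], which is
    how the Sobolev inequality produces it. The exponent is 1 / (dimension - 1). *)
Definition loomis_whitney_dim n := forall G : 'I_n.+2 -> 'rV[R]_n.+2 -> \bar R,
  (forall i, measurable_fun setT (G i)) -> (forall i x, 0 <= G i x) ->
  \int[leb n.+2]_x (\prod_i (line_integral i (G i) x) `^ (n.+1%:R^-1)) <=
  \prod_i (\int[leb n.+2]_x G i x) `^ (n.+1%:R^-1).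

(* The factor K is the data of the direction already integrated out; this is the
   form that passes from dimension n to n + 1 in the induction. *)
Definition weighted_loomis_whitney_dim n := forall (K : 'rV[R]_n.+1 -> \bar R)
    (G : 'I_n.+1 -> 'rV[R]_n.+1 -> \bar R),
  measurable_fun setT K -> (forall x, 0 <= K x) ->
  (forall i, measurable_fun setT (G i)) -> (forall i x, 0 <= G i x) ->
  \int[leb n.+1]_x (K x `^ (n.+1%:R^-1) *
     \prod_i (line_integral i (G i) x) `^ (n.+1%:R^-1)) <=
  (\int[leb n.+1]_x K x) `^ (n.+1%:R^-1) *
     \prod_i (\int[leb n.+1]_x G i x) `^ (n.+1%:R^-1).

(** In dimension 1 the line integral is the constant [\int G], and equality holds. *)
Lemma weighted_loomis_whitney_dim0 : weighted_loomis_whitney_dim 0.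
Proof.
move=> K G mK K0 mG G0.
rewrite big_ord1 invr1 !poweRe1; [|exact: integral_ge0..].
rewrite -ge0_integralZr//; last exact: integral_ge0.
rewrite le_eqVlt; apply/orP; left; apply/eqP/eq_integral => x _.
by rewrite big_ord1 !poweRe1// ?line_integral_ge0// -ge0_integral_rV1.
Qed.

(** Hoelder with weights 1/(n+2) and (n+1)/(n+2) separates [K]; the remaining product is the
    (n+1)/(n+2)-th power of the one in [loomis_whitney_dim n]. *)
Lemma weighted_loomis_whitney_dimS n :
  loomis_whitney_dim n -> weighted_loomis_whitney_dim n.+1.
Proof.
move=> IH K G mK K0 mG G0.
pose L i := line_integral i (G i).
have mL i : measurable_fun setT (L i) by exact: measurable_line_integral.
have L0 i x : 0 <= L i x by exact: line_integral_ge0.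
have kE : (n.+1%:R^-1 * (n.+1%:R / n.+2%:R) = n.+2%:R^-1 :> R)%R.
  by rewrite mulrA mulVf ?mul1r// pnatr_eq0.
pose P x := \prod_i L i x `^ (n.+1%:R^-1).
have mP : measurable_fun setT P.
  by apply: emeasurable_prod => i; exact: measurable_fun_poweR.
have P0 x : 0 <= P x by apply: prode_ge0 => i; exact: poweR_ge0.
have PE x : P x `^ (n.+1%:R / n.+2%:R) = \prod_i L i x `^ (n.+2%:R^-1).
  rewrite poweR_prod; last by move=> i; exact: poweR_ge0.
  by apply: eq_bigr => i _; rewrite -poweRrM kE.
under eq_integral do rewrite -PE.
have := @ge0_hoelder _ _ _ (leb n.+2) K P (n.+2%:R^-1) (n.+1%:R / n.+2%:R) mK mP K0 P0.
move=> /(_ _ _ _)/le_trans; apply => //.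
  by rewrite -[X in (X + _)%R]mul1r -mulrDl -[1%R]/(1%:R : R)%R -natrD add1n mulfV// pnatr_eq0.
apply: lee_pmul => //; [exact: poweR_ge0|exact: poweR_ge0|].
have H : \int[leb n.+2]_x P x <= \prod_i (\int[leb n.+2]_x G i x) `^ (n.+1%:R^-1).
  exact: IH.
apply: (@le_trans _ _ ((\prod_i (\int[leb n.+2]_x G i x) `^ (n.+1%:R^-1))
     `^ (n.+1%:R / n.+2%:R))).
    by apply: le_poweR => //; exact: integral_ge0.
  rewrite poweR_prod; last by move=> i; exact: poweR_ge0.
  by under eq_bigr do rewrite -poweRrM kE.
Qed.

(** The first coordinate is integrated out. The line integral in that direction does not depend on
    it and comes out as the weight [K']; the other n+1 factors have exponent 1/(n+1), so Hoelder for
    n+1 functions moves the integral inside each of them. *)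
Lemma loomis_whitney_dimS n :
  weighted_loomis_whitney_dim n -> loomis_whitney_dim n.
Proof.
move=> IH G mG G0.
pose L i := line_integral i (G i).
have mL i : measurable_fun setT (L i) by exact: measurable_line_integral.
have L0 i x : 0 <= L i x by exact: line_integral_ge0.
pose P x := \prod_i L i x `^ (n.+1%:R^-1).
have mP : measurable_fun setT P.
  by apply: emeasurable_prod => i; exact: measurable_fun_poweR.
have P0 x : 0 <= P x by apply: prode_ge0 => i; exact: poweR_ge0.
rewrite ge0_integral_rV_cons2// big_ord_recl.
under eq_integral do under eq_integral do rewrite /P big_ord_recl.
pose K' v := \int[mu]_t G ord0 (rV_cons (t, v)).
have LK t v : L ord0 (rV_cons (t, v)) = K' v.
  by apply: eq_integral => s _; rewrite rV_upd0.
pose G' j v := \int[mu]_s G (lift ord0 j) (rV_cons (s, v)).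
rewrite [X in _ <= X `^ _ * _]ge0_integral_rV_cons2//.
under [X in _ <= _ * X]eq_bigr do rewrite ge0_integral_rV_cons2//.
have mG' j : measurable_fun setT (G' j) by exact: measurable_integral_cons.
have G'0 j v : 0 <= G' j v by exact: integral_ge0.
apply: le_trans (IH K' G' _ _ _ _) => //; last 2 first.
- exact: measurable_integral_cons.
- by move=> v; exact: integral_ge0.
have mL1 (i : 'I_n.+1) v : measurable_fun setT
    (fun t : measurableTypeR R => L (lift ord0 i) (rV_cons (t, v))).
  exact: measurable_cons_l.
have K'0 v : 0 <= K' v by exact: integral_ge0.
apply: ge0_le_integral => //.
- move=> v _; apply: integral_ge0 => t _; apply: mule_ge0; first exact: poweR_ge0.
  by apply: prode_ge0 => i; exact: poweR_ge0.
- rewrite (_ : (fun v => _) = (fun v => \int[mu]_t P (rV_cons (t, v)))).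
    exact: measurable_integral_cons.
  by apply/funext => v; apply: eq_integral => t _; rewrite /P [RHS]big_ord_recl.
- apply: emeasurable_funM.
    by apply: measurable_fun_poweR; exact: measurable_integral_cons.
  by apply: emeasurable_prod => i; apply: measurable_fun_poweR; exact: measurable_line_integral.
move=> v _.
under eq_integral do rewrite -[line_integral ord0 _ _]/(L ord0 _) LK.
rewrite ge0_integralZl//; last 3 first.
- by apply: emeasurable_prod => i; apply: measurable_fun_poweR; exact: mL1.
- by move=> t _; apply: prode_ge0 => i; exact: poweR_ge0.
- exact: poweR_ge0.
apply: lee_pmul => //; first exact: poweR_ge0.
  by apply: integral_ge0 => t _; apply: prode_ge0 => i; exact: poweR_ge0.
have := @ge0_hoelder_prod _ _ _ mu _ (fun i t => L (lift ord0 i) (rV_cons (t, v))).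
move=> /(_ _ _)/le_trans; apply => //.
rewrite le_eqVlt; apply/orP; left; apply/eqP; apply: eq_bigr => i _.
by congr (_ `^ _); rewrite line_integral_cons.
Qed.

Lemma loomis_whitney n : loomis_whitney_dim n.
Proof.
by elim: n => [|n IH]; apply: loomis_whitney_dimS;
  [exact: weighted_loomis_whitney_dim0|exact: weighted_loomis_whitney_dimS].
Qed.

End loomis_whitney.

(** * Smooth functions *)

(** Both sides have the same difference quotients. This brings directional derivatives within reach
    of one-variable calculus, in particular of its chain rule. *)
Lemma is_derive_line {R : realType} {V : normedModType R} (f : V -> R) (x v : V) (df : R) :
  is_derive x v f df <-> is_derive (0 : R) 1 (fun h : R => f (h *: v + x)) df.
Proof.
suff E : 'D_1 (fun h : R => f (h *: v + x)) 0 = 'D_v f x.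
  split=> -[H <-]; first by rewrite -E; apply: DeriveDef; [exact: (derivable1P f x v).1|].
  by rewrite E; apply: DeriveDef; [exact: (derivable1P f x v).2|].
rewrite /derive; set g1 := fun h => h^-1 *: _; set g2 := fun h => h^-1 *: _.
suff -> : g1 = g2 by [].
apply/funext => h; rewrite /g1 /g2 /=.
by rewrite addr0 scale0r add0r [_%:A]mulr1.
Qed.

Section smooth_calculus.
Context {R : realType} {n : nat}.
Local Notation V := 'rV[R]_n.
Implicit Types (f g : V -> R) (i : 'I_n).
Local Notation e_ i := (delta_mx ord0 i : V).

Lemma is_derive_comp1 (h : R -> R) f x (v : V) (dh df : R) :
  is_derive (f x) 1 h dh -> is_derive x v f df ->
  is_derive x v (fun y => h (f y)) (dh * df).
Proof.
move=> H /is_derive_line F; apply/is_derive_line.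
apply: (@is_derive1_comp _ h (fun t : R => f (t *: v + x))) => //.
by rewrite scale0r add0r.
Qed.

Lemma is_derive_reflect f (a x v : V) (df : R) :
  is_derive (a - x) v f df -> is_derive x v (fun y => f (a - y)) (- df).
Proof.
move=> /is_derive_line F; apply/is_derive_line.
rewrite (_ : (fun h => _) = (fun h => f (h *: v + (a - x))) \o -%R); last first.
  by apply/funext => h /=; congr f; rewrite scaleNr opprD addrCA.
rewrite -mulrN1; apply: is_derive1_comp; rewrite ?oppr0//.
Qed.

Lemma is_derive_coord i j x :
  is_derive x (e_ i) (fun y : V => y ord0 j) (i == j)%:R.
Proof.
apply/is_derive_line.
rewrite (_ : (fun h : R => _) = (fun h => h * (i == j)%:R + x ord0 j)); last first.
  by apply/funext => h /=; rewrite !mxE eqxx/= eq_sym.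
rewrite -[X in is_derive _ _ _ X]addr0; apply: is_deriveD.
rewrite (_ : (fun h : R => _) = (i == j)%:R *: (@idfun R)); last first.
  by apply/funext => h /=; rewrite mulrC.
by apply: is_derive_eq; rewrite [LHS]mulr1.
Qed.

Definition smooth1 (h : R -> R) := forall k (x : R), derivable (derive1n k h) x 1.

Lemma smooth1_derive h : smooth1 h -> smooth1 (derive1 h).
Proof. by move=> sh k x; rewrite -derive1Sn; exact: sh. Qed.

Lemma smooth1_is_derive (h : R -> R) (x : R) : smooth1 h -> is_derive x 1 h ((derive1 h) x).
Proof. by move=> /(_ 0%N x) sh; rewrite derive1E; apply: DeriveDef. Qed.

Lemma smooth1_continuous h : smooth1 h -> continuous h.
Proof.
by move=> /(_ 0%N) sh x; apply: differentiable_continuous; apply/derivable1_diffP; exact: sh.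
Qed.

Lemma smooth_partial i f : smooth f -> smooth (partial i f).
Proof. by move=> sf s; have := sf (rcons s i); rewrite foldr_rcons. Qed.

Lemma smooth_is_derive f i x : smooth f -> is_derive x (e_ i) f (partial i f x).
Proof. by move=> /(_ [::])[_ /(_ i x) df]; apply: DeriveDef. Qed.

Lemma smooth_continuous f : smooth f -> continuous f.
Proof. by case/(_ [::]). Qed.

(* Iterated derivatives have no closed form under products and compositions, so
   smoothness is deduced from a class of functions stable under partial
   derivatives. *)
Inductive smooth_gen : (V -> R) -> Prop :=
| smooth_gen_smooth f of smooth f : smooth_gen f
| smooth_gen_cst c : smooth_gen (fun=> c)
| smooth_gen_coord i : smooth_gen (fun x => x ord0 i)
| smooth_genD f g of smooth_gen f & smooth_gen g : smooth_gen (fun x => f x + g x)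
| smooth_genM f g of smooth_gen f & smooth_gen g : smooth_gen (fun x => f x * g x)
| smooth_gen_comp h f of smooth1 h & smooth_gen f : smooth_gen (fun x => h (f x))
| smooth_gen_reflect a f of smooth_gen f : smooth_gen (fun x => f (a - x)).

Lemma smooth_gen_continuous f : smooth_gen f -> continuous f.
Proof.
elim=> {f} [f sf|c|i|f g _ cf _ cg|f g _ cf _ cg|h f sh _ cf|a f _ cf] x.
- exact: smooth_continuous.
- exact: cst_continuous.
- exact: coord_continuous.
- exact: (continuousD (cf x) (cg x)).
- exact: (continuousM (cf x) (cg x)).
- by apply: continuous_comp; [exact: cf|exact: smooth1_continuous].
- apply: (@continuous_comp _ _ _ (fun y : V => a - y) f); last exact: cf.
  by apply: continuousB; [exact: cst_continuous|move=> ?; exact: cvg_id].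
Qed.

Lemma smooth_gen_derive f i : smooth_gen f ->
  exists2 g, smooth_gen g & forall x, is_derive x (e_ i) f (g x).
Proof.
elim=> {f} [f|c|j|f g sf [f' sf' df] sg [g' sg' dg]
   |f g sf [f' sf' df] sg [g' sg' dg]|h f sh sf [f' sf' df]|a f sf [f' sf' df]].
- move=> sf; exists (partial i f).
    by apply: smooth_gen_smooth; exact: smooth_partial.
  by move=> x; exact: smooth_is_derive.
- by exists (fun=> 0); [exact: smooth_gen_cst|move=> x; exact: is_derive_cst].
- exists (fun=> (i == j)%:R); [exact: smooth_gen_cst|move=> x].
  exact: is_derive_coord.
- exists (fun x => f' x + g' x); [exact: smooth_genD|move=> x].
  exact: is_deriveD.
- exists (fun x => f x * g' x + g x * f' x).
    by apply: smooth_genD; exact: smooth_genM.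
  move=> x; exact: is_deriveM.
- exists (fun x => (derive1 h) (f x) * f' x).
    exact: smooth_genM (smooth_gen_comp (smooth1_derive sh) sf) sf'.
  by move=> x; apply: is_derive_comp1 (df x); exact: smooth1_is_derive.
- exists (fun x => -1 * f' (a - x)).
    by apply: smooth_genM; [exact: smooth_gen_cst|exact: smooth_gen_reflect].
  by move=> x; rewrite mulN1r; exact: is_derive_reflect.
Qed.

Lemma partialE f i g : (forall x, is_derive x (e_ i) f (g x)) -> partial i f = g.
Proof. by move=> H; apply/funext => x; rewrite /partial; exact: derive_val. Qed.

Lemma smooth_genP f : smooth_gen f -> smooth f.
Proof.
move=> sf s; elim: s f sf => [|i s IH] f sf /=.
  split; first exact: smooth_gen_continuous.
  by move=> i x; have [g _ /(_ x)[]] := smooth_gen_derive i sf.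
have [sg] : smooth_gen (foldr partial f s) /\ True.
  split => //; elim: s {IH} => //= j s IH.
  have [g sg H] := smooth_gen_derive j IH.
  by rewrite (partialE H).
move=> _; have [g sg' H] := smooth_gen_derive i sg.
rewrite (partialE H); split; first exact: smooth_gen_continuous.
by move=> j x; have [g' _ /(_ x)[]] := smooth_gen_derive j sg'.
Qed.

Lemma smoothM f g : smooth f -> smooth g -> smooth (fun x => f x * g x).
Proof. by move=> sf sg; apply/smooth_genP/smooth_genM; exact: smooth_gen_smooth. Qed.

Lemma smooth_comp h f : smooth1 h -> smooth f -> smooth (fun x => h (f x)).
Proof. by move=> sh sf; apply/smooth_genP/smooth_gen_comp => //; exact: smooth_gen_smooth. Qed.

Lemma smooth_reflect a f : smooth f -> smooth (fun x => f (a - x)).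
Proof. by move=> sf; apply/smooth_genP/smooth_gen_reflect; exact: smooth_gen_smooth. Qed.

Lemma partialM f g i : smooth f -> smooth g ->
  partial i (fun x => f x * g x) = (fun x => f x * partial i g x + g x * partial i f x).
Proof.
by move=> sf sg; apply: partialE => x; apply: is_deriveM; exact: smooth_is_derive.
Qed.

Lemma partial_comp h f i : smooth1 h -> smooth f ->
  partial i (fun x => h (f x)) = (fun x => (derive1 h) (f x) * partial i f x).
Proof.
move=> sh sf; apply: partialE => x.
by apply: is_derive_comp1; [exact: smooth1_is_derive|exact: smooth_is_derive].
Qed.

Lemma partial_reflect a f i : smooth f ->
  partial i (fun x => f (a - x)) = (fun x => - partial i f (a - x)).
Proof.
by move=> sf; apply: partialE => x; apply: is_derive_reflect; exact: smooth_is_derive.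
Qed.

End smooth_calculus.

(** * Borel sets and compact supports in R^n *)

Section borel_rV.
Context {R : realType} {n : nat}.
Local Notation V := 'rV[R]_n.
Local Notation leb := (@lebesgue_rV R n).

Lemma ball_rVP (x y : V) (e : R) : 0 < e ->
  ball x e y <-> forall i, `|x ord0 i - y ord0 i| < e.
Proof.
move=> e0; split=> [[_ H] i|H]; first exact: H.
by split=> // i j; rewrite ord1; exact: H.
Qed.

Lemma rV_norm_coord (x : V) i : `|x ord0 i| <= `|x|.
Proof.
have /mapP[j Hj ->] : `|x ord0 i| \in [seq `|x k.1 k.2| | k : 'I_1 * 'I_n].
  by apply/mapP; exists (ord0, i) => //=; rewrite mem_enum.
by rewrite [leRHS]/Num.norm /= mx_normrE; apply/bigmax_geP; right => /=; exists j.
Qed.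

(** An open set is the union of the countably many boxes with rational centre and half-side 1/(k+1)
    that it contains. *)
Lemma open_measurable_rV (A : set V) : open A -> measurable A.
Proof.
move=> oA.
pose box (p : 'rV[rat]_n * nat) : set V :=
  [set y | forall i, `|ratr (p.1 ord0 i) - y ord0 i| < p.2.+1%:R^-1].
have -> : A = \bigcup_p (if `[< box p `<=` A >] then box p else set0).
  apply/seteqP; split => [x Ax|x [p _]]; last by case: asboolP => // + px; exact.
  have /nbhs_ballP[e /= e0 xe] := open_nbhs_nbhs (conj oA Ax).
  have [k ke] : exists k : nat, k.+1%:R^-1 < e / 2.
    exists (Num.truncn (e / 2)^-1); rewrite invf_plt ?posrE ?divr_gt0//.
    exact: truncnS_gt.
  have H (i : 'I_n) : exists q : rat, `|ratr q - x ord0 i| < k.+1%:R^-1.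
    have : x ord0 i - k.+1%:R^-1 < x ord0 i + k.+1%:R^-1.
      by rewrite ltrBlDr -addrA ltrDl addr_gt0.
    move=> /rat_in_itvoo[q]; rewrite in_itv/= => qx; exists q.
    by rewrite ltr_distl.
  pose q : 'rV[rat]_n := \row_i sval (cid (H i)).
  have xq : box (q, k) x by move=> i /=; rewrite mxE; case: cid.
  exists (q, k) => //; case: asboolP => // nA; exfalso; apply: nA => y yq.
  apply: xe; apply/ball_rVP => // i.
  rewrite (splitr e) (le_lt_trans (ler_distD (ratr (q ord0 i)) _ _))// ltrD//.
    by rewrite distrC (lt_trans _ ke)//; exact: xq.
  by rewrite (lt_trans _ ke)//; exact: yq.
apply: countable_bigcupT_measurable => [|p]; first exact: countableP.
case: ifPn => // _.
pose B i : set R := [set t | `|ratr (p.1 ord0 i) - t| < p.2.+1%:R^-1].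
apply: (@measurable_rV_box R n B) => i.
by rewrite /B -[X in measurable X]/(ball (ratr (p.1 ord0 i) : R) p.2.+1%:R^-1);
  exact: measurable_ball.
Qed.

Lemma continuous_measurable_rV (f : V -> R) :
  continuous f -> measurable_fun setT f.
Proof.
move=> /continuousP cf; apply: (measurability _ (RGenOpens.measurableE R)).
move=> _ [_ [a [b ->] <-]]; rewrite setTI; apply: open_measurable_rV.
by apply: cf; exact: interval_open.
Qed.

(** Needed in this form for a pi-lambda argument that starts from open sets: coordinates are
    continuous, which gives the inclusion not yet proved. *)
Lemma measurable_rV_open : @measurable _ V = <<s @open V >>.
Proof.
apply/seteqP; split; last first.
  by apply: smallest_sub; [exact: sigma_algebra_measurable|exact: open_measurable_rV].
have mid : measurable_fun setT (id : g_sigma_algebraType (@open V) -> V).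
  apply/measurable_fun_rVP => i; apply: (measurability _ (RGenOpens.measurableE R)).
  move=> _ [_ [a [b ->] <-]]; rewrite setTI; apply: sub_sigma_algebra.
  apply: (@open_comp V R (fun x => x ord0 i)).
    by move=> x _; exact: coord_continuous.
  exact: interval_open.
by move=> A mA; have := mid measurableT A mA; rewrite setTI.
Qed.

Lemma measurable_rV_norm_le (M : R) : measurable [set x : V | `|x| <= M].
Proof.
rewrite -[X in measurable X]setCK; apply: measurableC; apply: open_measurable_rV.
rewrite (_ : ~` _ = (fun x : V => `|x|) @^-1` `]M, +oo[%classic).
  by apply: open_comp; [move=> x _; exact: norm_continuous|exact: interval_open].
by apply/seteqP; split => x /=; rewrite in_itv/= andbT ltNge => /negP.
Qed.

Lemma lebesgue_rV_norm_le (M : R) : (leb [set x : V | `|x| <= M]%R < +oo)%E.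
Proof.
have mB i : measurable ((fun=> `[- M, M]%classic) i : set R) by [].
apply: (@le_lt_trans _ _ (leb [set x : V | forall i : 'I_n, `[- M, M]%classic (x ord0 i)])).
  apply: le_measure; rewrite ?inE; [exact: measurable_rV_norm_le| |].
    exact: (@measurable_rV_box R n (fun=> `[- M, M]%classic)).
  move=> x /= xM i; rewrite in_itv/= -ler_norml.
  exact: le_trans (rV_norm_coord _ _) xM.
rewrite (@lebesgue_rV_box R n (fun=> `[- M, M]%classic))//.
suff [] : (0 <= \prod_(i < n) lebesgue_measure `[(- M)%R, M]%classic)%E /\
  (\prod_(i < n) lebesgue_measure `[(- M)%R, M]%classic < +oo)%E by [].
elim/big_ind : _ => [|x y [x0 xy] [y0 yy]|i _].
- by rewrite ltry.
- by rewrite mule_ge0// lte_mul_pinfty// ge0_fin_numE.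
- by rewrite measure_ge0 lebesgue_measure_itv/=; case: ifPn => //; rewrite -EFinB ltry.
Qed.

End borel_rV.

Section compactly_supported.
Context {R : realType} {n : nat}.
Local Notation V := 'rV[R]_n.
Local Notation leb := (@lebesgue_rV R n).
Implicit Types (f g : V -> R) (i : 'I_n).

(** On R^n this amounts to compactness of the closed support, and it passes more easily to products,
    translates and derivatives. *)
Definition bounded_support f := exists M : R, forall x, f x != 0 -> `|x| <= M.

Definition Ccinfty f := smooth f /\ bounded_support f.

Lemma partial_near0 f i x : (\forall y \near x, f y = 0) -> partial i f x = 0.
Proof.
move=> fx; rewrite /partial (@near_eq_derive _ _ _ f (cst 0)) ?derive_cst//.
Qed.

Lemma closure_subset_closed (A B : set V) : closed B -> A `<=` B -> closure A `<=` B.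
Proof. by move=> /closure_id cB /closureS; rewrite -cB. Qed.

Lemma closure_support_partial f i :
  [set x | partial i f x != 0] `<=` closure [set x | f x != 0].
Proof.
move=> x /= px; apply: contrapT => nx; move/eqP: px; apply.
apply: partial_near0.
have : nbhs x (~` closure [set x | f x != 0]).
  by apply: open_nbhs_nbhs; split => //; apply: closed_openC; exact: closed_closure.
apply: filterS => y yn; apply: contrapT => /eqP fy; apply: yn.
exact: subset_closure.
Qed.

Lemma closed_norm_le (M : R) : closed [set x : V | `|x| <= M].
Proof.
rewrite (_ : mkset _ = (fun x : V => `|x|) @^-1` [set t | t <= M])//.
by apply: closed_comp; [move=> x _; exact: norm_continuous|exact: closed_le].
Qed.

Lemma bounded_support_partial f i : bounded_support f -> bounded_support (partial i f).
Proof.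
move=> [M fM]; exists M => x /closure_support_partial.
apply: (closure_subset_closed (@closed_norm_le M) fM).
Qed.

Lemma Ccinfty_partial f i : Ccinfty f -> Ccinfty (partial i f).
Proof.
by move=> [sf bf]; split; [exact: smooth_partial|exact: bounded_support_partial].
Qed.

Lemma test_functionP (D : set V) f : test_function D f <->
  Ccinfty f /\ closure [set x | f x != 0] `<=` D.
Proof.
split=> [[sf cf fD]|[[sf [M fM]] fD]]; split => //.
  split=> //.
  have /compact_bounded [M [Mr H]] := cf.
  exists (M + 1) => x fx; apply: H; first by rewrite ltrDl.
  exact: subset_closure.
apply: bounded_closed_compact; last exact: closed_closure.
exists M; split; first by rewrite num_real.
move=> N MN x /(closure_subset_closed (@closed_norm_le M) fM) /= xM.
exact: (le_trans xM (ltW MN)).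
Qed.

Lemma test_function_partial (D : set V) f i :
  test_function D f -> test_function D (partial i f).
Proof.
move=> /test_functionP[cf fD]; apply/test_functionP; split.
  exact: Ccinfty_partial.
apply: subset_trans fD; apply: closure_subset_closed; first exact: closed_closure.
exact: closure_support_partial.
Qed.

Lemma continuous_bounded f : continuous f -> bounded_support f ->
  exists2 C : R, 0 <= C & forall x, `|f x| <= C.
Proof.
move=> cf [M fM].
(* The ball may be empty, [M] being of any sign; [f] then vanishes identically. *)
have [K0|K0] := pselect ([set x : V | `|x| <= M] !=set0); last first.
  exists 0 => // x; rewrite normr_le0; apply/eqP; apply: contrapT => /eqP /fM xM.
  by apply: K0; exists x.
have cK : compact [set x : V | `|x| <= M].
  apply: bounded_closed_compact; last exact: closed_norm_le.
  exists M; split; first by rewrite num_real.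
  by move=> N MN x /= xM; exact: (le_trans xM (ltW MN)).
have [c _ H] := @EVT_max_rV R n (fun x => `|f x|) _ K0 cK
  (continuous_subspaceT (fun x => continuous_comp (cf x) (@norm_continuous _ _ (f x)))).
exists `|f c| => // x; have [->|/fM xM] := eqVneq (f x) 0; first by rewrite normr0.
by apply: H; rewrite inE.
Qed.

Lemma Ccinfty_bounded f : Ccinfty f -> exists2 C : R, 0 <= C & forall x, `|f x| <= C.
Proof. by move=> [/smooth_continuous cf bf]; exact: continuous_bounded. Qed.

Lemma smooth_measurable f : smooth f -> measurable_fun setT f.
Proof. by move=> /smooth_continuous; exact: continuous_measurable_rV. Qed.

Lemma bounded_support_integrable f (C : R) : measurable_fun setT f ->
  (forall x, `|f x| <= C) -> bounded_support f -> leb.-integrable setT (EFin \o f).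
Proof.
move=> mf fC [M fM]; set K := [set x : V | `|x| <= M].
have mK : measurable K by exact: measurable_rV_norm_le.
apply: (@le_integrable _ _ _ leb _ measurableT _ (fun x => (C * \1_K x)%:E)).
- exact/measurable_EFinP.
- move=> x _; rewrite lee_fin (le_trans _ (ler_norm _))// indicE.
  have [xK|xK] := boolP (x \in K); first by rewrite mulr1.
  suff -> : f x = 0 by rewrite normr0 mulr0.
  by apply: contrapT => /eqP /fM xM; rewrite notin_setE in xK.
- under eq_fun do rewrite EFinM.
  apply: integrableZl => //; apply/integrableP; split.
    by apply/measurable_EFinP; exact: measurable_indic.
  under eq_integral do rewrite gee0_abs ?lee_fin//.
  by rewrite integral_indic// setIT; exact: lebesgue_rV_norm_le.
Qed.

Lemma Ccinfty_integrable f : Ccinfty f -> leb.-integrable setT (EFin \o f).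
Proof.
move=> cf; have [C C0 fC] := Ccinfty_bounded cf.
by apply: bounded_support_integrable fC _; [apply: smooth_measurable; case: cf|case: cf].
Qed.

Lemma Ccinfty_reflect a f : Ccinfty f -> Ccinfty (fun x => f (a - x)).
Proof.
move=> [sf [M fM]]; split; first exact: smooth_reflect.
exists (M + `|a|) => x /fM xM; rewrite -[x](subKr a).
by rewrite (le_trans (ler_normB _ _))// addrC lerD2r.
Qed.

Lemma CcinftyMl f g : Ccinfty f -> smooth g -> Ccinfty (fun x => f x * g x).
Proof.
move=> [sf [M fM]] sg; split; first exact: smoothM.
by exists M => x; rewrite mulf_eq0 negb_or => /andP[/fM].
Qed.

End compactly_supported.

(** * The Sobolev inequality *)

Section abs_power.
Context {R : realType}.
Implicit Types (a g y : R).
Local Notation mu := (@lebesgue_measure R).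

Lemma is_derive_powR_pos a y : 0 < y ->
  is_derive y (1 : R) (fun z => z `^ a) (a * y `^ (a - 1)).
Proof. by move=> y0; exact: is_derive1_powR. Qed.

Lemma continuous_powR_pos a y : 0 < y -> {for y, continuous (fun z => z `^ a)}.
Proof.
move=> y0; apply: differentiable_continuous; apply/derivable1_diffP.
by have [] := is_derive_powR_pos a y0.
Qed.

Lemma cvg_abs_powR0 a : 0 < a -> `|y| `^ a @[y --> (0 : R)] --> (0 : R).
Proof.
move=> a0; apply/cvgrPdist_lt => e e0; near=> y.
rewrite sub0r normrN ger0_norm ?powR_ge0//.
have -> : e = (e `^ a^-1) `^ a by rewrite -powRrM mulVf ?gt_eqF// powRr1// ltW.
apply: gt0_ltr_powR; rewrite ?nnegrE ?powR_ge0//.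
near: y. apply: (@nbhs0_lt R R). rewrite powR_gt0.
Unshelve. all: by end_near. Qed.

Lemma sg_abs_powR a y : 0 < a -> `|Num.sg y * `|y| `^ a| = `|y| `^ a.
Proof.
move=> a0; rewrite normrM normr_sg (ger0_norm (powR_ge0 _ _)).
by have [->|_] := eqVneq y 0; rewrite ?mul1r// normr0 powR0 ?gt_eqF// mulr0.
Qed.

Lemma continuous_sg_powR a : 0 < a ->
  continuous (fun y : R => Num.sg y * `|y| `^ a).
Proof.
move=> a0 y; have [y0|y0|->] := ltgtP y 0.
- have H : {for y, continuous (fun z : R => - (- z) `^ a)}.
    apply: continuousN; apply: (@continuous_comp _ _ _ -%R (fun z => z `^ a)).
      exact: opp_continuous.
    by apply: continuous_powR_pos; rewrite oppr_gt0.
  rewrite /continuous_at ltr0_sg// ltr0_norm// mulN1r; apply: cvg_trans H.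
  apply: near_eq_cvg; near=> z.
  have z0 : z < 0 by near: z; exact: lt_nbhsl.
  by rewrite ltr0_sg// ltr0_norm// mulN1r.
- rewrite /continuous_at gtr0_sg// gtr0_norm// mul1r.
  apply: cvg_trans (continuous_powR_pos (a := a) y0).
  apply: near_eq_cvg; near=> z.
  have z0 : 0 < z by near: z; exact: lt_nbhsr.
  by rewrite gtr0_sg// gtr0_norm// mul1r.
- rewrite /continuous_at sgr0 mul0r; apply: norm_cvg0.
  under eq_fun do rewrite sg_abs_powR//.
  exact: cvg_abs_powR0.
Unshelve. all: by end_near. Qed.

(** The point 0 is where [1 < g] matters: the difference quotient there has modulus [|h|^(g - 1)],
    which tends to 0. *)
Lemma is_derive_abs_powR g y : 1 < g ->
  is_derive y (1 : R) (fun z => `|z| `^ g) (g * (Num.sg y * `|y| `^ (g - 1))).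
Proof.
move=> g1; have g10 : 0 < g - 1 by rewrite subr_gt0.
have [y0|y0|->] := ltgtP y 0.
- apply: (@near_eq_is_derive _ _ _ ((fun z => z `^ g) \o -%R)).
    by near=> z; rewrite /= ltr0_norm//; near: z; exact: lt_nbhsl.
  rewrite ltr0_sg// mulN1r mulrN ltr0_norm// -[X in is_derive _ _ _ X]mulrN1.
  apply: is_derive1_comp.
  by apply: is_derive_powR_pos; rewrite oppr_gt0.
- apply: (@near_eq_is_derive _ _ _ (fun z => z `^ g)).
    by near=> z; rewrite /= gtr0_norm//; near: z; exact: lt_nbhsr.
  by rewrite gtr0_sg// mul1r gtr0_norm//; exact: is_derive_powR_pos.
- rewrite sgr0 mul0r mulr0.
  have H : (fun h : R => h^-1 *: (`|(h *: (1 : R) + 0) : R| `^ g - `|0 : R| `^ g)) @ (0 : R)^' --> (0 : R).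
    apply: norm_cvg0; apply: (@cvg_trans _ ((fun h => `|h| `^ (g - 1)) @ (0 : R)^')).
      apply: near_eq_cvg; near=> h.
      have h0 : h != 0 by near: h; exact: nbhs_dnbhs_neq.
      rewrite normr0 powR0 ?gt_eqF ?(lt_trans ltr01)// subr0 addr0 normrM normfV.
      rewrite [_ *: _]mulr1 (ger0_norm (powR_ge0 _ _)) powRB ?normr_eq0 ?h0 ?implybT//.
      by rewrite powRr1// mulrC.
    by apply: cvg_within_filter; exact: cvg_abs_powR0.
  apply: DeriveDef; last exact: cvg_lim H.
  by apply/cvg_ex; exists 0.
Unshelve. all: by end_near. Qed.

(** The fundamental theorem of calculus for [|f|^g], from a point left of [t] where [f] vanishes up
    to [t]; the integral of the absolute value of the derivative is then extended to the whole
    line. *)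
Lemma abs_powR_le_integral (f df : R -> R) (g M : R) : 1 < g ->
  (forall t : R, is_derive t (1 : R) f (df t)) -> continuous df ->
  (forall t, f t != 0 -> `|t| <= M) ->
  forall t, ((`|f t| `^ g)%:E <=
    \int[mu]_s (g * (`|f s| `^ (g - 1) * `|df s|))%:E)%E.
Proof.
move=> g1 dF cdf fM t.
have g0 : 0 < g by exact: lt_trans g1.
have g10 : 0 < g - 1 by rewrite subr_gt0.
have cf : continuous f.
  move=> x; apply: differentiable_continuous; apply/derivable1_diffP.
  by have [] := dF x.
pose H s := `|f s| `^ g.
pose dH s := g * (Num.sg (f s) * `|f s| `^ (g - 1)) * df s.
have dHE (s : R) : is_derive s (1 : R) H (dH s).
  by apply: (@is_derive1_comp _ (fun z => `|z| `^ g) f) => //; exact: is_derive_abs_powR.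
have cdH : continuous dH.
  have c1 : continuous (fun s => Num.sg (f s) * `|f s| `^ (g - 1)).
    move=> s; apply: (@continuous_comp _ _ _ f (fun z => Num.sg z * `|z| `^ (g - 1))).
      exact: cf.
    exact: continuous_sg_powR.
  move=> s; exact: (continuousM (continuousM (@cst_continuous _ _ g s) (c1 s)) (cdf s)).
have cH : continuous H.
  move=> x; apply: differentiable_continuous; apply/derivable1_diffP.
  by have [] := dHE x.
have mI : measurable_fun setT (fun s => (g * (`|f s| `^ (g - 1) * `|df s|))%:E).
  apply/measurable_EFinP; apply: measurable_funM => //.
  have mf := continuous_measurable_fun cf; have mdf := continuous_measurable_fun cdf.
  apply: measurable_funM; last exact: measurableT_comp.
  by apply: measurable_fun_powR; exact: measurableT_comp.
have I0 s : 0 <= g * (`|f s| `^ (g - 1) * `|df s|).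
  by rewrite !mulr_ge0 ?powR_ge0// ltW.
(* Left of [t], and outside the support since its absolute value exceeds [M]. *)
pose a := - (`|M| + `|t| + 1).
have at_ : a < t.
  by rewrite /a ltrNl (le_lt_trans (ler_norm _))// normrN -addrA addrC -addrA ltrDl ltr_wpDr.
have fa : f a = 0.
  apply: contrapT => /eqP/fM; rewrite /a normrN ger0_norm ?addr_ge0// leNgt.
  by rewrite (le_lt_trans (ler_norm _))// -addrA ltrDl ltr_wpDl.
have FTC : (\int[mu]_(s in `[a, t]) (dH s)%:E = (H t)%:E - (H a)%:E)%E.
  apply: continuous_FTC2 => //.
  - exact: continuous_subspaceT.
  - split=> [x _| |]; first by have [] := dHE x.
      by apply: cvg_at_right_filter; exact: cH.
    by apply: cvg_at_left_filter; exact: cH.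
  - by move=> x _; rewrite derive1E; have [_ ->] := dHE x.
rewrite -/(H t) (_ : (H t)%:E = (H t)%:E - (H a)%:E)%E; last first.
  by rewrite /H fa normr0 powR0 ?gt_eqF// sube0.
rewrite -FTC.
apply: (@le_trans _ _ (\int[mu]_(s in `[a, t]) `|(dH s)%:E|)%E).
  apply: le_trans (le_abse_integral _ _ _) => //; first exact: lee_abs.
  by apply/measurable_EFinP; apply: measurable_funTS; exact: continuous_measurable_fun.
apply: (@le_trans _ _ (\int[mu]_(s in `[a, t]) (g * (`|f s| `^ (g - 1) * `|df s|))%:E)%E).
  rewrite le_eqVlt; apply/orP; left; apply/eqP; apply: eq_integral => s _ /=.
  by rewrite /dH 2!normrM sg_abs_powR// (gtr0_norm g0) mulrA.
by apply: ge0_subset_integral => // s _; rewrite lee_fin.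
Qed.

End abs_power.

Section sobolev_inequality.
Context {R : realType}.
Local Notation leb := (@lebesgue_rV R).

Lemma is_derive_rV_upd n (f : 'rV[R]_n -> R) (i : 'I_n) x (t : R) : smooth f ->
  is_derive t (1 : R) (fun t : R => f (rV_upd i x t)) (partial i f (rV_upd i x t)).
Proof.
move=> sf; apply/is_derive_line.
rewrite (_ : (fun h => _) = (fun h : R => f (h *: delta_mx ord0 i + rV_upd i x t))).
  by have /is_derive_line := smooth_is_derive i (rV_upd i x t) sf.
apply/funext => h; congr f; apply/rowP => j; rewrite !mxE eqxx/=.
by case: (j == i); rewrite ?mulr1 ?mulr0 ?add0r// [_ *: _]mulr1.
Qed.

Lemma lee_prod_ge0 (I : Type) (r : seq I) (f g : I -> \bar R) :
  (forall i, 0 <= f i)%E -> (forall i, f i <= g i)%E ->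
  (\prod_(i <- r) f i <= \prod_(i <- r) g i)%E.
Proof.
move=> f0 fg; elim: r => [|i r IH]; first by rewrite !big_nil.
by rewrite !big_cons lee_pmul// prode_ge0.
Qed.

Lemma prode_powR_cst k (r a : R) : 0 <= r ->
  (\prod_(i < k) (r%:E `^ a) = (r `^ (a * k%:R))%:E)%E.
Proof.
move=> r0; elim: k => [|k IH]; first by rewrite big_ord0 mulr0 powRr0.
rewrite big_ord_recl IH poweR_EFin -EFinM powRrM -[X in (X * _)%:E]powRr1 ?powR_ge0//.
rewrite (powRrM r a k.+1%:R) -add1n natrD.
have [ra0|ra0] := eqVneq (r `^ a) 0.
  by rewrite ra0 powR0 ?oner_neq0// mul0r powR0// -natrD add1n pnatr_eq0.
by rewrite powRD// ra0 implybT.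
Qed.

(** In dimension n = m + 3, [g] is fixed by two demands: Cauchy-Schwarz on [|f|^(g-1) |df|] must
    reproduce [|f|^q], hence 2 (g - 1) = q, and Loomis-Whitney turns [|f|^g] into the exponent g n /
    (n - 1), again q. *)
Lemma sobolev_exponents m (q g : R) :
  q = 2 * m.+3%:R / m.+1%:R -> g = 2 * m.+2%:R / m.+1%:R ->
  [/\ 1 < g, 0 < q, (g - 1) * 2 = q, g * (m.+2%:R^-1 * m.+3%:R) = q &
   q^-1 + 2^-1 = m.+2%:R / m.+3%:R].
Proof.
move=> -> ->.
have -> : m.+3%:R = m%:R + 3 :> R by rewrite -addn3 natrD.
have -> : m.+2%:R = m%:R + 2 :> R by rewrite -addn2 natrD.
have -> : m.+1%:R = m%:R + 1 :> R by rewrite -addn1 natrD.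
have m0 : 0 <= m%:R :> R by [].
have m1 : 0 < m%:R + 1 :> R by rewrite ltr_wpDl.
have m2 : 0 < m%:R + 2 :> R by rewrite ltr_wpDl.
have m3 : 0 < m%:R + 3 :> R by rewrite ltr_wpDl.
split.
- by rewrite ltr_pdivlMr// mul1r; lra.
- by rewrite divr_gt0// mulr_gt0.
- by field; rewrite gt_eqF.
- by field; rewrite !gt_eqF.
- by field; rewrite !gt_eqF.
Qed.

(* The constant g is not the sharp one. *)
Lemma sobolev m (q g : R) (f : 'rV[R]_m.+3 -> R) (D : \bar R) :
  q = 2 * m.+3%:R / m.+1%:R -> g = 2 * m.+2%:R / m.+1%:R ->
  Ccinfty f ->
  (forall i, \int[leb m.+3]_x (partial i f x ^+ 2)%:E <= D)%E ->
  ((\int[leb m.+3]_x (`|f x| `^ q)%:E) `^ q^-1 <= g%:E * D `^ 2^-1)%E.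
Proof.
move=> qE gE cf fD.
have [g1 q0 gq gq2 q2] := sobolev_exponents qE gE.
have g0 : 0 < g by exact: lt_trans g1.
have D0 : (0 <= D)%E.
  by apply: le_trans (fD ord0); apply: integral_ge0 => x _; rewrite lee_fin sqr_ge0.
have mf : measurable_fun setT f by apply: smooth_measurable; case: cf.
have mdf i : measurable_fun setT (partial i f).
  by apply: smooth_measurable; case: (Ccinfty_partial i cf).
set A := (\int[leb m.+3]_x (`|f x| `^ q)%:E)%E.
have A0 : (0 <= A)%E by apply: integral_ge0 => x _; rewrite lee_fin powR_ge0.
have mfa a : measurable_fun setT (fun x => `|f x| `^ a).
  by apply: measurable_fun_powR; exact: measurableT_comp.
(* A power of [A] is cancelled at the end, which requires it to be finite. *)
have Afin : A \is a fin_num.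
  have [C C0 fC] := Ccinfty_bounded cf.
  rewrite ge0_fin_numE// /A.
  suff /integrableP[_] : (leb m.+3).-integrable setT (EFin \o (fun x => `|f x| `^ q)).
    by under eq_integral do rewrite gee0_abs ?lee_fin ?powR_ge0//.
  apply: (@bounded_support_integrable _ _ _ (C `^ q)) => //.
    by move=> x; rewrite ger0_norm ?powR_ge0// ge0_ler_powR ?nnegrE// ltW.
  have [_ [M fM]] := cf; exists M => x.
  have [->|/fM//] := eqVneq (f x) 0; by rewrite normr0 powR0 ?eqxx // gt_eqF.
pose G i x := (g * (`|f x| `^ (g - 1) * `|partial i f x|))%:E.
have mG i : measurable_fun setT (G i).
  apply/measurable_EFinP; apply: measurable_funM => //.
  by apply: measurable_funM => //; exact: measurableT_comp.
have G0 i x : (0 <= G i x)%E by rewrite lee_fin !mulr_ge0 ?powR_ge0// ltW.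
have fG x : ((`|f x| `^ q)%:E <= \prod_i (line_integral i (G i) x) `^ (m.+2%:R^-1))%E.
  apply: (@le_trans _ _ (\prod_(i < m.+3) ((`|f x| `^ g)%:E `^ (m.+2%:R^-1)))%E).
    by rewrite prode_powR_cst ?powR_ge0// -powRrM gq2.
  apply: lee_prod_ge0 => i; first exact: poweR_ge0.
  apply: le_poweR; rewrite ?lee_fin ?powR_ge0//.
  have [_ [M fM]] := cf.
  rewrite [X in `|f X|](_ : x = rV_upd i x (x ord0 i)); last first.
    by apply/rowP => j; rewrite mxE; case: eqP => [->|].
  apply: (@abs_powR_le_integral _ (fun t => f (rV_upd i x t))
    (fun t => partial i f (rV_upd i x t)) g M) => //.
  - by move=> t; apply: is_derive_rV_upd; case: cf.
  - move=> t; apply: differentiable_continuous; apply/derivable1_diffP.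
    have sf : smooth (partial i f) by apply: smooth_partial; case: cf.
    by have [] := is_derive_rV_upd i x t sf.
  - move=> t /fM; apply: le_trans; apply: le_trans (rV_norm_coord _ i).
    by rewrite mxE eqxx.
have AG : (A <= \prod_i (\int[leb m.+3]_x G i x) `^ (m.+2%:R^-1))%E.
  apply: le_trans (loomis_whitney mG G0); apply: ge0_le_integral => //.
  - exact/measurable_EFinP.
  - by apply: emeasurable_prod => i; apply: measurable_fun_poweR; exact: measurable_line_integral.
(* Cauchy-Schwarz; by [(g - 1) * 2 = q] the square of [|f|^(g - 1)] integrates to [A]. *)
have GA i : (\int[leb m.+3]_x G i x <= g%:E * (A `^ 2^-1 * D `^ 2^-1))%E.
  rewrite /G; under eq_integral do rewrite EFinM.
  rewrite ge0_integralZl//; last 2 first.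
  - apply/measurable_EFinP; apply: measurable_funM => //; exact: measurableT_comp.
  - by rewrite lee_fin ltW.
  apply: lee_wpmul2l; first by rewrite lee_fin ltW.
  have H x : (`|f x| `^ (g - 1) * `|partial i f x|)%:E =
      ((`|f x| `^ q)%:E `^ 2^-1 * (partial i f x ^+ 2)%:E `^ 2^-1)%E.
    rewrite !poweR_EFin -EFinM -powRrM -gq mulfK// powR12_sqrt ?sqr_ge0//.
    by rewrite sqrtr_sqr.
  under eq_integral do rewrite H.
  have := @ge0_hoelder _ _ _ (leb m.+3) (fun x => (`|f x| `^ q)%:E)
     (fun x => (partial i f x ^+ 2)%:E) 2^-1 2^-1.
  move=> /(_ _ _ _ _ _ _ _)/le_trans; apply => //.
  - exact/measurable_EFinP.
  - by apply/measurable_EFinP; exact: measurable_funX.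
  - by move=> x; rewrite lee_fin sqr_ge0.
  - by rewrite [RHS](splitr 1) !mul1r.
  - apply: lee_wpmul2l; first exact: poweR_ge0.
    apply: le_poweR => //; apply: integral_ge0 => x _; by rewrite lee_fin sqr_ge0.
have {AG GA fG} : (A <= \prod_(i < m.+3) ((g%:E * (A `^ 2^-1 * D `^ 2^-1)) `^ (m.+2%:R^-1)))%E.
  apply: le_trans AG _; apply: lee_prod_ge0 => i; first exact: poweR_ge0.
  by apply: le_poweR => //; exact: integral_ge0.
case: D D0 fD => [d d0 _|_ _ _|//]; last first.
  by rewrite poweRyr// mulry gtr0_sg// mul1e leey.
rewrite -(fineK Afin); set a := fine A.
have a0 : 0 <= a by exact: fine_ge0.
rewrite lee_fin in d0.
rewrite !poweR_EFin -!EFinM prode_powR_cst ?lee_fin; last first.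
  by rewrite !mulr_ge0 ?powR_ge0// ltW.
move=> H; have [->|an0] := eqVneq a 0.
  by rewrite powR0 ?invr_eq0 ?gt_eqF// mulr_ge0 ?powR_ge0// ltW.
have ap : 0 < a by rewrite lt0r an0.
(* The product of m + 3 equal factors of exponent 1/(m+2) is undone by the power (m+2)/(m+3). As
   this equals 1/q + 1/2, dividing by [a^(1/2)] leaves [a^(1/q)]. *)
have {H} : a `^ (m.+2%:R / m.+3%:R) <= g * (a `^ 2^-1 * d `^ 2^-1).
  have E1 : m.+2%:R^-1 * m.+3%:R * (m.+2%:R / m.+3%:R) = 1 :> R.
    by rewrite mulrACA mulVf ?pnatr_eq0// mulfV ?pnatr_eq0// mul1r.
  have B0 : 0 <= g * (a `^ 2^-1 * d `^ 2^-1) by rewrite !mulr_ge0 ?powR_ge0// ltW.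
  have /(_ (m.+2%:R / m.+3%:R)) := ge0_ler_powR _ _ _ H.
  rewrite -powRrM E1 powRr1//.
  by apply; rewrite ?nnegrE ?divr_ge0 ?powR_ge0.
rewrite -q2 powRD ?an0 ?implybT// mulrCA [leLHS]mulrC.
by rewrite ler_pM2l// powR_gt0.
Qed.

End sobolev_inequality.

(** * Mollification *)

Section smooth_functions_1d.
Context {R : realType}.
Implicit Types (h : R -> R) (t : R).

Lemma smooth1_closed (A : (R -> R) -> Prop) :
  (forall h, A h -> exists2 dh, A dh & forall t, is_derive t (1 : R) h (dh t)) ->
  forall h, A h -> smooth1 h.
Proof.
move=> HA h Ah k t.
have [dh _ /(_ t)[]//] : exists2 dh, A dh & forall t, is_derive t (1 : R) (derive1n k h) (dh t).
elim: k h Ah => [|k IH] h Ah; first exact: HA.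
have [dh Adh H] := HA _ Ah.
rewrite derive1Sn (_ : derive1 h = dh); first exact: IH.
by apply/funext => s; rewrite derive1E; have [_ ->] := H s.
Qed.

(* Stable under differentiation; it contains sqrt (t^2 + e^2) for c = e^2. *)
Inductive power_algebra (c : R) : (R -> R) -> Prop :=
| power_algebra_cst a : power_algebra c (fun=> a)
| power_algebra_id : power_algebra c id
| power_algebra_powR a : power_algebra c (fun t => (t * t + c) `^ a)
| power_algebraD f g of power_algebra c f & power_algebra c g :
    power_algebra c (fun t => f t + g t)
| power_algebraM f g of power_algebra c f & power_algebra c g :
    power_algebra c (fun t => f t * g t).

Lemma is_derive_sqrD_powR (c a t : R) : 0 < c ->
  is_derive t (1 : R) (fun t => (t * t + c) `^ a)
    (a * (t * t + c) `^ (a - 1) * (t + t)).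
Proof.
move=> c0.
apply: (@is_derive1_comp _ (fun z => z `^ a) (fun t => t * t + c)).
  by apply: is_derive1_powR; rewrite ltr_wpDl// -expr2 sqr_ge0.
rewrite -[X in is_derive _ _ _ X]addr0; apply: is_deriveD.
by apply: is_derive_eq; rewrite [_ *: _]mulr1.
Qed.

Lemma smooth1_power_algebra c h : 0 < c -> power_algebra c h -> smooth1 h.
Proof.
move=> c0; apply: smooth1_closed => {h} h.
elim=> {h} [a||a|f g af [f' af' df] ag [g' ag' dg]|f g af [f' af' df] ag [g' ag' dg]].
- by exists (fun=> 0); [exact: power_algebra_cst|move=> t; exact: is_derive_cst].
- by exists (fun=> 1); [exact: power_algebra_cst|move=> t; exact: is_derive_id].
- exists (fun t => a * (t * t + c) `^ (a - 1) * (t + t)).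
    by apply: power_algebraM; [apply: power_algebraM; [exact: power_algebra_cst|exact: power_algebra_powR]|
      apply: power_algebraD; exact: power_algebra_id].
  by move=> t; exact: is_derive_sqrD_powR.
- exists (fun t => f' t + g' t); first exact: power_algebraD.
  by move=> t; exact: is_deriveD.
- exists (fun t => f t * g' t + g t * f' t).
    by apply: power_algebraD; exact: power_algebraM.
  by move=> t; exact: is_deriveM.
Qed.

(** For [k = 0] the standard flat function exp (-1/t). The powers of 1/t are included because its
    derivatives are linear combinations of the members of this family. *)
Definition flat_exp (k : nat) (t : R) : R :=
  if 0 < t then t^-1 ^+ k * expR (- t^-1) else 0.

Lemma flat_exp_ge0 k t : 0 <= flat_exp k t.
Proof.
rewrite /flat_exp; case: ifPn => // t0.
by rewrite mulr_ge0 ?expR_ge0// exprn_ge0// invr_ge0 ltW.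
Qed.

(** With y = 1/t, one term of the exponential series gives y^(k+1) <= (k+1)! exp y. The linear bound
    is what makes the difference quotients at 0 converge. *)
Lemma flat_exp_le k t : `|flat_exp k t| <= k.+1`!%:R * `|t|.
Proof.
rewrite ger0_norm ?flat_exp_ge0// /flat_exp; case: ifPn => [t0|_]; last first.
  by rewrite mulr_ge0.
rewrite gtr0_norm//.
have y0 : 0 < t^-1 by rewrite invr_gt0.
have := expR_ge1Dxn k (ltW y0).
set y := t^-1; move=> H; rewrite expRN ler_pdivrMr ?expR_gt0//.
have yt : y * t = 1 by rewrite mulVf ?gt_eqF.
rewrite -[leLHS]mulr1 -[X in _ * X <= _]yt mulrA -exprSr mulrAC; apply: ler_wpM2r; first exact: ltW.
by rewrite mulrC -ler_pdivrMr ?ltr0n ?fact_gt0//; apply: le_trans H; rewrite lerDr.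
Qed.

Lemma is_derive_flat_exp k t : is_derive t (1 : R) (flat_exp k)
  (- k%:R * flat_exp k.+1 t + flat_exp k.+2 t).
Proof.
have [t0|t0|->] := ltgtP t 0.
- apply: (@near_eq_is_derive _ _ _ (cst 0)).
    near=> z; rewrite /flat_exp ltNge ltW//; near: z; exact: lt_nbhsl.
  rewrite /flat_exp ltNge ltW//= mulr0 addr0; exact: is_derive_cst.
- apply: (@near_eq_is_derive _ _ _ (fun z : R => z^-1 ^+ k * expR (- z^-1))).
    by near=> z; rewrite /flat_exp ifT//; near: z; exact: lt_nbhsr.
  rewrite /flat_exp t0.
  have tn0 : t != 0 by rewrite gt_eqF.
  have dV : is_derive t (1 : R) (fun z : R => z^-1) (- t^-1 ^+ 2).
    have di : derivable (@idfun R) t (1 : R) by exact: derivable_id.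
    apply: DeriveDef; first exact: (@derivableV _ _ (@idfun R)).
    by rewrite (@deriveV _ _ (@idfun R))// derive_id exprVn [_ *: _]mulr1.
  have dX : is_derive t (1 : R) (fun z : R => z^-1 ^+ k) (k%:R * t^-1 ^+ k.-1 * (- t^-1 ^+ 2)).
    apply: (@is_derive1_comp _ (fun z => z ^+ k) (fun z => z^-1)) => //.
    apply: DeriveDef; first exact: exprn_derivable.
    by rewrite exp_derive [_ *: _]mulr1.
  have dE : is_derive t (1 : R) (fun z : R => expR (- z^-1)) (expR (- t^-1) * t^-1 ^+ 2).
    apply: (@is_derive1_comp _ expR (fun z => - z^-1)) => //.
    by rewrite -[X in is_derive _ _ _ X]opprK; exact: is_deriveN.
  apply: (@is_derive_eq _ _ _ _ _ _ _ _ (is_deriveM dX dE)).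
  rewrite /GRing.scale/=; case: k {dX} => [|k] /=.
    by rewrite !exprS !expr0; ring.
  rewrite !exprS; ring.
- have -> : - k%:R * flat_exp k.+1 0 + flat_exp k.+2 0 = 0.
    by rewrite /flat_exp ltxx mulr0 addr0.
  (* For h > 0 the difference quotient at 0 is [flat_exp k.+1 h], hence at most (k+2)! |h|; for h <
     0 it is 0. *)
  have H : (fun h : R => h^-1 *: (flat_exp k ((h *: (1 : R) + 0) : R) - flat_exp k 0)) @ (0 : R)^' --> (0 : R).
    apply: norm_cvg0; apply: (@squeeze_cvgr _ _ _ _ (fun _ : R => 0) (fun h : R => k.+2`!%:R * `|h|)).
    + near=> h; rewrite normr_ge0/=.
      have h0 : h != 0 by near: h; exact: nbhs_dnbhs_neq.
      rewrite {2}/flat_exp ltxx subr0 addr0 [h *: 1]mulr1.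
      apply: le_trans (flat_exp_le k.+1 h).
      rewrite /flat_exp; case: ifPn => [hp|_]; last by rewrite scaler0.
      by rewrite exprS -mulrA.
    + exact: cvg_cst.
    + apply: cvg_within_filter.
      have := continuousM (@cst_continuous _ _ (k.+2`!%:R : R) (0 : R)) (@norm_continuous _ R 0).
      by rewrite /prop_for /continuous_at /= normr0 mulr0.
  apply: DeriveDef; last exact: cvg_lim H.
  by apply/cvg_ex; exists 0.
Unshelve. all: by end_near. Qed.

Inductive flat_algebra : (R -> R) -> Prop :=
| flat_algebra_exp k : flat_algebra (flat_exp k)
| flat_algebraD (a : R) f g of flat_algebra f & flat_algebra g :
    flat_algebra (fun t => a * f t + g t).

Lemma smooth1_flat_exp k : smooth1 (flat_exp k).
Proof.
apply: (smooth1_closed (A := flat_algebra)); last exact: flat_algebra_exp.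
move=> h; elim=> {h k} [k|a f g af [f' af' df] ag [g' ag' dg]].
  exists (fun t => - k%:R * flat_exp k.+1 t + flat_exp k.+2 t).
    by apply: flat_algebraD; exact: flat_algebra_exp.
  by move=> t; exact: is_derive_flat_exp.
exists (fun t => a * f' t + g' t); first exact: flat_algebraD.
move=> t; apply: is_deriveD; exact: is_deriveZ.
Qed.

End smooth_functions_1d.

(** * Differentiation under the integral sign and integration by parts *)

Section integral_of_translates.
Context {R : realType} {n : nat}.
Local Notation V := 'rV[R]_n.
Local Notation e_ i := (delta_mx ord0 i : V).

Lemma lipschitz_of_derive (g dg : R -> R) (C : R) :
  (forall t : R, is_derive t (1 : R) g (dg t)) -> (forall t, `|dg t| <= C) ->
  forall a b, `|g b - g a| <= C * `|b - a|.
Proof.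
move=> dgE gC a b; wlog ab : a b / a <= b => [H|].
  have [/H//|/ltW/H] := leP a b; by rewrite distrC (distrC b).
have cg : continuous g.
  move=> x; apply: differentiable_continuous; apply/derivable1_diffP.
  by have [] := dgE x.
have [c _ ->] := MVT_segment ab (fun x _ => dgE x) (continuous_subspaceT cg).
by rewrite normrM ler_wpM2r.
Qed.

(** Only partial derivatives are at hand, so one coordinate is changed at a time: [z k] has its
    first [k] coordinates from [y] and the others from [x], and each step is a one-dimensional mean
    value estimate. *)
Lemma lipschitz_of_partial (f : V -> R) (f' : 'I_n -> V -> R) (C : R) :
  (forall i x, is_derive x (e_ i) f (f' i x)) ->
  (forall i x, `|f' i x| <= C) ->
  forall x y, `|f y - f x| <= C * \sum_i `|y ord0 i - x ord0 i|.
Proof.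
move=> df fC x y.
pose z k : V := \row_j (if (j < k)%N then y ord0 j else x ord0 j).
have z0 : z 0%N = x by apply/rowP => j; rewrite mxE.
have zn : z n = y by apply/rowP => j; rewrite mxE ltn_ord.
have step (k : 'I_n) : `|f (z k.+1) - f (z k)| <= C * `|y ord0 k - x ord0 k|.
  pose g (t : R) := f (t *: e_ k + z k).
  have dg (t : R) : is_derive t (1 : R) g (f' k (t *: e_ k + z k)).
    apply/is_derive_line; have /is_derive_line := df k (t *: e_ k + z k).
    rewrite /g (_ : (fun h : R => _) = (fun h : R => f ((h *: (1 : R) + t) *: e_ k + z k)))//.
    by apply/funext => h; rewrite addrA -scalerDl [_ *: 1]mulr1.
  have zS : z k.+1 = (y ord0 k - x ord0 k) *: e_ k + z k.
    apply/rowP => j; rewrite !mxE eqxx/= ltnS leq_eqVlt.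
    rewrite [(j : nat) == k]val_eqE; case: (eqVneq j k) => [->|jk]/=; rewrite ?ltnn.
      by rewrite mulr1 subrK.
    by rewrite mulr0 add0r.
  have := lipschitz_of_derive dg (fun t => fC k _) 0 (y ord0 k - x ord0 k).
  by rewrite /g scale0r add0r -zS subr0.
have -> : f y - f x = \sum_(k < n) (f (z k.+1) - f (z k)).
  by rewrite -(big_mkord xpredT (fun k => f (z k.+1) - f (z k))) telescope_sumr// zn z0.
rewrite mulr_sumr; apply: le_trans (ler_norm_sum _ _ _) _.
by apply: ler_sum => k _; exact: step.
Qed.

Lemma lipschitz_continuous_rV (f : V -> R) (C : R) :
  (forall x y, `|f y - f x| <= C * \sum_i `|y ord0 i - x ord0 i|) -> continuous f.
Proof.
move=> H x; apply/(@cvgrPdist_le _ _ _ (nbhs x) _ f (f x)) => e e0.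
pose C' := `|C| * n%:R + 1.
have C'0 : 0 < C' by rewrite ltr_wpDl// mulr_ge0.
have eC : 0 < e / C' by exact: divr_gt0.
apply/nbhs_ballP; exists (e / C') => //= y /(ball_rVP _ _ eC) xy.
rewrite distrC; apply: le_trans (H _ _) _.
have yx i : `|y ord0 i - x ord0 i| <= e / C' by rewrite distrC ltW.
apply: (@le_trans _ _ (`|C| * (n%:R * (e / C')))).
  apply: (@le_trans _ _ (`|C| * \sum_i `|y ord0 i - x ord0 i|)).
    by rewrite ler_wpM2r ?ler_norm// sumr_ge0.
  apply: ler_wpM2l => //.
  apply: (@le_trans _ _ (\sum_(i < n) (e / C'))); first exact: ler_sum.
  by rewrite sumr_const card_ord -[X in X <= _]mulr_natl.
have -> : `|C| * (n%:R * (e / C')) = e * ((`|C| * n%:R) / C') by ring.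
apply: ler_piMr; first exact: ltW.
by rewrite ler_pdivrMr// mul1r lerDl.
Qed.

Context d (Y : measurableType d) (m : {measure set Y -> \bar R}).
Variables (U : Y -> R) (a : Y -> V).
Hypothesis intU : m.-integrable setT (EFin \o U).
Hypothesis ma : measurable_fun setT a.

(** Two uses share this form: [a = -%R] gives the convolution of [U] with [f], and [a = id] with an
    indicator [U] gives the integral of a translate of [f]. *)
Definition translate_integral (f : V -> R) (x : V) : R :=
  \int[m]_y (U y * f (x + a y)).

Let mU : measurable_fun setT U.
Proof. by have /integrableP[/measurable_EFinP] := intU. Qed.

Lemma measurable_translate (f : V -> R) (x : V) : measurable_fun setT f ->
  measurable_fun setT (fun y => f (x + a y)).
Proof.
move=> mf; under eq_fun do rewrite addrC.
apply: (measurableT_comp mf).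
exact: (measurableT_comp (measurable_rV_shift x) ma).
Qed.

Lemma integrable_translate f x : Ccinfty f ->
  m.-integrable setT (EFin \o (fun y => U y * f (x + a y))).
Proof.
move=> cf; have [C C0 fC] := Ccinfty_bounded cf.
apply: (@le_integrable _ _ _ m _ measurableT _ (fun y => C%:E * (EFin \o U) y)%E).
- apply/measurable_EFinP; apply: measurable_funM => //.
  by apply: measurable_translate; apply: smooth_measurable; case: cf.
- move=> y _; rewrite -EFinM lee_fin !normrM mulrC ler_wpM2r//.
  by rewrite (ger0_norm C0).
- exact: integrableZl.
Qed.

Lemma translate_integral_bound f (C : R) : Ccinfty f -> (forall x, `|f x| <= C) ->
  forall x, `|translate_integral f x| <= C * \int[m]_y `|U y|.
Proof.
move=> cf fC x; apply: (le_trans (le_normr_Rintegral measurableT (integrable_translate x cf))).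
rewrite -RintegralZl//; last exact: integrable_norm.
apply: le_Rintegral => //.
- by apply: integrable_norm => //; exact: integrable_translate.
- have := integrable_norm intU => /(@integrableZl _ _ _ m setT measurableT C).
  by apply: eq_integrable.
- by move=> y _; rewrite normrM mulrC ler_wpM2r.
Qed.

(** Dominated differentiation: along the line through [x], the derivative of the integrand is at
    most [C * |U|], with [C] a bound of [partial i f]. *)
Lemma is_derive_translate_integral f i x : Ccinfty f ->
  is_derive x (e_ i) (translate_integral f) (translate_integral (partial i f) x).
Proof.
move=> cf; have [C C0 fC] := Ccinfty_bounded (Ccinfty_partial i cf).
apply/is_derive_line.
pose g (h : R) y := U y * f (h *: e_ i + x + a y).
have dg (h : R) y : is_derive h (1 : R) (g ^~ y) (U y * partial i f (h *: e_ i + x + a y)).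
  have sf : smooth f by case: cf.
  have /is_derive_line H := smooth_is_derive i (h *: e_ i + x + a y) sf.
  suff H1 : is_derive h (1 : R) (fun h : R => f (h *: e_ i + x + a y))
      (partial i f (h *: e_ i + x + a y)) by exact: is_deriveZ.
  apply/is_derive_line.
  rewrite (_ : (fun h0 : R => _) = (fun h0 : R => f (h0 *: e_ i + (h *: e_ i + x + a y)))) //.
  by apply/funext => k; rewrite [_ *: 1]mulr1 scalerDl !addrA.
have D1 : partial1of2 g 0 = fun y => U y * partial i f (x + a y).
  apply/funext => y; rewrite partial1of2E; have [_ ->] := dg 0 y.
  by rewrite scale0r add0r.
have I0 : (`](-1 : R), 1[%classic : set R) 0 by rewrite /= in_itv/= ltrN10 ltr01.
have H := @cvg_differentiation_under_integral R _ Y m g setT measurableT 0 (-1) 1 I0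
  (fun h _ => integrable_translate _ cf) (fun h y _ _ => let: DeriveDef H _ := dg h y in H)
  (fun y => C * `|U y|).
have {}H := H (fun y => mulr_ge0 C0 (normr_ge0 _)).
have iCU : m.-integrable setT (EFin \o (fun y => C * `|U y|)).
  have := integrable_norm intU => /(@integrableZl _ _ _ m setT measurableT C).
  by apply: eq_integrable.
have {}H := H iCU.
have GU (h : R) y : `](-1 : R), 1[%classic h -> [set: Y] y ->
    `|partial1of2 g h y| <= C * `|U y|.
  move=> _ _; rewrite partial1of2E; have [_ ->] := dg h y.
  by rewrite normrM mulrC ler_wpM2r.
have {H GU iCU}H := H GU; rewrite D1 in H.
have E : (fun h : R => translate_integral f (h *: e_ i + x)) = (fun h => \int[m]_y g h y) by [].
rewrite E; apply: DeriveDef.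
  apply/cvg_ex; exists (translate_integral (partial i f) x) => /=.
  by under eq_fun do rewrite [_ *: 1]mulr1.
rewrite /derive; apply: (cvg_lim (@Rhausdorff R)).
by under eq_fun do rewrite [_ *: 1]mulr1.
Qed.

(** Every iterated derivative falls on [f]. Its continuity comes from a Lipschitz bound, since the
    next partial derivatives are bounded. *)
Lemma smooth_translate_integral f : Ccinfty f -> smooth (translate_integral f).
Proof.
move=> cf s.
have -> : foldr partial (translate_integral f) s =
    translate_integral (foldr partial f s).
  elim: s => //= i s ->; apply: partialE => x; apply: is_derive_translate_integral.
  by elim: s => //= j s; exact: Ccinfty_partial.
have {}cf : Ccinfty (foldr partial f s).
  by elim: s => //= j s; exact: Ccinfty_partial.
split; last by move=> i x; have [] := is_derive_translate_integral i x cf.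
have /choice[C CE] : forall i, exists C, forall x, `|partial i (foldr partial f s) x| <= C.
  by move=> i; have [C _ H] := Ccinfty_bounded (Ccinfty_partial i cf); exists C.
pose C' := \sum_i `|C i|.
apply: (@lipschitz_continuous_rV _ (C' * \int[m]_y `|U y|)).
apply: lipschitz_of_partial => [i x|i x]; first exact: is_derive_translate_integral.
apply: translate_integral_bound; first exact: Ccinfty_partial.
move=> z; apply: le_trans (CE i z) _; rewrite /C' (bigD1 i)//=.
by rewrite (le_trans (ler_norm _))// lerDl sumr_ge0.
Qed.

Lemma partial_translate_integral f i : Ccinfty f ->
  partial i (translate_integral f) = translate_integral (partial i f).
Proof. by move=> cf; apply: partialE => x; exact: is_derive_translate_integral. Qed.

End integral_of_translates.

Section integration_by_parts.
Context {R : realType} {n : nat}.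
Local Notation V := 'rV[R]_n.
Local Notation leb := (@lebesgue_rV R n).

Lemma integral_shift (a : V) (F : V -> \bar R) : measurable_fun setT F ->
  (\int[leb]_x F (x + a)%R = \int[leb]_x F x)%E.
Proof.
move=> mF; rewrite integralE [RHS]integralE; congr (_ - _)%E.
  rewrite -[RHS](ge0_integral_shift a)//;
    [by apply: eq_integral => x _; rewrite !funeposE|exact: measurable_funepos].
rewrite -[RHS](ge0_integral_shift a)//;
    [by apply: eq_integral => x _; rewrite !funenegE|exact: measurable_funeneg].
Qed.

Lemma Rintegral_shift (a : V) (f : V -> R) : measurable_fun setT f ->
  \int[leb]_x f (x + a) = \int[leb]_x f x.
Proof.
move=> mf; congr fine; rewrite -[RHS](integral_shift a)//; exact/measurable_EFinP.
Qed.

(** By translation invariance [\int f (x + y) dy] does not depend on [x]; its derivative at [x = 0],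
    taken under the integral sign, is the integral in question. *)
Lemma Rintegral_partial (f : V -> R) i : Ccinfty f -> \int[leb]_x partial i f x = 0.
Proof.
move=> cf; have [sf [M fM]] := cf.
(* An integrable weight is required under the integral; the margin 1 keeps the supports of all
   translates by [|x| < 1] inside [K]. *)
pose K := [set x : V | `|x| <= M + 1].
have mK : measurable K by exact: measurable_rV_norm_le.
have iU : leb.-integrable setT (EFin \o (\1_K : V -> R)).
  apply/integrableP; split; first exact/measurable_EFinP.
  under eq_integral do rewrite gee0_abs ?lee_fin//.
  by rewrite integral_indic// setIT; exact: lebesgue_rV_norm_le.
have mid : measurable_fun [set: V] (@id V) by exact: measurable_id.
pose F := translate_integral leb \1_K id f.
have F0 x : `|x| < 1 -> F x = \int[leb]_y f y.
  move=> x1; rewrite -[RHS](Rintegral_shift x); last exact: smooth_measurable.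
  apply: eq_Rintegral => y _; rewrite addrC indicE.
  have [yK|yK] := boolP (y \in K); first by rewrite mul1r.
  rewrite mul0r; apply/esym; apply: contrapT => /eqP /fM xyM.
  move: yK; rewrite notin_setE; apply; rewrite /K/= -[y](addrK x).
  by rewrite (le_trans (ler_normB _ _))// lerD// ltW.
have : partial i F 0 = 0.
  rewrite /partial -[RHS](@derive_cst _ V _ (\int[leb]_y f y) 0 (delta_mx ord0 i)).
  apply: near_eq_derive; apply/nbhs_ballP; exists 1 => //= x x0.
  by apply: F0; move: x0; rewrite mx_norm_ball /ball_/= sub0r normrN.
rewrite (partial_translate_integral iU mid i cf) => H; rewrite -[RHS]H.
apply: eq_Rintegral => y _; rewrite add0r indicE.
have [yK|yK] := boolP (y \in K); first by rewrite mul1r.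
rewrite mul0r; apply: contrapT => /eqP pf.
move: yK; rewrite notin_setE; apply.
have /(closure_subset_closed (@closed_norm_le R n M) fM) := closure_support_partial pf.
by move=> /= yM; rewrite /K/= (le_trans yM)// lerDl.
Qed.

Lemma Rintegral_by_parts (f g : V -> R) i : Ccinfty f -> smooth g ->
  \int[leb]_x (f x * partial i g x) = - \int[leb]_x (g x * partial i f x).
Proof.
move=> cf sg; have sf : smooth f by case: cf.
have ifg : leb.-integrable setT (EFin \o (fun x => f x * partial i g x)).
  exact: Ccinfty_integrable (CcinftyMl cf (smooth_partial i sg)).
have igf : leb.-integrable setT (EFin \o (fun x => g x * partial i f x)).
  under eq_fun do rewrite mulrC.
  exact: Ccinfty_integrable (CcinftyMl (Ccinfty_partial i cf) sg).
apply/eqP; rewrite -addr_eq0 -(RintegralD measurableT ifg igf).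
rewrite -[X in _ == X](Rintegral_partial i (CcinftyMl cf sg)).
by apply/eqP; apply: eq_Rintegral => x _; rewrite partialM.
Qed.

End integration_by_parts.

(** * The standard mollifier and its convolutions *)

Section mollifier.
Context {R : realType} {n : nat}.
Local Notation V := 'rV[R]_n.
Local Notation leb := (@lebesgue_rV R n).

(** A polynomial, hence smooth everywhere, whereas [enorm] is singular at the origin; [unit_ball] is
    a sublevel set of it. *)
Definition sqnorm (x : V) : R := \sum_i x ord0 i * x ord0 i.

(** That is, exp (-1 / (r^2 - |x|^2)) in the Euclidean ball of radius [r], and 0 outside; sums and
    products alone are used, to match the constructors of [smooth_gen]. *)
Definition cutoff (r : R) (x : V) : R := flat_exp 0 (r * r + -1 * sqnorm x).

Lemma sqnorm_ge0 x : 0 <= sqnorm x.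
Proof. by apply: sumr_ge0 => i _; rewrite -expr2 sqr_ge0. Qed.

Lemma unit_ballE : unit_ball = [set x : V | sqnorm x < 1].
Proof.
have E x : enorm x = Num.sqrt (sqnorm x).
  by congr Num.sqrt; apply: eq_bigr => i _; rewrite expr2.
by apply/funext => x; rewrite /unit_ball/= E -[in LHS]sqrtr1 ltr_sqrt.
Qed.

Lemma smooth_gen_sqnorm : smooth_gen sqnorm.
Proof.
rewrite /sqnorm; elim: (index_enum _) => [|i r IH].
  under eq_fun do rewrite big_nil; exact: smooth_gen_cst.
under eq_fun do rewrite big_cons.
by apply: smooth_genD => //; apply: smooth_genM; exact: smooth_gen_coord.
Qed.

Lemma smooth_cutoff r : smooth (cutoff r).
Proof.
apply: smooth_genP; apply: smooth_gen_comp; first exact: smooth1_flat_exp.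
apply: smooth_genD; first exact: smooth_gen_cst.
by apply: smooth_genM; [exact: smooth_gen_cst|exact: smooth_gen_sqnorm].
Qed.

Lemma sqnorm_coord (x : V) i : x ord0 i * x ord0 i <= sqnorm x.
Proof.
by rewrite /sqnorm (bigD1 i)//= lerDl sumr_ge0// => j _; rewrite -expr2 sqr_ge0.
Qed.

Lemma rV_norm_le (x : V) (e : R) : 0 <= e -> (forall i, `|x ord0 i| <= e) -> `|x| <= e.
Proof.
move=> e0 H; have [->|] := eqVneq `|x| 0; first by [].
rewrite [X in X != _ -> _]/Num.norm [X in _ -> X <= _]/Num.norm /=.
by move=> /mx_norm_neq0[[i j] /= ->]; rewrite (ord1 i); exact: H.
Qed.

Lemma sqnorm_norm (r : R) (x : V) : 0 < r -> sqnorm x < r * r -> `|x| <= r.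
Proof.
move=> r0 xr; apply: rV_norm_le => [|i]; first exact: ltW.
rewrite -ler_sqr ?nnegrE ?(ltW r0)// real_normK ?num_real// !expr2.
by rewrite (le_trans (sqnorm_coord x i))// ltW.
Qed.

Lemma cutoff_ge0 r x : 0 <= cutoff r x.
Proof. exact: flat_exp_ge0. Qed.

Lemma cutoff_neq0 r x : (cutoff r x != 0) = (sqnorm x < r * r).
Proof.
rewrite /cutoff /flat_exp mulN1r subr_gt0; case: ifPn => [_|_]; last by rewrite eqxx.
by rewrite expr0 mul1r gt_eqF// expR_gt0.
Qed.

Lemma Ccinfty_cutoff r : 0 < r -> Ccinfty (cutoff r).
Proof.
move=> r0; split; first exact: smooth_cutoff.
by exists r => x; rewrite cutoff_neq0 => /(sqnorm_norm r0).
Qed.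

Lemma cutoffN r x : cutoff r (- x) = cutoff r x.
Proof.
rewrite /cutoff; congr (flat_exp _ (_ + _ * _)).
by apply: eq_bigr => i _; rewrite !mxE mulrNN.
Qed.

(** If the integral were 0, the cutoff would vanish almost everywhere; but it is positive on a small
    cube, whose measure is a product of positive lengths. *)
Lemma integral_cutoff_gt0 r : 0 < r -> 0 < \int[leb]_x cutoff r x.
Proof.
move=> r0; have cb := Ccinfty_cutoff r0.
have mb : measurable_fun setT (cutoff r) by apply: smooth_measurable; case: cb.
rewrite lt0r Rintegral_ge0 ?andbT; last by move=> x _; exact: cutoff_ge0.
apply/eqP => I0.
have E0 : (\int[leb]_x (cutoff r x)%:E = 0)%E.
  rewrite -[LHS]fineK; first by congr EFin.
  by apply: integrable_fin_num => //; exact: Ccinfty_integrable.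
have [N [mN N0 bN]] : {ae leb, forall x, (cutoff r x)%:E = 0%E}.
  by apply: integral_eq0_ae => //; [exact/measurable_EFinP|move=> x; rewrite lee_fin cutoff_ge0].
(* Then n s^2 < r^2, so the cube of half-side [s] lies in the Euclidean ball of radius [r], also
   when n = 0. *)
pose s : R := r / n.+1%:R.
have s0 : 0 < s by rewrite divr_gt0.
pose S := [set x : V | forall i : 'I_n, `[- s, s]%classic (x ord0 i)].
have sN : S `<=` N.
  move=> x xs; apply: bN => /= /eqP; rewrite eqe; apply/negP.
  rewrite cutoff_neq0.
  apply: (@le_lt_trans _ _ (\sum_(i < n) s * s)).
    apply: ler_sum => i _; have := xs i; rewrite /= in_itv/= -ler_norml => xi.
    by rewrite -!expr2 -[x _ _ ^+ 2]real_normK ?num_real// ler_sqr ?nnegrE// ltW.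
  rewrite sumr_const card_ord -[X in X < _]mulr_natl /s.
  have -> : n%:R * (r / n.+1%:R * (r / n.+1%:R)) = (r * r) * (n%:R / n.+1%:R / n.+1%:R) :> R by ring.
  rewrite gtr_pMr ?mulr_gt0// -mulrA -invfM ltr_pdivrMr ?mulr_gt0// mul1r.
  by rewrite -natrM ltr_nat (@leq_trans n.+1)// leq_pmulr.
have : (leb S <= leb N)%E.
  apply: le_measure; rewrite ?inE//.
  exact: (@measurable_rV_box R n (fun=> `[- s, s]%classic)).
rewrite N0 (@lebesgue_rV_box R n (fun=> `[- s, s]%classic))//.
apply/negP; rewrite -ltNge.
elim/big_ind : _ => // [x y|i _]; first exact: mule_gt0.
by rewrite lebesgue_measure_itv/= lte_fin gtrN// -EFinB lte_fin subr_gt0 gtrN.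
Qed.

Definition mollifier (k : nat) (x : V) : R :=
  (\int[leb]_y cutoff k.+1%:R^-1 y)^-1 * cutoff k.+1%:R^-1 x.

Lemma mollifier_ge0 k x : 0 <= mollifier k x.
Proof. by rewrite mulr_ge0 ?cutoff_ge0// invr_ge0 ltW// integral_cutoff_gt0. Qed.

Lemma Ccinfty_mollifier k : Ccinfty (mollifier k).
Proof.
have cb : Ccinfty (cutoff k.+1%:R^-1) by exact: Ccinfty_cutoff.
rewrite /mollifier; under eq_fun do rewrite mulrC; apply: CcinftyMl => //.
by apply: smooth_genP; exact: smooth_gen_cst.
Qed.

Lemma mollifierN k x : mollifier k (- x) = mollifier k x.
Proof. by rewrite /mollifier cutoffN. Qed.

Lemma mollifier_support k x : mollifier k x != 0 -> `|x| <= k.+1%:R^-1.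
Proof.
by rewrite mulf_eq0 negb_or cutoff_neq0 => /andP[_ /sqnorm_norm]; apply.
Qed.

Lemma integral_mollifier k : (\int[leb]_x (mollifier k x)%:E = 1)%E.
Proof.
have cb : Ccinfty (cutoff k.+1%:R^-1) by exact: Ccinfty_cutoff.
rewrite -[LHS]fineK.
  congr EFin; rewrite -/(Rintegral _ _ _) RintegralZl//; last exact: Ccinfty_integrable.
  by rewrite mulVf// gt_eqF// integral_cutoff_gt0.
by apply: integrable_fin_num => //; apply: Ccinfty_integrable; exact: Ccinfty_mollifier.
Qed.

End mollifier.

Section mollification.
Context {R : realType} {n : nat}.
Local Notation V := 'rV[R]_n.
Local Notation leb := (@lebesgue_rV R n).
Local Notation Int U := (leb.-integrable setT (EFin \o U)).

Lemma measurable_rV_opp : measurable_fun [set: V] (fun x : V => - x).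
Proof.
apply/measurable_fun_rVP => i; under eq_fun do rewrite mxE.
by apply: measurableT_comp => //; exact: measurable_rV_coord.
Qed.

Lemma measurable_rV_sub : measurable_fun setT (fun p : V * V => p.1 - p.2 : V).
Proof.
apply/measurable_fun_rVP => i; under eq_fun do rewrite !mxE.
apply: measurable_funB.
  exact: (measurableT_comp (@measurable_rV_coord _ R n i) measurable_fst).
exact: (measurableT_comp (@measurable_rV_coord _ R n i) measurable_snd).
Qed.

Definition mollify k (U : V -> R) (x : V) : R :=
  \int[leb]_y (U y * mollifier k (x - y)).

(** By Tonelli's theorem it has the same integral as [W]. It majorizes [|mollify k U|] for [W = |U|]
    and the square of [mollify k U] for [W = U^2]. *)
Definition mollify_ge0 k (W : V -> \bar R) (x : V) : \bar R :=
  (\int[leb]_y (W y * (mollifier k (x - y))%:E))%E.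

Lemma measurable_mollifier k : measurable_fun [set: V] (mollifier k).
Proof. by apply: smooth_measurable; case: (@Ccinfty_mollifier R n k). Qed.

Lemma integral_mollifier_l k (y : V) : (\int[leb]_x (mollifier k (x - y))%:E = 1)%E.
Proof.
rewrite -[RHS](@integral_mollifier R n k) -[RHS](ge0_integral_shift (- y))//.
- by apply/measurable_EFinP; exact: measurable_mollifier.
- by move=> x; rewrite lee_fin mollifier_ge0.
Qed.

Lemma integral_mollifier_r k (x : V) : (\int[leb]_y (mollifier k (x - y))%:E = 1)%E.
Proof.
rewrite -[RHS](integral_mollifier_l k x); apply: eq_integral => y _.
by rewrite -mollifierN opprB.
Qed.

Lemma measurable_mollify_kernel k (W : V -> \bar R) : measurable_fun setT W ->
  measurable_fun setT (fun p : V * V => W p.2 * (mollifier k (p.1 - p.2))%:E)%E.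
Proof.
move=> mW; apply: emeasurable_funM.
  exact: (measurableT_comp mW measurable_snd).
apply/measurable_EFinP.
exact: (measurableT_comp (measurable_mollifier k) measurable_rV_sub).
Qed.

Lemma measurable_mollify_ge0 k (W : V -> \bar R) : measurable_fun setT W ->
  (forall x, 0 <= W x)%E -> measurable_fun setT (mollify_ge0 k W).
Proof.
move=> mW W0; have := @measurable_fun_fubini_tonelli_F _ _ _ _ _ leb
  (fun p : V * V => W p.2 * (mollifier k (p.1 - p.2))%:E)%E.
apply; first exact: measurable_mollify_kernel.
by move=> p; rewrite mule_ge0// lee_fin mollifier_ge0.
Qed.

Lemma integral_mollify_ge0 k (W : V -> \bar R) : measurable_fun setT W ->
  (forall x, 0 <= W x)%E ->
  (\int[leb]_x mollify_ge0 k W x = \int[leb]_x W x)%E.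
Proof.
move=> mW W0.
transitivity (\int[leb]_y \int[leb]_x (W y * (mollifier k (x - y))%:E))%E.
  have := @fubini_tonelli _ _ _ _ _ leb leb
    (fun p : V * V => W p.2 * (mollifier k (p.1 - p.2))%:E)%E.
  apply; first exact: measurable_mollify_kernel.
  by move=> p; rewrite mule_ge0// lee_fin mollifier_ge0.
apply: eq_integral => y _; rewrite ge0_integralZl//.
- by rewrite integral_mollifier_l mule1.
- apply/measurable_EFinP; apply: (measurableT_comp (measurable_mollifier k)).
  exact: measurable_rV_shift.
- by move=> x _; rewrite lee_fin mollifier_ge0.
Qed.

Lemma mollifyE k U : mollify k U = translate_integral leb U -%R (mollifier k).
Proof. by []. Qed.

Lemma smooth_mollify k U : Int U -> smooth (mollify k U).
Proof.
by move=> iU; apply: smooth_translate_integral => //;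
  [exact: measurable_rV_opp|exact: Ccinfty_mollifier].
Qed.

Lemma measurable_mollify k U : Int U -> measurable_fun setT (mollify k U).
Proof. by move=> iU; apply: smooth_measurable; exact: smooth_mollify. Qed.

Lemma integrable_mollify_kernel k U x : Int U ->
  Int (fun y => U y * mollifier k (x - y)).
Proof.
by move=> iU; apply: (integrable_translate iU measurable_rV_opp x); exact: Ccinfty_mollifier.
Qed.

Lemma mollify_le k U x : Int U ->
  (`|mollify k U x|%:E <= mollify_ge0 k (fun y => `|U y|%:E) x)%E.
Proof.
move=> iU; have iK := integrable_mollify_kernel k x iU.
have mK : measurable_fun setT (EFin \o (fun y => U y * mollifier k (x - y))).
  by have /integrableP[] := iK.
rewrite /mollify EFin_normr_Rintegral//.
apply: le_trans (le_abse_integral _ _ _) _ => //.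
rewrite le_eqVlt; apply/orP; left; apply/eqP; apply: eq_integral => y _ /=.
by rewrite normrM (ger0_norm (mollifier_ge0 _ _)) EFinM.
Qed.

Lemma measurable_norm_EFin U : Int U -> measurable_fun setT (fun x => `|U x|%:E).
Proof.
by move=> /integrableP[/measurable_EFinP mU _]; apply/measurable_EFinP; exact: measurableT_comp.
Qed.

Lemma integral_norm_mollify k U : Int U ->
  (\int[leb]_x `|mollify k U x|%:E <= \int[leb]_x `|U x|%:E)%E.
Proof.
move=> iU; rewrite -[leRHS](integral_mollify_ge0 k)//; last exact: measurable_norm_EFin.
apply: ge0_le_integral => //.
- by apply/measurable_EFinP; apply: measurableT_comp => //; exact: measurable_mollify.
- by apply: measurable_mollify_ge0 => //; exact: measurable_norm_EFin.
- by move=> x _; exact: mollify_le.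
Qed.

Lemma integrable_mollify k U : Int U -> Int (mollify k U).
Proof.
move=> iU; apply/integrableP; split; first by apply/measurable_EFinP; exact: measurable_mollify.
apply: le_lt_trans (integral_norm_mollify k iU) _.
by have /integrableP[] := iU.
Qed.

Lemma mollifyD k U W : Int U -> Int W ->
  mollify k (fun x => U x + W x) = (fun x => mollify k U x + mollify k W x).
Proof.
move=> iU iW; apply/funext => x; rewrite /mollify -RintegralD//; last 2 first.
- exact: integrable_mollify_kernel.
- exact: integrable_mollify_kernel.
by apply: eq_Rintegral => y _; rewrite mulrDl.
Qed.

Lemma mollifyZ k a U : Int U ->
  mollify k (fun x => a * U x) = (fun x => a * mollify k U x).
Proof.
move=> iU; apply/funext => x; rewrite /mollify -RintegralZl//; last first.
  exact: integrable_mollify_kernel.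
by apply: eq_Rintegral => y _; rewrite mulrA.
Qed.

(** Jensen's inequality for the square: Cauchy-Schwarz with respect to the probability density
    [mollifier k (x - y)]. *)
Lemma sqr_mollify_le k U x : Int U ->
  ((mollify k U x ^+ 2)%:E <= mollify_ge0 k (fun y => (U y ^+ 2)%:E) x)%E.
Proof.
move=> iU; have mU : measurable_fun setT U by have /integrableP[/measurable_EFinP] := iU.
have mk : measurable_fun setT (fun y : V => mollifier k (x - y)).
  apply: (measurableT_comp (measurable_mollifier k)).
  under eq_fun do rewrite addrC.
  exact: (measurableT_comp (measurable_rV_shift x) measurable_rV_opp).
have mU2 : measurable_fun setT (fun y : V => (U y ^+ 2)%:E * (mollifier k (x - y))%:E)%E.
  by apply: emeasurable_funM; apply/measurable_EFinP => //; exact: measurable_funX.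
have H := @ge0_hoelder _ _ _ leb (fun y => (U y ^+ 2)%:E * (mollifier k (x - y))%:E)%E
  (fun y => (mollifier k (x - y))%:E) 2^-1 2^-1 mU2.
have {}H : (`|mollify k U x|%:E <= mollify_ge0 k (fun y => (U y ^+ 2)%:E) x `^ 2^-1)%E.
  apply: le_trans (mollify_le k x iU) _.
  rewrite -[leRHS]mule1 -[X in (_ * X)%E](poweR1r 2^-1) -[X in (_ * X `^ _)%E](integral_mollifier_r k x).
  apply: le_trans (H _ _ _ _ _ _) => //.
  - rewrite le_eqVlt; apply/orP; left; apply/eqP; apply: eq_integral => y _.
    rewrite -EFinM !poweR_EFin powRM ?sqr_ge0 ?mollifier_ge0// -!EFinM; congr EFin.
    rewrite [in RHS]powR12_sqrt ?sqr_ge0// sqrtr_sqr -mulrA; congr (_ * _).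
    by rewrite powR12_sqrt ?mollifier_ge0// -expr2 sqr_sqrtr// mollifier_ge0.
  - exact/measurable_EFinP.
  - by move=> y; rewrite -EFinM lee_fin mulr_ge0 ?sqr_ge0 ?mollifier_ge0.
  - by move=> y; rewrite lee_fin mollifier_ge0.
  - by rewrite [RHS](splitr 1) !mul1r.
have A0 : (0 <= mollify_ge0 k (fun y => (U y ^+ 2)%:E) x)%E.
  by apply: integral_ge0 => y _; rewrite -EFinM lee_fin mulr_ge0 ?sqr_ge0 ?mollifier_ge0.
have := le_poweR (ler0n R 2) (_ : 0 <= `|mollify k U x|%:E)%E H.
rewrite -poweRrM mulVf ?pnatr_eq0// poweRe1//.
by rewrite poweR_EFin powR_mulrn// real_normK ?num_real//; apply; rewrite lee_fin.
Qed.

Lemma integral_sqr_mollify k U : Int U ->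
  (\int[leb]_x (mollify k U x ^+ 2)%:E <= \int[leb]_x (U x ^+ 2)%:E)%E.
Proof.
move=> iU; have mU : measurable_fun setT U by have /integrableP[/measurable_EFinP] := iU.
have mU2 : measurable_fun setT (fun x => (U x ^+ 2)%:E).
  by apply/measurable_EFinP; exact: measurable_funX.
have U20 x : (0 <= (U x ^+ 2)%:E)%E by rewrite lee_fin sqr_ge0.
rewrite -[leRHS](integral_mollify_ge0 k)//; apply: ge0_le_integral => //.
- by move=> x _; rewrite lee_fin sqr_ge0.
- by apply/measurable_EFinP; apply: measurable_funX; exact: measurable_mollify.
- exact: measurable_mollify_ge0.
- by move=> x _; exact: sqr_mollify_le.
Qed.

End mollification.

(** * Convergence of mollifications in L^1 *)

Section mollification_L1.
Context {R : realType} {n : nat}.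
Local Notation V := 'rV[R]_n.
Local Notation leb := (@lebesgue_rV R n).
Local Notation Int U := (leb.-integrable setT (EFin \o U)).

Definition L1norm (U : V -> R) : \bar R := (\int[leb]_x `|U x|%:E)%E.

(** A predicate, so that the functions satisfying it form a class closed under linear combinations
    and L^1 limits; the class is enlarged from indicators of open sets to all integrable
    functions. *)
Definition mollify_cvg (U : V -> R) := Int U /\
  forall e : R, 0 < e ->
    \forall k \near \oo, (L1norm (fun x => mollify k U x - U x)%R <= e%:E)%E.

Lemma L1normD U W : Int U -> Int W ->
  (L1norm (fun x => U x + W x)%R <= L1norm U + L1norm W)%E.
Proof.
move=> iU iW; have mU := measurable_norm_EFin iU; have mW := measurable_norm_EFin iW.
rewrite -ge0_integralD//; apply: ge0_le_integral => //.
- apply: measurable_norm_EFin; have := integrableD measurableT iU iW.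
  by apply: eq_integrable.
- exact: emeasurable_funD.
- by move=> x _; rewrite -EFinD lee_fin ler_normD.
Qed.

Lemma IntD U W : Int U -> Int W -> Int (fun x => U x + W x).
Proof. by move=> iU iW; have := integrableD measurableT iU iW; apply: eq_integrable. Qed.

Lemma IntB U W : Int U -> Int W -> Int (fun x => U x - W x).
Proof. by move=> iU iW; have := integrableB measurableT iU iW; apply: eq_integrable. Qed.

Lemma IntZ a U : Int U -> Int (fun x => a * U x).
Proof. by move=> iU; have := integrableZl measurableT a iU; apply: eq_integrable. Qed.

Lemma L1normZ a U : Int U -> (L1norm (fun x => a * U x)%R = `|a|%:E * L1norm U)%E.
Proof.
move=> iU; rewrite /L1norm -ge0_integralZl//; last exact: measurable_norm_EFin.
by apply: eq_integral => x _; rewrite normrM EFinM.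
Qed.

Lemma Int_mollify_sub k U : Int U -> Int (fun x => mollify k U x - U x).
Proof. by move=> iU; apply: IntB => //; exact: integrable_mollify. Qed.

Lemma mollify_cvgD U W : mollify_cvg U -> mollify_cvg W ->
  mollify_cvg (fun x => U x + W x).
Proof.
move=> [iU cU] [iW cW]; split; first exact: IntD.
move=> e e0; have e2 : 0 < e / 2 by rewrite divr_gt0.
have {}cU := cU _ e2; have {}cW := cW _ e2; near=> k.
have HU : (L1norm (fun x => mollify k U x - U x)%R <= (e / 2)%:E)%E by near: k.
have HW : (L1norm (fun x => mollify k W x - W x)%R <= (e / 2)%:E)%E by near: k.
rewrite mollifyD// (splitr e) EFinD.
apply: le_trans (leeD HU HW).
apply: le_trans (L1normD (Int_mollify_sub k iU) (Int_mollify_sub k iW)).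
by rewrite le_eqVlt; apply/orP; left; apply/eqP; apply: eq_integral => x _; congr (`|_|%:E); ring.
Unshelve. all: by end_near. Qed.

Lemma mollify_cvgZ a U : mollify_cvg U -> mollify_cvg (fun x => a * U x).
Proof.
move=> [iU cU]; split; first exact: IntZ.
move=> e e0; have a1 : 0 < `|a| + 1 by rewrite ltr_wpDl.
have e2 : 0 < e / (`|a| + 1) by rewrite divr_gt0.
have {}cU := cU _ e2; near=> k.
have HU : (L1norm (fun x => mollify k U x - U x)%R <= (e / (`|a| + 1))%:E)%E by near: k.
rewrite mollifyZ// (_ : (fun x => _) = (fun x => a * (mollify k U x - U x))); last first.
  by apply/funext => x; rewrite mulrBr.
rewrite L1normZ; last exact: Int_mollify_sub.
apply: (@le_trans _ _ (`|a|%:E * (e / (`|a| + 1))%:E)%E); first exact: lee_wpmul2l.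
rewrite -EFinM lee_fin mulrCA ler_piMr ?(ltW e0)//.
by rewrite ler_pdivrMr// mul1r lerDl.
Unshelve. all: by end_near. Qed.

(** Mollification is a contraction of L^1, so an approximation of [U] by [W] costs its error twice,
    next to the convergence error of [W]: three times e/3. *)
Lemma mollify_cvg_closed U : Int U ->
  (forall e : R, 0 < e -> exists2 W, mollify_cvg W & (L1norm (fun x => U x - W x)%R <= e%:E)%E) ->
  mollify_cvg U.
Proof.
move=> iU H; split => // e e0; have e3 : 0 < e / 3 by rewrite divr_gt0.
have [W [iW cW] UW] := H _ e3; have {}cW := cW _ e3; near=> k.
have HW : (L1norm (fun x => mollify k W x - W x)%R <= (e / 3)%:E)%E by near: k.
have iUW := IntB iU iW.
have iWU : Int (fun x => -1 * (U x - W x)) by exact: IntZ.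
have -> : (fun x => mollify k U x - U x) =
    (fun x => mollify k (fun x => U x - W x) x + ((mollify k W x - W x) + -1 * (U x - W x))).
  have mU : mollify k U = fun x => mollify k (fun x => U x - W x) x + mollify k W x.
    by rewrite -mollifyD//; congr mollify; apply/funext => y; rewrite subrK.
  by apply/funext => x; rewrite mU; ring.
apply: le_trans (L1normD (integrable_mollify k iUW) (IntD (Int_mollify_sub k iW) iWU)) _.
have -> : e%:E = ((e / 3)%:E + ((e / 3)%:E + (e / 3)%:E))%E.
  by rewrite -!EFinD; congr EFin; field.
apply: leeD; first exact: le_trans (integral_norm_mollify k iUW) UW.
apply: le_trans (L1normD (Int_mollify_sub k iW) iWU) _; apply: leeD => //.
by rewrite L1normZ// normrN normr1 mul1e.
Unshelve. all: by end_near. Qed.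

Lemma Int_indic (A : set V) : measurable A -> (leb A < +oo)%E -> Int (\1_A : V -> R).
Proof.
move=> mA Afin; apply/integrableP; split; first exact/measurable_EFinP.
under eq_integral do rewrite gee0_abs ?lee_fin//.
by rewrite integral_indic// setIT.
Qed.

Lemma mollify_indic_ge0 k (A : set V) x : 0 <= mollify k \1_A x.
Proof.
by apply: Rintegral_ge0 => y _; rewrite mulr_ge0 ?mollifier_ge0// indicE.
Qed.

Lemma Int_mollifier_r k (x : V) : Int (fun y => mollifier k (x - y)).
Proof. by apply: Ccinfty_integrable; apply: Ccinfty_reflect; exact: Ccinfty_mollifier. Qed.

Lemma Rintegral_mollifier_r k (x : V) : \int[leb]_y mollifier k (x - y) = 1.
Proof. by rewrite /Rintegral integral_mollifier_r. Qed.

Lemma mollify_indic_le1 k (A : set V) x : measurable A -> (leb A < +oo)%E ->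
  mollify k \1_A x <= 1.
Proof.
move=> mA Afin; rewrite -[leRHS](Rintegral_mollifier_r k x).
apply: le_Rintegral => //.
- by apply: integrable_mollify_kernel; exact: Int_indic.
- exact: Int_mollifier_r.
- by move=> y _; rewrite ler_piMl ?mollifier_ge0// indicE lern1 leq_b1.
Qed.

Lemma Rintegral_mollify_indic k (A : set V) : measurable A -> (leb A < +oo)%E ->
  \int[leb]_x mollify k \1_A x = \int[leb]_x \1_A x.
Proof.
move=> mA Afin; have iA := Int_indic mA Afin.
have mA1 : measurable_fun setT (fun x : V => (\1_A x : R)%:E) by exact/measurable_EFinP.
congr fine; rewrite -[RHS](integral_mollify_ge0 k)//.
apply: eq_integral => x _; rewrite /mollify /Rintegral fineK//.
by apply: integrable_fin_num => //; exact: integrable_mollify_kernel.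
Qed.

(** At a point of [A] the mollified indicator is eventually 1. The mass that leaves [A] equals the
    mass lost inside, total mass being preserved, so the L^1 error is twice the integral of [h k],
    which tends to 0 by dominated convergence. *)
Lemma mollify_cvg_open (A : set V) : open A -> (leb A < +oo)%E -> mollify_cvg \1_A.
Proof.
move=> oA Afin; have mA := open_measurable_rV oA; have iA := Int_indic mA Afin.
split => // e e0.
pose h k x := \1_A x * (1 - mollify k \1_A x).
have ih k : Int (h k).
  have := IntB iA (integrable_mollify k iA) => H.
  apply: (@le_integrable _ _ _ leb _ measurableT _ (EFin \o \1_A)) => //.
    apply/measurable_EFinP; apply: measurable_funM; first exact: measurable_indic.
    by apply: measurable_funB => //; exact: measurable_mollify.
  move=> x _; rewrite lee_fin normrM ler_piMr//.
  have m0 := mollify_indic_ge0 k A x; have m1 := mollify_indic_le1 k x mA Afin.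
  by rewrite ler_norml; apply/andP; split; lra.
have E k : L1norm (fun x => mollify k \1_A x - \1_A x) = (2 * \int[leb]_x h k x)%:E.
  have -> : L1norm (fun x => mollify k \1_A x - \1_A x) =
      (\int[leb]_x `|mollify k \1_A x - \1_A x|)%:E.
    rewrite /L1norm fineK//; apply: integrable_fin_num => //.
    exact: integrable_norm (Int_mollify_sub k iA).
  congr EFin; transitivity (\int[leb]_x (2 * h k x + (mollify k \1_A x - \1_A x))).
    apply: eq_Rintegral => x _; rewrite /h indicE; case: (x \in A) => /=.
      rewrite ler0_norm; first by rewrite mulr1n; ring.
      by rewrite subr_le0; exact: mollify_indic_le1.
    by rewrite mulr0n !mul0r !subr0 mulr0 add0r ger0_norm// mollify_indic_ge0.
  rewrite RintegralD//; last 2 first.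
  - exact: IntZ.
  - exact: Int_mollify_sub.
  rewrite RintegralZl// RintegralB//; last exact: integrable_mollify.
  by rewrite Rintegral_mollify_indic// subrr addr0.
have cvgh x : h k x @[k --> \oo] --> (0 : R).
  have [Ax|Ax] := pselect (A x); last first.
    by rewrite /h indicE memNset//; under eq_fun do rewrite mul0r; exact: cvg_cst.
  have /nbhs_ballP[r /= r0 xr] := open_nbhs_nbhs (conj oA Ax).
  apply: cvg_near_cst; near=> k.
  rewrite /h; suff -> : mollify k \1_A x = 1 by rewrite subrr mulr0.
  rewrite -[RHS](Rintegral_mollifier_r k x); apply: eq_Rintegral => y _.
  have [->|/mollifier_support xy] := eqVneq (mollifier k (x - y)) 0; first by rewrite mulr0.
  rewrite indicE mem_set ?mul1r//; apply: xr; rewrite mx_norm_ball /ball_/=.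
  apply: le_lt_trans xy _; near: k; exact: near_infty_natSinv_lt (PosNum r0).
have := @dominated_convergence _ _ _ leb _ measurableT (fun k => EFin \o h k) (cst 0%E)
  (EFin \o \1_A).
case=> //.
- by move=> k; have /integrableP[] := ih k.
- by apply: aeW => x _; apply/fine_cvgP; split; [exact: nearW|exact: cvgh].
- apply: aeW => x k _; rewrite /= lee_fin /h normrM (ger0_norm (_ : 0 <= \1_A x :> R)) ?indicE// ler_piMr//.
  have m0 := mollify_indic_ge0 k A x; have m1 := mollify_indic_le1 k x mA Afin.
  by rewrite ler_norml; apply/andP; split; lra.
move=> _ _ H.
have {}H : (\int[leb]_x h k x)%R @[k --> \oo] --> (0 : R).
  by move: H; rewrite integral0 => /fine_cvg.
have e2 : 0 < e / 2 by rewrite divr_gt0.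
have {}H := cvgr0_norm_lt _ H _ e2.
near=> k; rewrite E lee_fin.
have : `|\int[leb]_x h k x| < e / 2 by near: k; exact: H.
move=> /ltW /ler_normlW hk.
by rewrite mulrC -ler_pdivlMr.
Unshelve. all: by end_near. Qed.

End mollification_L1.

Section dominated_L1.
Context d (T : measurableType d) (R : realType).
Variable m : {measure set T -> \bar R}.

Lemma dominated_L1 (f_ : nat -> T -> R) (f g : T -> R) :
  (forall k, measurable_fun setT (f_ k)) -> measurable_fun setT f ->
  {ae m, forall x, f_ k x @[k --> \oo] --> f x} ->
  m.-integrable setT (EFin \o g) -> (forall k x, `|f_ k x| <= g x) ->
  forall e : R, 0 < e ->
    \forall k \near \oo, (\int[m]_x `|f_ k x - f x|%:E <= e%:E)%E.
Proof.
move=> mf_ mf cf ig fg e e0.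
have := @dominated_convergence _ _ _ m _ measurableT (fun k => EFin \o f_ k) (EFin \o f)
  (EFin \o g).
case=> //.
- by move=> k; exact/measurable_EFinP.
- exact/measurable_EFinP.
- apply: filterS cf => x cx _; apply/fine_cvgP; split; [exact: nearW|exact: cx].
- by apply: aeW => x k _; rewrite /= lee_fin.
move=> _ H _.
move/fine_cvgP : H => [Hf /cvgr0_norm_lt/(_ _ e0) H].
near=> k.
have fk : (\int[m]_x `|f_ k x - f x|%:E)%E \is a fin_num by near: k.
rewrite -(fineK fk) lee_fin (le_trans (ler_norm _))//.
by apply: ltW; near: k.
Unshelve. all: by end_near. Qed.

Lemma near_ltn_geP (P : nat -> Prop) : (\forall k \near \oo, P k) ->
  forall j : nat, exists k, (j <= k)%N /\ P k.
Proof.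
move=> [N _ H] j; exists (maxn j N); split; first exact: leq_maxl.
by apply: H => /=; exact: leq_maxr.
Qed.

(** With errors at most 2^-(j+1) the sum of all [|f_ (phi j) - f|] is integrable, hence finite
    almost everywhere, and its terms tend to 0. The bound [j <= phi j] transfers eventual properties
    to the subsequence. *)
Lemma L1_cvg_ae_subseq (f_ : nat -> T -> R) (f : T -> R) :
  (forall k, measurable_fun setT (f_ k)) -> measurable_fun setT f ->
  (forall e : R, 0 < e ->
    \forall k \near \oo, (\int[m]_x `|f_ k x - f x|%:E <= e%:E)%E) ->
  exists phi : nat -> nat, (forall j, (j <= phi j)%N) /\
    {ae m, forall x, f_ (phi j) x @[j --> \oo] --> f x}.
Proof.
move=> mf_ mf H.
have /choice[phi phiE] : forall j, exists k, (j <= k)%N /\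
    (\int[m]_x `|f_ k x - f x|%:E <= (1 / (2 ^ j.+1)%:R)%:E)%E.
  move=> j; apply: near_ltn_geP; apply: H.
  by rewrite divr_gt0// ltr0n expn_gt0.
exists phi; split; first by move=> j; have [] := phiE j.
pose g j x : \bar R := `|f_ (phi j) x - f x|%:E.
have mg j : measurable_fun setT (g j).
  by apply/measurable_EFinP; apply: measurableT_comp => //; exact: measurable_funB.
have g0 j x : (0 <= g j x)%E by rewrite lee_fin.
have S : (\int[m]_x (\sum_(j <oo) g j x) < +oo)%E.
  rewrite integral_nneseries//.
  apply: (@le_lt_trans _ _ (\sum_(j <oo) (1 / (2 ^ j.+1)%:R)%:E)%E).
    apply: lee_nneseries => [j _ _|j _]; first exact: integral_ge0.
    by have [] := phiE j.
  by apply: (@le_lt_trans _ _ 1%:E); [exact: epsilon_trick0|exact: ltry].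
have mS : measurable_fun setT (fun x => \sum_(j <oo) g j x)%E.
  exact: ge0_emeasurable_sum.
have S0 x : (0 <= \sum_(j <oo) g j x)%E by exact: nneseries_ge0.
apply: filterS (ae_fin_ge0_integral mS S0 S) => x; rewrite ge0_fin_numE// => Sx.
have tail := nneseries_tail_cvg Sx (fun j _ => g0 j x).
apply/subr_cvg0; apply: norm_cvg0.
suff : (g j x @[j --> \oo] --> 0)%E by move=> /fine_cvg.
apply: (squeeze_cvge _ (cvg_cst 0%E) tail); near=> j.
rewrite g0/=; have := @nneseries_lim_ge _ (fun j => g j x) xpredT j j.+1 (fun j _ _ => g0 j x).
by rewrite big_nat1.
Unshelve. all: by end_near. Qed.

End dominated_L1.

Section mollification_converges.
Context {R : realType} {n : nat}.
Local Notation V := 'rV[R]_n.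
Local Notation leb := (@lebesgue_rV R n).
Local Notation Int U := (leb.-integrable setT (EFin \o U)).

Lemma eq_mollify_cvg (U W : V -> R) : U =1 W -> mollify_cvg U -> mollify_cvg W.
Proof. by move=> /funext ->. Qed.

Definition oball (N : nat) : set V := [set x | `|x| < N%:R].

Lemma open_oball N : open (oball N).
Proof.
rewrite (_ : oball N = (fun x : V => `|x|) @^-1` `]-oo, N%:R[%classic).
  by apply: open_comp; [move=> x _; exact: norm_continuous|exact: interval_open].
by apply/seteqP; split => x /=; rewrite in_itv/=.
Qed.

Lemma oball_fin N : (leb (oball N) < +oo)%E.
Proof.
apply: le_lt_trans (@lebesgue_rV_norm_le R n N%:R); apply: le_measure.
- by rewrite inE; apply: open_measurable_rV; exact: open_oball.
- by rewrite inE; exact: measurable_rV_norm_le.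
- by move=> x /= /ltW.
Qed.

(** Pi-lambda theorem from open sets. The ball keeps measures finite: a complement becomes a
    difference of two integrable indicators, and a disjoint union is the L^1 limit of its finite
    partial unions. *)
Lemma mollify_cvg_indic (N : nat) (A : set V) : measurable A ->
  mollify_cvg \1_(A `&` oball N).
Proof.
have mO : measurable (oball N) by apply: open_measurable_rV; exact: open_oball.
have fO (B : set V) : measurable B -> (leb (B `&` oball N) < +oo)%E.
  move=> mB; apply: le_lt_trans (oball_fin N); apply: le_measure; rewrite ?inE//.
  exact: measurableI.
have := @dynkin_induction _ _ (@open V) (fun A => mollify_cvg \1_(A `&` oball N))
  measurable_rV_open.
move=> H mA; apply: H; last by rewrite -measurable_rV_open.
- by move=> B C oB oC; exact: openI.
- by rewrite setTI; apply: mollify_cvg_open; [exact: open_oball|exact: oball_fin].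
- move=> B oB; apply: mollify_cvg_open; first by apply: openI => //; exact: open_oball.
  by apply: fO; exact: open_measurable_rV.
- move=> B mB PB.
  have PO : mollify_cvg \1_(oball N).
    by apply: mollify_cvg_open; [exact: open_oball|exact: oball_fin].
  apply: eq_mollify_cvg (mollify_cvgD PO (mollify_cvgZ (-1) PB)) => x.
  rewrite !indicE !in_setI in_setC; case: (x \in B) => /=; case: (x \in oball N) => //=;
    rewrite ?mulr1n ?mulr0n; ring.
- move=> F mF tF PF.
  have mUF : measurable (\bigcup_k F k `&` oball N).
    by apply: measurableI => //; exact: bigcupT_measurable.
  pose G m := \big[setU/set0]_(k < m) F k `&` oball N.
  have mG m : measurable (G m) by apply: measurableI => //; exact: bigsetU_measurable.
  have PG m : mollify_cvg \1_(G m).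
    rewrite /G; elim: m => [|m IH].
      rewrite big_ord0 set0I; apply: eq_mollify_cvg (mollify_cvgZ 0 (PF 0%N)) => x.
      by rewrite indic0 mul0r.
    apply: eq_mollify_cvg (mollify_cvgD IH (PF m)) => x.
    rewrite big_ord_recr/= !indicE !in_setI in_setU.
    have [xF|] := boolP (x \in F m); last by rewrite orbF mulr0n addr0.
    have [/set_mem xB|] := boolP (x \in \big[setU/set0]_(k < m) F k); last first.
      by rewrite /= mulr0n add0r.
    exfalso; move: xB; rewrite -bigcup_mkord => -[k /= km Fk].
    have := tF k m I I; rewrite -(_ : (k = m)%N) ?ltnn in km *.
      by [].
    by apply/esym/tF => //; exists x; split => //; exact: set_mem.
  apply: mollify_cvg_closed; first by apply: Int_indic => //; apply: fO; exact: bigcupT_measurable.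
  move=> e e0.
  have [m0 _ /(_ m0 (leqnn _)) Hm0] : \forall m \near \oo,
      (\int[leb]_x `|\1_(G m) x - \1_(\bigcup_k F k `&` oball N) x|%:E <= e%:E)%E.
    apply: (dominated_L1 (f_ := fun m => \1_(G m) : V -> R) (g := \1_(oball N)) _ _ _ _ _ e0) => //.
  - apply: aeW => x; apply: cvg_near_cst.
    have [[[k _ Fk] xO]|nx] := pselect ((\bigcup_k F k `&` oball N) x); last first.
      near=> m; rewrite !indicE !memNset// /G => -[+ xO].
      by rewrite -bigcup_mkord => -[k _ Fk]; apply: nx; split => //; exists k.
    near=> m; rewrite !indicE !mem_set//; first by split => //; exists k.
    split => //; rewrite -bigcup_mkord; exists k => //=.
    by near: m; exact: nbhs_infty_gt.
  - by apply: Int_indic => //; exact: oball_fin.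
  - move=> m x; rewrite ger0_norm// !indicE /G in_setI ler_nat.
    by case: (x \in oball N); rewrite ?andbT ?andbF// leq_b1.
  exists \1_(G m0) => //.
  by move: Hm0; rewrite /L1norm; under eq_integral do rewrite distrC.
Unshelve. all: by end_near. Qed.

Lemma mollify_cvg_sum (I : Type) (s : seq I) (F : I -> V -> R) :
  (forall i, mollify_cvg (F i)) -> mollify_cvg (fun x => \sum_(i <- s) F i x).
Proof.
move=> PF; elim: s => [|i s IH].
  have P0 := mollify_cvgZ 0 (mollify_cvg_indic 0 measurable0).
  by apply: eq_mollify_cvg P0 => x; rewrite big_nil mul0r.
by apply: eq_mollify_cvg (mollify_cvgD (PF i) IH) => x; rewrite big_cons.
Qed.

Lemma measurable_oball N : measurable (oball N).
Proof. by apply: open_measurable_rV; exact: open_oball. Qed.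

Import HBSimple.

Lemma mollify_cvg_sfun (N : nat) (g : {sfun V >-> R}) :
  mollify_cvg (fun x => g x * \1_(oball N) x).
Proof.
have H := @mollify_cvg_sum R (finmap.enum_fset (fset_set (range g)))
  (fun r x => r * \1_(g @^-1` [set r] `&` oball N) x).
apply: eq_mollify_cvg (H _) => [x|r].
  rewrite (fimfunE g) fsbig_finite//= mulr_suml; apply: eq_bigr => r _.
  by rewrite -mulrA !indicE in_setI -natrM mulnb.
by apply: mollify_cvgZ; exact: mollify_cvg_indic.
Qed.

(** Two approximations in L^1: [U] by its truncations to balls, and each truncation by simple
    functions on the same ball. *)
Lemma mollify_cvg_integrable U : Int U -> mollify_cvg U.
Proof.
move=> iU; have mU : measurable_fun setT U by have /integrableP[/measurable_EFinP] := iU.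
have mO N : measurable_fun [set: V] (\1_(oball N) : V -> R).
  by apply: measurable_indic; exact: measurable_oball.
have iUO N : Int (fun x => U x * \1_(oball N) x).
  apply: (@le_integrable _ _ _ leb _ measurableT _ (EFin \o U)) => //.
    by apply/measurable_EFinP; exact: measurable_funM.
  by move=> x _; rewrite /= lee_fin normrM ler_piMr// indicE ger0_norm// lern1 leq_b1.
have PUO N : mollify_cvg (fun x => U x * \1_(oball N) x).
  apply: mollify_cvg_closed => // e e0.
  have [g [ig _ gU]] := approximation_sfun_integrable measurableT iU.
  have [j gj] : exists j, (\int[leb]_x `|(EFin \o U) x - (g j x)%:E| <= e%:E)%E.
    have [Hf /cvgr0_norm_lt/(_ _ e0) H] := (fine_cvgP _ _).1 gU.
    have [j [_ [fj ej]]] := near_ltn_geP (filterI Hf H) 0%N.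
    exists j; rewrite -(fineK fj) lee_fin (le_trans (ler_norm _))//; exact: ltW.
  exists (fun x => g j x * \1_(oball N) x); first exact: mollify_cvg_sfun.
  apply: le_trans gj; apply: ge0_le_integral => //.
  - apply/measurable_EFinP; apply: measurableT_comp => //.
    by apply: measurable_funB; exact: measurable_funM.
  - apply: measurableT_comp => //; apply: emeasurable_funB; exact/measurable_EFinP.
  - move=> x _; rewrite -EFinB lee_fin -mulrBl normrM ler_piMr//.
    by rewrite indicE ger0_norm// lern1 leq_b1.
apply: mollify_cvg_closed => // e e0.
have [N _ /(_ N (leqnn _)) HN] : \forall N \near \oo,
    (\int[leb]_x `|U x * \1_(oball N) x - U x|%:E <= e%:E)%E.
  apply: (dominated_L1 (f_ := fun N x => U x * \1_(oball N) x) (g := fun x => `|U x|) _ _ _ _ _ e0) => //.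
  - by move=> N; exact: measurable_funM.
  - apply: aeW => x; apply: cvg_near_cst; near=> N.
    rewrite indicE mem_set ?mulr1// /oball/=.
    by near: N; exact: nbhs_infty_gtr.
  - exact: integrable_norm.
  - by move=> N x; rewrite normrM ler_piMr// indicE ger0_norm// lern1 leq_b1.
exists (fun x => U x * \1_(oball N) x) => //.
by move: HN; rewrite /L1norm; under eq_integral do rewrite distrC.
Unshelve. all: by end_near. Qed.

End mollification_converges.

(** * Square-integrable functions and the unit ball *)

Section square_integrable.
Context d (T : measurableType d) (R : realType).
Variable m : {measure set T -> \bar R}.
Implicit Types a b : T -> R.

Definition L2 a := measurable_fun setT a /\ (\int[m]_x (a x ^+ 2)%:E < +oo)%E.

Lemma integral_mul_le a b (A B : R) :
  measurable_fun setT a -> measurable_fun setT b ->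
  (\int[m]_x (a x ^+ 2)%:E <= A%:E)%E -> (\int[m]_x (b x ^+ 2)%:E <= B%:E)%E ->
  (\int[m]_x `|a x * b x|%:E <= (Num.sqrt (A * B))%:E)%E.
Proof.
move=> ma mb aA bB.
have a0 : (0 <= \int[m]_x (a x ^+ 2)%:E)%E.
  by apply: integral_ge0 => x _; rewrite lee_fin sqr_ge0.
have b0 : (0 <= \int[m]_x (b x ^+ 2)%:E)%E.
  by apply: integral_ge0 => x _; rewrite lee_fin sqr_ge0.
have A0 : 0 <= A by have := le_trans a0 aA; rewrite lee_fin.
have B0 : 0 <= B by have := le_trans b0 bB; rewrite lee_fin.
have H := @ge0_hoelder _ _ _ m (fun x => (a x ^+ 2)%:E) (fun x => (b x ^+ 2)%:E) 2^-1 2^-1.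
have E x : `|a x * b x|%:E = ((a x ^+ 2)%:E `^ 2^-1 * (b x ^+ 2)%:E `^ 2^-1)%E.
  by rewrite !poweR_EFin -EFinM !powR12_sqrt ?sqr_ge0// !sqrtr_sqr normrM.
under eq_integral do rewrite E.
apply: le_trans (H _ _ _ _ _ _ _) _ => //.
- by apply/measurable_EFinP; exact: measurable_funX.
- by apply/measurable_EFinP; exact: measurable_funX.
- by move=> x; rewrite lee_fin sqr_ge0.
- by move=> x; rewrite lee_fin sqr_ge0.
- by rewrite [RHS](splitr 1) !mul1r.
apply: (@le_trans _ _ (A%:E `^ 2^-1 * B%:E `^ 2^-1)%E).
  by apply: lee_pmul; rewrite ?poweR_ge0// le_poweR.
by rewrite !poweR_EFin -EFinM lee_fin !powR12_sqrt// sqrtrM.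
Qed.

Lemma L2_bound a : L2 a ->
  (\int[m]_x (a x ^+ 2)%:E)%E = (\int[m]_x (a x ^+ 2))%:E.
Proof.
move=> [ma ay]; rewrite /Rintegral fineK// ge0_fin_numE//.
by apply: integral_ge0 => x _; rewrite lee_fin sqr_ge0.
Qed.

Lemma L2_mul a b : L2 a -> L2 b -> m.-integrable setT (EFin \o (fun x => a x * b x)).
Proof.
move=> La Lb; apply/integrableP; split.
  by apply/measurable_EFinP; apply: measurable_funM; [case: La|case: Lb].
apply: le_lt_trans (ltry (Num.sqrt (\int[m]_x (a x ^+ 2) * \int[m]_x (b x ^+ 2)))).
by apply: integral_mul_le; rewrite ?L2_bound//; [case: La|case: Lb].
Qed.

Lemma Rintegral_mul_le a b (A B : R) : L2 a -> L2 b ->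
  (\int[m]_x (a x ^+ 2)%:E <= A%:E)%E -> (\int[m]_x (b x ^+ 2)%:E <= B%:E)%E ->
  `|\int[m]_x (a x * b x)| <= Num.sqrt (A * B).
Proof.
move=> La Lb aA bB.
apply: (le_trans (le_normr_Rintegral measurableT (L2_mul La Lb))).
rewrite -lee_fin /Rintegral fineK.
  by apply: integral_mul_le => //; [case: La|case: Lb].
apply: integrable_fin_num => //; exact: integrable_norm (L2_mul La Lb).
Qed.

Lemma L2D a b : L2 a -> L2 b -> L2 (fun x => a x + b x).
Proof.
move=> [ma ay] [mb by_]; split; first exact: measurable_funD.
have ma2 : measurable_fun setT (fun x => (a x ^+ 2)%:E).
  by apply/measurable_EFinP; exact: measurable_funX.
have mb2 : measurable_fun setT (fun x => (b x ^+ 2)%:E).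
  by apply/measurable_EFinP; exact: measurable_funX.
apply: (@le_lt_trans _ _ (\int[m]_x (2%:E * ((a x ^+ 2)%:E + (b x ^+ 2)%:E)))%E).
  apply: ge0_le_integral => //.
  - by move=> x _; rewrite lee_fin sqr_ge0.
  - by apply/measurable_EFinP; apply: measurable_funX; exact: measurable_funD.
  - by apply: emeasurable_funM => //; exact: emeasurable_funD.
  - move=> x _; rewrite -EFinD -EFinM lee_fin.
    have := sqr_ge0 (a x - b x); nra.
rewrite ge0_integralZl//; last 2 first.
- exact: emeasurable_funD.
- by move=> x _; rewrite -EFinD lee_fin addr_ge0// sqr_ge0.
rewrite ge0_integralD//; [|by move=> x _; rewrite lee_fin sqr_ge0..].
rewrite lte_mul_pinfty ?lee_fin//; exact: lte_add_pinfty.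
Qed.

Lemma L2Z (r : R) a : L2 a -> L2 (fun x => r * a x).
Proof.
move=> [ma ay]; split; first exact: measurable_funM.
under eq_integral do rewrite exprMn EFinM.
rewrite ge0_integralZl//; last 3 first.
- by apply/measurable_EFinP; exact: measurable_funX.
- by move=> x _; rewrite lee_fin sqr_ge0.
- by rewrite lee_fin sqr_ge0.
by rewrite lte_mul_pinfty ?lee_fin ?sqr_ge0.
Qed.

Lemma L2B a b : L2 a -> L2 b -> L2 (fun x => a x - b x).
Proof.
move=> La Lb; have := L2D La (L2Z (-1) Lb).
by under eq_fun do rewrite mulN1r.
Qed.

Lemma L2_le a b : measurable_fun setT a -> (forall x, `|a x| <= `|b x|) -> L2 b -> L2 a.
Proof.
move=> ma ab [mb by_]; split => //; apply: le_lt_trans by_.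
apply: ge0_le_integral => //.
- by move=> x _; rewrite lee_fin sqr_ge0.
- by apply/measurable_EFinP; exact: measurable_funX.
- by apply/measurable_EFinP; exact: measurable_funX.
- by move=> x _; rewrite lee_fin -(real_normK (num_real (a x))) -(real_normK (num_real (b x)))
    ler_sqr ?nnegrE.
Qed.

End square_integrable.

Section unit_ball_facts.
Context {R : realType} {n : nat}.
Local Notation V := 'rV[R]_n.
Local Notation leb := (@lebesgue_rV R n).
Local Notation B := (@unit_ball R n).
Local Notation Int U := (leb.-integrable setT (EFin \o U)).

Lemma continuous_sqnorm : continuous (@sqnorm R n).
Proof. exact: smooth_gen_continuous (@smooth_gen_sqnorm R n). Qed.

Lemma open_unit_ball : open B.
Proof.
rewrite unit_ballE (_ : mkset _ = @sqnorm R n @^-1` `]-oo, 1[%classic).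
  by apply: open_comp; [move=> x _; exact: continuous_sqnorm|exact: interval_open].
by apply/seteqP; split => x /=; rewrite in_itv/=.
Qed.

Lemma measurable_unit_ball : measurable B.
Proof. exact: open_measurable_rV open_unit_ball. Qed.

Lemma unit_ball_fin : (leb B < +oo)%E.
Proof.
apply: le_lt_trans (@lebesgue_rV_norm_le R n 1); apply: le_measure.
- by rewrite inE; exact: measurable_unit_ball.
- by rewrite inE; exact: measurable_rV_norm_le.
- by rewrite unit_ballE => x /= x1; apply: sqnorm_norm => //; rewrite mulr1.
Qed.

Lemma closed_sqnorm_le (r : R) : closed [set x : V | sqnorm x <= r].
Proof.
rewrite (_ : mkset _ = @sqnorm R n @^-1` [set t | t <= r])//.
by apply: closed_comp; [move=> x _; exact: continuous_sqnorm|exact: closed_le].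
Qed.

Lemma Lp_onP (D : set V) (p : R) (u : V -> R) : 0 < p -> Lp_on D p u ->
  measurable_fun setT (u \_ D) /\ (\int[leb]_x (`|(u \_ D) x| `^ p)%:E < +oo)%E.
Proof.
move=> p0 /andP[mu fu]; split; first exact: set_mem mu.
have := set_mem fu; rewrite /= /finite_norm => H.
have := poweR_lty p H; rewrite poweR_Lnorm ?gt_eqF//.
Qed.

Lemma Lp_on_L2 (D : set V) (u : V -> R) : Lp_on D 2 u -> L2 leb (u \_ D).
Proof.
move=> /Lp_onP[//|mu uy]; split => //.
under eq_integral do rewrite -(real_normK (num_real _)) -powR_mulrn//.
exact: uy.
Qed.

(** [sqnorm] attains its maximum on the compact support. The margin left before 1 is the room in
    which mollifiers centred on the support remain test functions of the ball. *)
Lemma test_function_margin f : test_function B f ->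
  exists2 r : R, 0 < r < 1 & forall x, closure [set x | f x != 0] x -> sqnorm x <= r.
Proof.
move=> [sf cf fB]; set K := closure _ in cf fB *.
have [K0|K0] := pselect (K !=set0); last first.
  exists (2^-1); first by rewrite invr_gt0 ltr0n invf_lt1// ltr1n.
  by move=> x Kx; exfalso; apply: K0; exists x.
have [c cK H] := @EVT_max_rV R n (@sqnorm R n) _ K0 cf
  (continuous_subspaceT continuous_sqnorm).
have c1 : sqnorm c < 1 by have := fB _ (set_mem cK); rewrite unit_ballE.
have c0 := sqnorm_ge0 c.
(* A midpoint and not the maximum itself, which may be 0. *)
exists ((sqnorm c + 1) / 2); first by apply/andP; split; lra.
by move=> x Kx; have := H x (mem_set Kx); lra.
Qed.

(** In each coordinate the cross term contributes at most 2e and the square of [z] at most e^2 <= e;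
    hence the factor 3. *)
Lemma sqnorm_perturb (x z : V) (e : R) : e <= 1 -> sqnorm x <= 1 -> `|z| <= e ->
  sqnorm (x - z) <= sqnorm x + 3 * n%:R * e.
Proof.
move=> e1 x1 ze; rewrite /sqnorm.
apply: (@le_trans _ _ (\sum_i (x ord0 i * x ord0 i + 3 * e))).
  apply: ler_sum => i _; rewrite !mxE.
  have xi : `|x ord0 i| <= 1.
    rewrite -ler_sqr ?nnegrE// real_normK ?num_real// expr2 expr1n.
    exact: le_trans (sqnorm_coord x i) x1.
  have zi : `|z ord0 i| <= e by exact: le_trans (rV_norm_coord z i) ze.
  have xz : `|x ord0 i * z ord0 i| <= e.
    by rewrite normrM -[e]mul1r ler_pM.
  have zz : z ord0 i * z ord0 i <= e.
    rewrite (le_trans (ler_norm _))// normrM -[e]mul1r ler_pM//.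
    exact: le_trans zi e1.
  have := ler_normr (x ord0 i * z ord0 i) e.
  move: xz; rewrite ler_norml => /andP[xz _] _; lra.
by rewrite big_split/= sumr_const card_ord -[X in _ + X <= _]mulr_natl lerD2l mulrCA mulrA.
Qed.

Lemma test_function_mollifier k x (r : R) : sqnorm x <= r ->
  r + 3 * n%:R * k.+1%:R^-1 < 1 ->
  test_function B (fun y => mollifier k (x - y)).
Proof.
move=> xr rk; apply/test_functionP; split.
  by apply: Ccinfty_reflect; exact: Ccinfty_mollifier.
have k0 : 0 <= k.+1%:R^-1 :> R by [].
have r1 : r <= 1 by rewrite (le_trans _ (ltW rk))// lerDl !mulr_ge0.
apply: (@subset_trans _ [set y : V | sqnorm y <= r + 3 * n%:R * k.+1%:R^-1]).
  apply: closure_subset_closed; first exact: closed_sqnorm_le.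
  move=> y /= /mollifier_support xy; rewrite -[y](subKr x).
  apply: le_trans (sqnorm_perturb _ _ xy) _.
  - by rewrite invf_le1// ler1n.
  - exact: le_trans r1.
  - by rewrite lerD2r.
by rewrite unit_ballE => y /= yr; exact: le_lt_trans rk.
Qed.

Lemma near_margin (r s : R) : r < s ->
  \forall k \near \oo, r + 3 * n%:R * k.+1%:R^-1 < s.
Proof.
move=> rs; have p0 : 0 < 3 * n%:R + 1 :> R by rewrite ltr_wpDl// mulr_ge0.
have e0 : 0 < (s - r) / (3 * n%:R + 1) by rewrite divr_gt0 ?subr_gt0.
near=> k; have : k.+1%:R^-1 < (s - r) / (3 * n%:R + 1).
  by near: k; exact: near_infty_natSinv_lt (PosNum e0).
rewrite ltr_pdivlMr// mulrDr mulr1 => H.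
by rewrite -ltrBrDl mulrC; apply: le_lt_trans H; rewrite lerDl.
Unshelve. all: by end_near. Qed.

Lemma test_function_out (f : V -> R) x : test_function B f -> ~ B x -> f x = 0.
Proof.
move=> [_ _ fB] nBx; apply: contrapT => /eqP fx; apply: nBx; apply: fB.
exact: subset_closure.
Qed.

Lemma Ccinfty_test (D : set V) f : test_function D f -> Ccinfty f.
Proof. by move=> /test_functionP[]. Qed.

Lemma Ccinfty_L2 f : Ccinfty f -> L2 leb f.
Proof.
move=> cf; split; first by apply: smooth_measurable; case: cf.
have := Ccinfty_integrable (CcinftyMl cf (proj1 cf)).
move=> /integrableP[_]; apply: le_lt_trans; rewrite le_eqVlt; apply/orP; left; apply/eqP.
by apply: eq_integral => x _; rewrite /= -expr2 ger0_norm// sqr_ge0.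
Qed.

Lemma patch_mulr (D : set V) (u h : V -> R) :
  (fun x => u x * h x) \_ D = (fun x => (u \_ D) x * h x).
Proof. by apply/funext => x; rewrite !patchE; case: ifPn => // _; rewrite mul0r. Qed.

Lemma weak_partialE (i : 'I_n) u w f : weak_partial B i u w -> test_function B f ->
  \int[leb]_x ((u \_ B) x * partial i f x) = - \int[leb]_x ((w \_ B) x * f x).
Proof.
move=> H tf; have := H f tf; rewrite Rintegral_mkcond patch_mulr.
by rewrite [X in _ = - X -> _]Rintegral_mkcond patch_mulr.
Qed.

Lemma L2_ball_Int (U : V -> R) : L2 leb U -> (forall x, ~ B x -> U x = 0) -> Int U.
Proof.
move=> [mU Uy] UB.
apply: (@le_integrable _ _ _ leb _ measurableT _ (EFin \o (fun x => \1_B x + U x ^+ 2))).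
- exact/measurable_EFinP.
- move=> x _; rewrite /= lee_fin indicE.
  have [/set_mem xB|/negP nB] := boolP (x \in B); last first.
    by rewrite UB ?normr0// => Bx; apply: nB; exact: mem_set.
  rewrite mulr1n [leRHS]ger0_norm ?addr_ge0 ?sqr_ge0// -(real_normK (num_real (U x))).
  have := normr_ge0 (U x); have := sqr_ge0 (`|U x| - 1); nra.
- apply: IntD; first by apply: Int_indic; [exact: measurable_unit_ball|exact: unit_ball_fin].
  apply/integrableP; split; first by apply/measurable_EFinP; exact: measurable_funX.
  by under eq_integral do rewrite /= ger0_norm ?sqr_ge0//.
Qed.

Lemma patch_out (D : set V) (u : V -> R) x : ~ D x -> (u \_ D) x = 0.
Proof. by move=> nD; rewrite patchE memNset. Qed.

End unit_ball_facts.

(** * Local integrability of u to the Sobolev exponent *)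

Section fatou_bound.
Context d (T : measurableType d) (R : realType).
Variable m : {measure set T -> \bar R}.

Lemma fatou_bound (f_ : nat -> T -> R) (f : T -> R) (C : \bar R) :
  (forall k, measurable_fun setT (f_ k)) -> measurable_fun setT f ->
  (forall k x, 0 <= f_ k x) ->
  {ae m, forall x, f_ k x @[k --> \oo] --> f x} ->
  (\forall k \near \oo, (\int[m]_x (f_ k x)%:E <= C)%E) ->
  (\int[m]_x (f x)%:E <= C)%E.
Proof.
move=> mf_ mf f0 cf [K _ HK].
have mF k : measurable_fun setT (EFin \o f_ (k + K)%N) by exact/measurable_EFinP.
have H := fatou m measurableT mF (fun k x _ => f0 (k + K)%N x).
rewrite (ae_eq_integral (fun x => limn_einf (fun k => (f_ (k + K)%N x)%:E))) //.
- apply: le_trans H _; rewrite limn_einf_lim; apply: lime_le; first exact: is_cvg_einfs.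
  apply: nearW => k; apply: (@le_trans _ _ (\int[m]_x (f_ (k + K)%N x)%:E)%E).
    by apply: ereal_inf_lbound; exists k => //=.
  by apply: HK => /=; exact: leq_addl.
- exact/measurable_EFinP.
- rewrite (_ : (fun x => _) =
      (fun x => - limn_esup (-%E \o (fun k => (f_ (k + K)%N x)%:E)))%E); last first.
    by apply/funext => x; rewrite limn_esupN oppeK.
  apply: measurableT_comp => //.
  apply: (measurable_fun_limn_esup (f := fun k x => (- (f_ (k + K)%N x)%:E)%E)) => k.
  by apply/measurable_EFinP; apply: measurableT_comp => //; exact: mf_.
- apply: filterS cf => x cx _.
  have cK : (f_ (k + K)%N x)%:E @[k --> \oo] --> (f x)%:E.
    apply/fine_cvgP; split; first exact: nearW.
    by rewrite (cvg_shiftn K (fun k => f_ k x)).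
  by rewrite is_cvg_limn_einfE; [exact/esym/cvg_lim|apply/cvg_ex; exists (f x)%:E].
Qed.

End fatou_bound.

Section local_integrability.
Context {R : realType}.
Local Notation leb := (@lebesgue_rV R).
Local Notation Int U := ((leb _).-integrable setT (EFin \o U)).

Lemma cvg_norm_powR (a_ : nat -> R) (a q : R) : 1 < q ->
  a_ k @[k --> \oo] --> a -> `|a_ k| `^ q @[k --> \oo] --> `|a| `^ q.
Proof.
move=> q1 ca; have H : {for a, continuous (fun z : R => `|z| `^ q)}.
  apply: differentiable_continuous; apply/derivable1_diffP.
  by have [] := is_derive_abs_powR a q1.
exact: (cvg_comp _ _ ca H).
Qed.

(** The margin makes the kernel [y -> mollifier k (x - y)] a test function of the ball, to which the
    weak derivative applies; its sign cancels the one produced by the reflection in [y]. *)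
Lemma partial_mollify_weak n (k : nat) (i : 'I_n) (u w : 'rV[R]_n -> R) (x : 'rV[R]_n) (r : R) :
  Int (u \_ unit_ball) -> weak_partial unit_ball i u w ->
  sqnorm x <= r -> r + 3 * n%:R * k.+1%:R^-1 < 1 ->
  partial i (mollify k (u \_ unit_ball)) x = mollify k (w \_ unit_ball) x.
Proof.
move=> iU wp xr rk; have tf := test_function_mollifier xr rk.
rewrite mollifyE partial_translate_integral//; last 2 first.
- exact: measurable_rV_opp.
- exact: Ccinfty_mollifier.
have := weak_partialE wp tf; rewrite partial_reflect; last by case: (@Ccinfty_mollifier R n k).
rewrite /mollify => /(congr1 -%R); rewrite opprK => <-.
rewrite /translate_integral -[LHS]opprK; congr (- _).
rewrite -mulN1r -RintegralZl//; last first.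
  apply: (integrable_translate iU measurable_rV_opp).
  by apply: Ccinfty_partial; exact: Ccinfty_mollifier.
by apply: eq_Rintegral => y _; rewrite mulN1r mulrN.
Qed.

(** The products of [f] with mollifications of [u] are smooth, compactly supported, and bounded in
    gradient, so Sobolev's inequality bounds them in L^q; Fatou's lemma passes this to [f u]. The
    factor [f] confines everything to where mollification commutes with the weak gradient. *)
Lemma local_Lq m (q : R) (u f : 'rV[R]_m.+3 -> R) (g : 'I_m.+3 -> 'rV[R]_m.+3 -> R) :
  q = 2 * m.+3%:R / m.+1%:R ->
  H1_gradient unit_ball u g -> test_function unit_ball f ->
  (\int[leb m.+3]_x (`|f x * (u \_ unit_ball) x| `^ q)%:E < +oo)%E.
Proof.
move=> qE [/Lp_on_L2 LU Hg] tf.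
set U := u \_ unit_ball in LU *.
have [g1 q0 gq gq2 q2] := sobolev_exponents qE erefl.
have q1 : 1 < q.
  by rewrite qE ltr_pdivlMr// mul1r -natrM ltr_nat mulSn (leq_trans _ (leq_addr _ _)).
have iU : Int U by apply: L2_ball_Int => // x; exact: patch_out.
pose G i := g i \_ unit_ball.
have LG i : L2 (leb _) (G i) by apply: Lp_on_L2; case: (Hg i).
have iG i : Int (G i) by apply: L2_ball_Int => // x; exact: patch_out.
have mU : measurable_fun setT U by case: LU.
have [r /andP[r0 r1] fr] := test_function_margin tf.
have cf := Ccinfty_test tf.
have [C C0 fC] := Ccinfty_bounded cf.
have /choice[C' C'E] : forall i, exists C, forall x, `|partial i f x| <= C.
  by move=> i; have [c _ H] := Ccinfty_bounded (Ccinfty_partial i cf); exists c.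
pose M := C + \sum_i `|C' i|.
have M0 : 0 <= M by rewrite addr_ge0// sumr_ge0.
have fM x : `|f x| <= M by rewrite (le_trans (fC x))// lerDl sumr_ge0.
have dfM i x : `|partial i f x| <= M.
  rewrite (le_trans (C'E i x))// /M (bigD1 i)//= addrCA.
  by rewrite (le_trans (ler_norm _))// lerDl addr_ge0// sumr_ge0.
pose EU := \int[leb _]_x (U x ^+ 2); pose EG := \sum_i \int[leb _]_x (G i x ^+ 2).
have EG_ge i : \int[leb _]_x (G i x ^+ 2) <= EG.
  rewrite /EG (bigD1 i)//= lerDl sumr_ge0// => j _.
  by apply: Rintegral_ge0 => x _; exact: sqr_ge0.
(* From (f G + U df)^2 <= 2 (f^2 G^2 + U^2 df^2), with [M] a common bound of [f] and its partial
   derivatives. *)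
pose D := 2 * M ^+ 2 * (EG + EU).
pose F k x := f x * mollify k U x.
have cF k : Ccinfty (F k) by apply: CcinftyMl => //; exact: smooth_mollify.
have dF : \forall k \near \oo, forall i, (\int[leb _]_x (partial i (F k) x ^+ 2)%:E <= D%:E)%E.
  have := @near_margin R m.+3 r 1 r1; apply: filterS => k rk i.
  have pF x : partial i (F k) x = f x * mollify k (G i) x + mollify k U x * partial i f x.
    rewrite /F partialM; [|by case: cf|exact: smooth_mollify].
    have [fx|fx] := eqVneq (f x) 0; first by rewrite fx !mul0r.
    rewrite (@partial_mollify_weak _ _ _ _ (g i) _ r)//; first by case: (Hg i).
    by apply: fr; exact: subset_closure.
  have mT (W : 'rV[R]_m.+3 -> R) : Int W -> measurable_fun setT (fun x => (mollify k W x ^+ 2)%:E).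
    by move=> iW; apply/measurable_EFinP; apply: measurable_funX; exact: measurable_mollify.
  apply: (@le_trans _ _ (\int[leb m.+3]_x ((2 * M ^+ 2)%:E *
      ((mollify k (G i) x ^+ 2)%:E + (mollify k U x ^+ 2)%:E)))%E).
    apply: ge0_le_integral => //.
    - by move=> x _; rewrite lee_fin sqr_ge0.
    - apply/measurable_EFinP; apply: measurable_funX; apply: smooth_measurable.
      by case: (Ccinfty_partial i (cF k)).
    - by apply: emeasurable_funM => //; apply: emeasurable_funD; exact: mT.
    - move=> x _; rewrite -EFinD -EFinM lee_fin pF.
      set a := f x; set b := mollify k (G i) x; set c := mollify k U x; set e := partial i f x.
      have a2 : a ^+ 2 <= M ^+ 2 by rewrite -(real_normK (num_real a)) ler_sqr ?nnegrE ?fM.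
      have e2 : e ^+ 2 <= M ^+ 2 by rewrite -(real_normK (num_real e)) ler_sqr ?nnegrE ?dfM.
      apply: (@le_trans _ _ (2 * (a ^+ 2 * b ^+ 2 + e ^+ 2 * c ^+ 2))).
        have := sqr_ge0 (a * b - c * e); rewrite !expr2; nra.
      have -> : 2 * M ^+ 2 * (b ^+ 2 + c ^+ 2) = 2 * (M ^+ 2 * b ^+ 2 + M ^+ 2 * c ^+ 2) by ring.
      by apply: ler_wpM2l => //; apply: lerD; apply: ler_wpM2r => //; exact: sqr_ge0.
  have M2 : 0 <= 2 * M ^+ 2 by rewrite mulr_ge0// sqr_ge0.
  rewrite ge0_integralZl//; last 2 first.
  - by apply: emeasurable_funD; exact: mT.
  - by move=> x _; rewrite -EFinD lee_fin addr_ge0// sqr_ge0.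
  rewrite ge0_integralD//; [|by move=> x _; rewrite lee_fin sqr_ge0|exact: mT|
    by move=> x _; rewrite lee_fin sqr_ge0|exact: mT].
  rewrite /D [X in (_ <= X)%E]EFinM; apply: lee_wpmul2l => //; rewrite EFinD; apply: leeD.
    by apply: le_trans (integral_sqr_mollify k (iG i)) _; rewrite L2_bound ?lee_fin.
  by apply: le_trans (integral_sqr_mollify k iU) _; rewrite L2_bound ?lee_fin.
have [_ cU] := mollify_cvg_integrable iU.
have [phi [phi_ge aeU]] := L1_cvg_ae_subseq (fun k => measurable_mollify k iU) mU cU.
have bound : \forall k \near \oo, (\int[leb _]_x (`|F (phi k) x| `^ q)%:E <=
    ((2 * m.+2%:R / m.+1%:R)%:E * D%:E `^ 2^-1) `^ q)%E.
  case: dF => K _ HK; exists K => // k /= Kk.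
  have H := sobolev qE erefl (cF (phi k)) (HK _ (leq_trans Kk (phi_ge k))).
  have I0 : (0 <= \int[leb _]_x (`|F (phi k) x| `^ q)%:E)%E.
    by apply: integral_ge0 => x _; rewrite lee_fin powR_ge0.
  have := le_poweR (ltW q0) (poweR_ge0 _ _) H.
  by rewrite -poweRrM mulVf ?gt_eqF// poweRe1.
apply: le_lt_trans (_ : _ < +oo)%E; first apply: (@fatou_bound _ _ _ _ _ _ _ _ _ _ _ bound).
- move=> k; apply: measurable_fun_powR; apply: measurableT_comp => //.
  by apply: smooth_measurable; case: (cF (phi k)).
- apply: measurable_fun_powR; apply: measurableT_comp => //; apply: measurable_funM => //.
  by apply: smooth_measurable; case: cf.
- by move=> k x; exact: powR_ge0.
- apply: filterS aeU => x cx; apply: cvg_norm_powR => //.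
  by rewrite /F; apply: cvgM => //; exact: cvg_cst.
- by apply: poweR_lty; rewrite poweR_EFin -EFinM ltry.
Qed.

End local_integrability.

(** * Kato's inequality *)

Section smooth_absolute_value.
Context {R : realType}.
Implicit Types (e t : R).

(** This is sqrt (t^2 + e^2), written as a power to belong to [power_algebra]. *)
Definition sabs e t : R := (t * t + e ^+ 2) `^ 2^-1.

(* A convex and nonincreasing approximation of the negative part. *)
Definition sneg e t : R := 2^-1 * (sabs e t + -1 * t).

Definition dsabs e t : R := t * (t * t + e ^+ 2) `^ (- 2^-1).

Lemma sqrD_gt0 e t : 0 < e -> 0 < t * t + e ^+ 2.
Proof. by move=> e0; rewrite ltr_wpDl ?exprn_gt0// -expr2 sqr_ge0. Qed.

Lemma smooth1_sneg e : 0 < e -> smooth1 (sneg e).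
Proof.
move=> e0; apply: (@smooth1_power_algebra _ (e ^+ 2)); first exact: exprn_gt0.
apply: power_algebraM; first exact: power_algebra_cst.
apply: power_algebraD; first exact: power_algebra_powR.
by apply: power_algebraM; [exact: power_algebra_cst|exact: power_algebra_id].
Qed.

Lemma sabsE e t : sabs e t = Num.sqrt (t ^+ 2 + e ^+ 2).
Proof. by rewrite /sabs powR12_sqrt ?expr2// addr_ge0// -expr2 sqr_ge0. Qed.

Lemma sabs_ge e t : `|t| <= sabs e t.
Proof.
rewrite sabsE -(sqrtr_sqr t) ler_wsqrtr// lerDl sqr_ge0//.
Qed.

Lemma sabs_le e t : 0 < e -> sabs e t <= `|t| + e.
Proof.
move=> e0; rewrite sabsE.
have te : 0 <= `|t| + e by rewrite addr_ge0// ltW.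
rewrite -(ger0_norm te) -sqrtr_sqr ler_wsqrtr// sqrrD real_normK ?num_real//.
by rewrite lerD2r lerDl mulrn_wge0// mulr_ge0// ltW.
Qed.

Lemma sabs_gt0 e t : 0 < e -> 0 < sabs e t.
Proof. by move=> e0; rewrite /sabs powR_gt0// sqrD_gt0. Qed.

Lemma dsabsE e t : 0 < e -> dsabs e t = t / sabs e t.
Proof. by move=> e0; rewrite /dsabs powRN. Qed.

Lemma is_derive_sabs e t : 0 < e -> is_derive t (1 : R) (sabs e) (dsabs e t).
Proof.
move=> e0; have := @is_derive_sqrD_powR R (e ^+ 2) 2^-1 t (exprn_gt0 _ e0).
have -> : 2^-1 - 1 = - 2^-1 :> R by field.
set P := _ `^ (- _); rewrite (_ : 2^-1 * P * (t + t) = t * P); first by [].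
by field.
Qed.

Lemma dsabs_le1 e t : 0 < e -> `|dsabs e t| <= 1.
Proof.
move=> e0; have s0 := sabs_gt0 t e0.
by rewrite dsabsE// normrM normfV (gtr0_norm s0) ler_pdivrMr// mul1r sabs_ge.
Qed.

Lemma is_derive_sneg e t : 0 < e ->
  is_derive t (1 : R) (sneg e) (2^-1 * (dsabs e t + -1 * 1)).
Proof.
move=> e0; apply: is_deriveZ; apply: is_deriveD; first exact: is_derive_sabs.
Qed.

Lemma derive1_sneg e : 0 < e -> derive1 (sneg e) = (fun t => 2^-1 * (dsabs e t + -1 * 1)).
Proof.
by move=> e0; apply/funext => t; rewrite derive1E; have [_ ->] := is_derive_sneg t e0.
Qed.

Lemma derive1_sneg_le0 e t : 0 < e -> derive1 (sneg e) t <= 0.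
Proof.
move=> e0; rewrite derive1_sneg// pmulr_rle0// mulr1 subr_le0.
by rewrite (le_trans (ler_norm _))// dsabs_le1.
Qed.

Lemma derive1_sneg_norm e t : 0 < e -> `|derive1 (sneg e) t| <= 1.
Proof.
move=> e0; rewrite derive1_sneg//.
by have := dsabs_le1 t e0; rewrite !ler_norml => /andP[H1 H2]; apply/andP; split; lra.
Qed.

(** The second derivative equals e^2 (t^2 + e^2)^(-3/2) / 2; the factor [A] is that power of t^2 +
    e^2. *)
Lemma derive2_sneg_ge0 e t : 0 < e -> 0 <= derive1 (derive1 (sneg e)) t.
Proof.
move=> e0; rewrite derive1_sneg// derive1E.
have c0 : 0 < e ^+ 2 by rewrite exprn_gt0.
have D1 : is_derive t (1 : R) (dsabs e)
   (t * (- 2^-1 * (t * t + e ^+ 2) `^ (- 2^-1 - 1) * (t + t)) + (t * t + e ^+ 2) `^ (- 2^-1) * 1).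
  by apply: is_deriveM; exact: is_derive_sqrD_powR.
have D2 : is_derive t (1 : R) (fun t => 2^-1 * (dsabs e t + -1 * 1)) (2^-1 * (
   (t * (- 2^-1 * (t * t + e ^+ 2) `^ (- 2^-1 - 1) * (t + t)) + (t * t + e ^+ 2) `^ (- 2^-1) * 1) + 0)).
  by apply: is_deriveZ; apply: is_deriveD; exact: is_derive_cst.
have [_ ->] := D2; set A := _ `^ (- _ - _).
have -> : (t * t + e ^+ 2) `^ (- 2^-1) = (t * t + e ^+ 2) * A.
  have S0 := sqrD_gt0 t e0.
  transitivity ((t * t + e ^+ 2) `^ 1 * A); last by rewrite powRr1 ?ltW.
  rewrite /A -powRD; first by congr (_ `^ _); ring.
  by rewrite (gt_eqF S0) implybT.
have A0 : 0 <= A by exact: powR_ge0.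
rewrite (_ : _ * _ = 2^-1 * (e ^+ 2 * A)); last by field.
by rewrite !mulr_ge0// ltW.
Qed.

Lemma sneg_approx e s t : 0 < e -> `|sneg e s - 2^-1 * (`|t| - t)| <= e + `|s - t|.
Proof.
move=> e0; have H1 := sabs_ge e s; have H2 := sabs_le s e0; rewrite /sneg.
have H3 : `|s| <= `|t| + `|s - t| by rewrite -{1}(subrK t s) addrC ler_normD.
have H4 : `|t| <= `|s| + `|s - t| by rewrite distrC -{1}(subrK s t) addrC ler_normD.
have H5 := ler_norm (s - t); have := ler_norm (t - s); rewrite distrC => H6.
by rewrite ler_norml; apply/andP; split; lra.
Qed.

Lemma derive1_sneg_approx e t : 0 < e -> t != 0 ->
  `|derive1 (sneg e) t - 2^-1 * (Num.sg t - 1)| <= e / `|t|.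
Proof.
move=> e0 t0; rewrite derive1_sneg// -mulrBr normrM ger0_norm// mulr1.
have -> : dsabs e t + -1 - (Num.sg t - 1) = dsabs e t - Num.sg t by ring.
have s0 := sabs_gt0 t e0; have H1 := sabs_ge e t; have H2 := sabs_le t e0.
have nt : 0 < `|t| by rewrite normr_gt0.
rewrite dsabsE// {1}[t]numEsg -[X in _ - X]mulr1 -mulrA -mulrBr normrM normr_sg t0 mul1r.
have -> : `|t| / sabs e t - 1 = (`|t| - sabs e t) / sabs e t.
  by rewrite mulrBl mulfV// gt_eqF.
rewrite normrM normfV (gtr0_norm s0) distrC ger0_norm ?subr_ge0//.
apply: (@le_trans _ _ ((sabs e t - `|t|) / sabs e t)).
  apply: ler_piMl; last by rewrite invf_le1 ?ler1n.
  by rewrite divr_ge0 ?subr_ge0 ?(ltW s0).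
apply: ler_pM; rewrite ?subr_ge0// ?invr_ge0 ?(ltW s0)//; first lra.
by rewrite lef_pV2.
Qed.

Lemma cvg_derive1_sneg (e_ a_ : nat -> R) (a : R) : (forall j, 0 < e_ j) ->
  e_ j @[j --> \oo] --> (0 : R) -> a_ j @[j --> \oo] --> a -> a != 0 ->
  derive1 (sneg (e_ j)) (a_ j) @[j --> \oo] --> 2^-1 * (Num.sg a - 1).
Proof.
move=> e0 ce ca a0; apply/subr_cvg0; apply: norm_cvg0.
have na : 0 < `|a| by rewrite normr_gt0.
apply: (@squeeze_cvgr _ _ _ _ (fun=> 0) (fun j => e_ j / (`|a| / 2))); last 2 first.
- exact: cvg_cst.
- by rewrite -[X in _ --> X](mul0r (`|a| / 2)^-1); apply: cvgM => //; exact: cvg_cst.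
near=> j; rewrite normr_ge0/=.
have aj : `|a - a_ j| < `|a| / 2.
  by near: j; apply: cvgr_dist_lt => //; rewrite divr_gt0.
have haj : `|a| / 2 <= `|a_ j|.
  have : `|a| <= `|a_ j| + `|a - a_ j| by rewrite -{1}(subrK (a_ j) a) addrC ler_normD.
  by move=> ?; lra.
have aj0 : a_ j != 0 by rewrite -normr_gt0; lra.
have <- : Num.sg (a_ j) = Num.sg a.
  have := ler_norm (a - a_ j); have := ler_norm (a_ j - a); rewrite distrC => H1 H2.
  have [an|ap|az] := ltgtP a 0; last by rewrite az eqxx in a0.
    by rewrite !ltr0_sg//; move: aj; rewrite (ltr0_norm an) => ?; lra.
  by rewrite !gtr0_sg//; move: aj; rewrite (gtr0_norm ap) => ?; lra.
apply: le_trans (derive1_sneg_approx (e0 j) aj0) _.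
by rewrite ler_wpM2l ?(ltW (e0 j))// lef_pV2 ?posrE// ?divr_gt0//; lra.
Unshelve. all: by end_near. Qed.

End smooth_absolute_value.

(** * Kato's inequality for smooth functions *)

Section kato_smooth.
Context {R : realType} {n : nat}.
Local Notation V := 'rV[R]_n.
Local Notation leb := (@lebesgue_rV R n).
Local Notation Int U := (leb.-integrable setT (EFin \o U)).

Lemma Int_sum (s : seq 'I_n) (f : 'I_n -> V -> R) : (forall i, Int (f i)) ->
  Int (fun x => \sum_(i <- s) f i x).
Proof.
move=> fi; elim: s => [|j s IH]; first by under eq_fun do rewrite big_nil; exact: integrable0.
by under eq_fun do rewrite big_cons; exact: IntD.
Qed.

Lemma Rintegral_sum (s : seq 'I_n) (f : 'I_n -> V -> R) : (forall i, Int (f i)) ->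
  \int[leb]_x (\sum_(i <- s) f i x) = \sum_(i <- s) \int[leb]_x f i x.
Proof.
move=> fi; elim: s => [|i s IH].
  by rewrite big_nil; under eq_Rintegral do rewrite big_nil; rewrite Rintegral_cst// mul0r.
rewrite big_cons -IH -(RintegralD measurableT (fi i) (Int_sum s fi)).
by apply: eq_Rintegral => x _; rewrite big_cons.
Qed.

(** The difference of the two sides is the second derivative of [sneg e] at [v x] times the square
    of [partial i v x], nonnegative by convexity. *)
Lemma partial2_sneg (e : R) (v : V -> R) i x : 0 < e -> smooth v ->
  derive1 (sneg e) (v x) * partial i (partial i v) x <=
  partial i (partial i (fun x => sneg e (v x))) x.
Proof.
move=> e0 sv; have sh := smooth1_sneg e0; have sh' := smooth1_derive sh.
rewrite partial_comp// partialM; [|exact: smooth_comp|exact: smooth_partial].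
rewrite partial_comp// lerDl mulrC -mulrA mulr_ge0 ?derive2_sneg_ge0//.
by rewrite -expr2 sqr_ge0.
Qed.

Lemma Rintegral_partial2 (f g : V -> R) i : Ccinfty f -> smooth g ->
  \int[leb]_x (g x * partial i (partial i f) x) =
  \int[leb]_x (f x * partial i (partial i g) x).
Proof.
move=> cf sg.
have H1 := Rintegral_by_parts i cf (smooth_partial i sg).
have H2 := Rintegral_by_parts i (Ccinfty_partial i cf) sg.
have H3 : \int[leb]_x (partial i f x * partial i g x) =
    \int[leb]_x (partial i g x * partial i f x).
  by apply: eq_Rintegral => x _; rewrite mulrC.
have aux (a b b' c : R) : a = - b -> b' = - c -> b' = b -> c = a.
  by move=> -> bc <-; rewrite bc opprK.
exact: aux H1 H2 H3.
Qed.

Lemma bounded_mul_Int (f q : V -> R) (C : R) : measurable_fun setT f ->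
  (forall x, `|f x| <= C) -> Int q -> Int (fun x => f x * q x).
Proof.
move=> mf fC iq; have mq : measurable_fun setT q by have /integrableP[/measurable_EFinP] := iq.
apply: (@le_integrable _ _ _ leb _ measurableT _ (EFin \o (fun x => C * q x))).
- by apply/measurable_EFinP; exact: measurable_funM.
- move=> x _; rewrite /= lee_fin !normrM ler_wpM2r//.
  exact: le_trans (fC x) (ler_norm _).
- exact: IntZ.
Qed.

(** Write h for [sneg e]. Where [z] is nonzero, convexity bounds the Laplacian of h(v) below by
    h'(v) times that of [v], and h' <= 0 turns the upper bound [q] into the lower bound h'(v) q. Two
    integrations by parts put the Laplacian on [z]. *)
Lemma kato_smooth (e : R) (v z q : V -> R) : 0 < e -> smooth v -> Ccinfty z ->
  (forall x, 0 <= z x) -> Int q ->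
  (forall x, z x != 0 -> \sum_i partial i (partial i v) x <= q x) ->
  \int[leb]_x (z x * (derive1 (sneg e) (v x) * q x)) <=
  \sum_i \int[leb]_x (sneg e (v x) * partial i (partial i z) x).
Proof.
move=> e0 sv cz z0 iq vq.
have sh := smooth1_sneg e0; have shv : smooth (fun x => sneg e (v x)) by exact: smooth_comp.
have mz : measurable_fun setT z by apply: smooth_measurable; case: cz.
have [C C0 zC] := Ccinfty_bounded cz.
have iI i : Int (fun x => z x * partial i (partial i (fun x => sneg e (v x))) x).
  exact: Ccinfty_integrable (CcinftyMl cz (smooth_partial i (smooth_partial i shv))).
under eq_bigr do rewrite Rintegral_partial2//.
have mh : measurable_fun setT (fun x => derive1 (sneg e) (v x)).
  exact: smooth_measurable (smooth_comp (smooth1_derive sh) sv).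
have iL : Int (fun x => z x * (derive1 (sneg e) (v x) * q x)).
  apply: (@bounded_mul_Int _ _ C) => //; apply: (@bounded_mul_Int _ _ 1) => // x.
  exact: derive1_sneg_norm.
rewrite -(Rintegral_sum _ iI); apply: le_Rintegral => //; first exact: Int_sum iI.
move=> x _; rewrite -mulr_sumr.
have [->|zx] := eqVneq (z x) 0; first by rewrite !mul0r.
apply: ler_wpM2l => //.
apply: (@le_trans _ _ (derive1 (sneg e) (v x) * \sum_i partial i (partial i v) x)).
  by apply: ler_wnM2l; [exact: derive1_sneg_le0|exact: vq].
by rewrite mulr_sumr; apply: ler_sum => i _; exact: partial2_sneg.
Qed.

End kato_smooth.

Section kato.
Context {R : realType} {n : nat}.
Local Notation V := 'rV[R]_n.
Local Notation leb := (@lebesgue_rV R n).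
Local Notation B := (@unit_ball R n).
Local Notation Int U := (leb.-integrable setT (EFin \o U)).

Lemma cvg_Rintegral_L1 (f_ : nat -> V -> R) (f : V -> R) :
  (forall j, Int (f_ j)) -> Int f ->
  (forall e : R, 0 < e -> \forall j \near \oo, (L1norm (fun x => f_ j x - f x)%R <= e%:E)%E) ->
  \int[leb]_x f_ j x @[j --> \oo] --> \int[leb]_x f x.
Proof.
move=> if_ ifi H; apply/cvgrPdist_le => e e0; have := H e e0; apply: filterS => j Hj.
rewrite distrC -RintegralB//.
have iB : Int (fun x => f_ j x - f x) by exact: IntB.
apply: le_trans (le_normr_Rintegral measurableT iB) _.
by rewrite -lee_fin /Rintegral fineK//; apply: integrable_fin_num => //; exact: integrable_norm.
Qed.

Lemma near_L1norm_le (f_ g_ : nat -> V -> R) (C : R) :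
  (forall j, measurable_fun setT (f_ j)) -> (forall j, Int (g_ j)) ->
  (forall j x, `|f_ j x| <= C * `|g_ j x|) -> 0 <= C ->
  (forall e : R, 0 < e -> \forall j \near \oo, (L1norm (g_ j) <= e%:E)%E) ->
  forall e : R, 0 < e -> \forall j \near \oo, (L1norm (f_ j) <= e%:E)%E.
Proof.
move=> mf ig fg C0 H e e0; have C1 : 0 < C + 1 by rewrite ltr_wpDl.
have := H (e / (C + 1)) (divr_gt0 e0 C1); apply: filterS => j Hj.
apply: (@le_trans _ _ (L1norm (fun x => C * g_ j x)%R)).
  apply: ge0_le_integral => //.
  - by apply/measurable_EFinP; apply: measurableT_comp.
  - by apply: measurable_norm_EFin; exact: IntZ.
  - by move=> x _; rewrite lee_fin normrM (ger0_norm C0).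
rewrite L1normZ// (ger0_norm C0).
apply: (@le_trans _ _ (C%:E * (e / (C + 1))%:E)%E); first by apply: lee_wpmul2l.
rewrite -EFinM lee_fin mulrCA ler_piMr ?(ltW e0)//.
by rewrite ler_pdivrMr// mul1r lerDl.
Qed.

Lemma near_L1normD (f_ g_ : nat -> V -> R) :
  (forall j, Int (f_ j)) -> (forall j, Int (g_ j)) ->
  (forall e : R, 0 < e -> \forall j \near \oo, (L1norm (f_ j) <= e%:E)%E) ->
  (forall e : R, 0 < e -> \forall j \near \oo, (L1norm (g_ j) <= e%:E)%E) ->
  forall e : R, 0 < e -> \forall j \near \oo, (L1norm (fun x => f_ j x + g_ j x)%R <= e%:E)%E.
Proof.
move=> if_ ig Hf Hg e e0; have e2 : 0 < e / 2 by rewrite divr_gt0.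
near=> j; apply: le_trans (L1normD (if_ j) (ig j)) _.
by rewrite (splitr e) EFinD; apply: leeD; near: j; [exact: Hf|exact: Hg].
Unshelve. all: by end_near. Qed.

Lemma partial2_reflect (a : V) (f : V -> R) i : smooth f ->
  partial i (partial i (fun x => f (a - x))) = (fun x => partial i (partial i f) (a - x)).
Proof.
move=> sf; rewrite partial_reflect//; apply: partialE => x.
rewrite -[X in is_derive _ _ _ X]opprK; apply: is_deriveN; apply: is_derive_reflect.
by apply: smooth_is_derive; exact: smooth_partial.
Qed.

(* The mollifier translated to x is an admissible test function. *)
Lemma mollify_supersolution (k : nat) (c u q : V -> R) (g : 'I_n -> V -> R) (x : V) (r : R) :
  H1_gradient B u g ->
  (forall f, test_function B f -> (forall x, 0 <= f x) ->
    0 <= \int[leb]_(x in B) (\sum_(i < n) g i x * partial i f x) +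
         \int[leb]_(x in B) (c x * u x * f x)) ->
  sqnorm x <= r -> r + 3 * n%:R * k.+1%:R^-1 < 1 ->
  (forall y, sqnorm y <= r + 3 * n%:R * k.+1%:R^-1 -> q y = (c \_ B) y * (u \_ B) y) ->
  \sum_i partial i (partial i (mollify k (u \_ B))) x <= mollify k q x.
Proof.
move=> [/Lp_on_L2 LU Hg] sup xr rk qE.
have iU : Int (u \_ B) by apply: L2_ball_Int => // y; exact: patch_out.
have tf := test_function_mollifier xr rk.
set f := fun y => mollifier k (x - y) in tf.
have sm : smooth (@mollifier R n k) by case: (@Ccinfty_mollifier R n k).
have cm := @Ccinfty_mollifier R n k.
have LG i : L2 leb (g i \_ B) by apply: Lp_on_L2; case: (Hg i).
have H := sup f tf (fun y => mollifier_ge0 _ _).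
(* Second derivatives of the kernel in [y] and in [x] agree, the two signs of the reflection
   cancelling; the remaining minus sign is that of the weak derivative. *)
have E1 : \int[leb]_(y in B) (\sum_(i < n) g i y * partial i f y) =
    - \sum_i partial i (partial i (mollify k (u \_ B))) x.
  rewrite Rintegral_mkcond (_ : _ \_ B = fun y => \sum_(i < n) ((g i \_ B) y * partial i f y)); last first.
    apply/funext => y; rewrite patchE; case: ifPn => yB.
      by apply: eq_bigr => i _; rewrite patchE yB.
    by rewrite big1// => i _; rewrite patchE (negbTE yB) mul0r.
  have iGf i : Int (fun y => (g i \_ B) y * partial i f y).
    apply: L2_mul => //; apply: Ccinfty_L2; apply: Ccinfty_partial.
    exact: Ccinfty_test tf.
  rewrite (Rintegral_sum _ iGf).
  rewrite -sumrN; apply: eq_bigr => i _.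
  have [_ wp] := Hg i.
  rewrite -[LHS]opprK -(weak_partialE wp (test_function_partial i tf)); congr (- _).
  rewrite partial2_reflect// mollifyE.
  by rewrite !partial_translate_integral//; try exact: measurable_rV_opp; exact: Ccinfty_partial.
(* The kernel vanishes wherever [q] may differ from [c u]. *)
have E2 : \int[leb]_(y in B) (c y * u y * f y) = mollify k q x.
  rewrite Rintegral_mkcond; apply: eq_Rintegral => y _.
  have [fy|/mollifier_support xy] := eqVneq (f y) 0.
    by rewrite /patch -/(f y) fy !mulr0; case: ifP.
  rewrite -/(f y) qE; last first.
    rewrite -[y](subKr x); apply: le_trans (sqnorm_perturb _ _ xy) _.
    - by rewrite invf_le1// ler1n.
    - by apply: (le_trans xr); rewrite (le_trans _ (ltW rk))// lerDl !mulr_ge0.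
    - by rewrite lerD2r.
  by rewrite !patchE; case: ifP => // _; rewrite !mul0r.
by move: H; rewrite E1 E2 addrC subr_ge0.
Qed.

End kato.

(** * Kato's inequality for the negative part *)

Section kato_inequality.
Context {R : realType} {n : nat}.
Local Notation V := 'rV[R]_n.
Local Notation leb := (@lebesgue_rV R n).
Local Notation B := (@unit_ball R n).
Local Notation Int U := (leb.-integrable setT (EFin \o U)).

Lemma test_function_cutoff (s : R) : 0 < s < 1 -> test_function B (cutoff (Num.sqrt s)).
Proof.
move=> /andP[s0 s1]; apply/test_functionP; split.
  by apply: Ccinfty_cutoff; rewrite sqrtr_gt0.
apply: (@subset_trans _ [set y : V | sqnorm y <= s]).
  apply: closure_subset_closed; first exact: closed_sqnorm_le.
  by move=> y /=; rewrite cutoff_neq0 -expr2 sqr_sqrtr ?(ltW s0)// => /ltW.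
by rewrite unit_ballE => y /= ys; exact: le_lt_trans s1.
Qed.

(** Dividing by [b] turns the integrability of [c u f] for test functions [f] into the integrability
    of [c u] on a smaller ball. *)
Lemma cutoff_lower_bound (s t : R) : 0 < t < s ->
  exists2 b : R, 0 < b & forall y : V, sqnorm y <= t -> b <= cutoff (Num.sqrt s) y.
Proof.
move=> /andP[t0 ts]; have s0 := lt_trans t0 ts.
have st : 0 < s - t by rewrite subr_gt0.
exists (flat_exp 0 (s - t)).
  by rewrite /flat_exp st expr0 mul1r expR_gt0.
move=> y yt; rewrite /cutoff -expr2 sqr_sqrtr ?(ltW s0)// mulN1r /flat_exp st.
have sy : 0 < s - sqnorm y by rewrite subr_gt0 (le_lt_trans yt).
rewrite sy !expr0 !mul1r ler_expR lerN2 lef_pV2//.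
by rewrite lerD2l lerN2.
Qed.

Lemma measurable_sqnorm_le (s : R) : measurable [set x : V | sqnorm x <= s].
Proof.
rewrite -[X in measurable X]setCK; apply: measurableC; apply: open_measurable_rV.
by apply: closed_openC; exact: closed_sqnorm_le.
Qed.

Lemma near_subseq (P : nat -> Prop) (phi : nat -> nat) : (forall j, (j <= phi j)%N) ->
  (\forall k \near \oo, P k) -> \forall j \near \oo, P (phi j).
Proof.
move=> phiE [K _ HK]; exists K => // j /= Kj; apply: HK => /=.
exact: leq_trans Kj (phiE j).
Qed.

Lemma cvg_sum_index (I : finType) (a_ : nat -> I -> R) (a : I -> R) :
  (forall i, a_ j i @[j --> \oo] --> a i) ->
  \sum_i a_ j i @[j --> \oo] --> \sum_i a i.
Proof.
move=> H; elim: (index_enum _) => [|i s IH].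
  by rewrite big_nil; under eq_fun do rewrite big_nil; exact: cvg_cst.
by rewrite big_cons; under eq_fun do rewrite big_cons; exact: cvgD.
Qed.

(** The pointwise limit of [sneg e] along [U] as [e] tends to 0, in the same algebraic form. *)
Definition neg_part (U : V -> R) (x : V) : R := 2^-1 * (`|U x| - U x).

(* Only the convergence of the mollified u and c u in L^1 is used: the limit of
   the derivative of sneg is discontinuous at 0, where the factor c u vanishes. *)
Lemma kato_negative_part (c u : V -> R) (g : 'I_n -> V -> R) (z : V -> R) :
  H1_gradient B u g ->
  (forall f, test_function B f -> (forall x, 0 <= f x) ->
    0 <= \int[leb]_(x in B) (\sum_(i < n) g i x * partial i f x) +
         \int[leb]_(x in B) (c x * u x * f x)) ->
  measurable_fun setT (c \_ B) ->
  (forall f, test_function B f -> Int (fun x => (c \_ B) x * (u \_ B) x * f x)) ->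
  test_function B z -> (forall x, 0 <= z x) ->
  \int[leb]_x (z x * ((c \_ B) x * neg_part (u \_ B) x)) <=
  \sum_i \int[leb]_x (neg_part (u \_ B) x * partial i (partial i z) x).
Proof.
move=> Hu sup mC hloc tz z0; set C := c \_ B in mC hloc *; set U := u \_ B in hloc *.
set W := neg_part U.
have LU : L2 leb U by apply: Lp_on_L2; case: Hu.
have mU : measurable_fun setT U by case: LU.
have iU : Int U by apply: L2_ball_Int => // y; exact: patch_out.
have mW : measurable_fun setT W.
  by apply: measurable_funM => //; apply: measurable_funB => //; exact: measurableT_comp.
have WU x : `|W x| <= `|U x|.
  rewrite /W /neg_part normrM gtr0_norm// (le_trans (ler_wpM2l _ (ler_normB _ _)))//.
  by rewrite normr_id; lra.
have iW : Int W.
  apply: (@le_integrable _ _ _ leb _ measurableT _ (EFin \o U)) => //.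
  - exact/measurable_EFinP.
  - by move=> x _; rewrite /= lee_fin WU.
have cz := Ccinfty_test tz.
have [r /andP[r0 r1] zr] := test_function_margin tz.
have mz : measurable_fun setT z by apply: smooth_measurable; case: cz.
have [M M0 zM] := Ccinfty_bounded cz.
(* Squared radii with r < s < t < 1: [z] is supported within [r], fine mollifiers centred there stay
   within [s], and a cutoff living within [t] is bounded below on [s]. *)
pose s := (1 + r) / 2; pose t := (1 + s) / 2.
have rs : r < s by rewrite /s; lra.
have s1 : s < 1 by rewrite /s; lra.
have st : s < t by rewrite /t; lra.
have t1 : t < 1 by rewrite /t; lra.
have s0 : 0 < s by exact: lt_trans rs.
have t0 : 0 < t by exact: lt_trans st.
pose K := [set x : V | sqnorm x <= s].
have mK : measurable K by exact: measurable_sqnorm_le.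
(* [c u] is only locally integrable; restricted to [K] it can be mollified on R^n, and nothing
   changes for mollifications evaluated on the support of [z]. *)
pose q x := C x * U x * \1_K x.
have [b b0 bK] := cutoff_lower_bound (introT andP (conj s0 st)).
have tb : test_function B (cutoff (Num.sqrt t)) by apply: test_function_cutoff; rewrite t0 t1.
have mq : measurable_fun setT q.
  by apply: measurable_funM; [exact: measurable_funM|exact: measurable_indic].
have iq : Int q.
  have iCUb := IntZ b^-1 (hloc _ tb).
  apply: (@le_integrable _ _ _ leb _ measurableT _ _ _ _ iCUb); first exact/measurable_EFinP.
  move=> x _; rewrite /= lee_fin /q indicE.
  have [/set_mem xK|_] := boolP (x \in K); last by rewrite mulr0 normr0.
  rewrite mulr1 [X in _ <= X]normrM [X in _ <= _ * X]normrM mulrCA.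
  rewrite ler_peMr// gtr0_norm ?invr_gt0// mulrC ler_pdivlMr// mul1r.
  by rewrite (le_trans (bK x xK))// ler_norm.
have [_ cU] := mollify_cvg_integrable iU.
have [_ cq] := mollify_cvg_integrable iq.
have [phi [phiE aeU]] := L1_cvg_ae_subseq (fun k => measurable_mollify k iU) mU cU.
pose v j := mollify (phi j) U; pose Q j := mollify (phi j) q.
have sv j : smooth (v j) by exact: smooth_mollify.
have iv j : Int (v j) by exact: integrable_mollify.
have iQ j : Int (Q j) by exact: integrable_mollify.
have vU e : 0 < e -> \forall j \near \oo, (L1norm (fun x => v j x - U x)%R <= e%:E)%E.
  by move=> e0; exact: (near_subseq phiE (cU e e0)).
have Qq e : 0 < e -> \forall j \near \oo, (L1norm (fun x => Q j x - q x)%R <= e%:E)%E.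
  by move=> e0; exact: (near_subseq phiE (cq e e0)).
pose e_ (j : nat) : R := j.+1%:R^-1.
have e0 j : 0 < e_ j by rewrite invr_gt0.
have ce : e_ j @[j --> \oo] --> (0 : R) by exact: cvg_harmonic.
pose a_ j := \sum_i \int[leb]_x (sneg (e_ j) (v j x) * partial i (partial i z) x).
pose b_ j := \int[leb]_x (z x * (derive1 (sneg (e_ j)) (v j x) * Q j x)).
have ba : \forall j \near \oo, b_ j <= a_ j.
  have := near_subseq phiE (@near_margin R n r s rs); apply: filterS => j rj.
  apply: kato_smooth => // x zx.
  have xr : sqnorm x <= r by apply: zr; exact: subset_closure.
  apply: (mollify_supersolution Hu sup xr (lt_trans rj s1)) => y yr.
  by rewrite /q indicE mem_set ?mulr1//; exact: le_trans yr (ltW rj).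
have ca : a_ j @[j --> \oo] --> \sum_i \int[leb]_x (W x * partial i (partial i z) x).
  apply: cvg_sum_index => i.
  have [M2 M20 z2M] := Ccinfty_bounded (Ccinfty_partial i (Ccinfty_partial i cz)).
  have cz2 := Ccinfty_partial i (Ccinfty_partial i cz).
  set z2 := partial i (partial i z) in z2M cz2 *.
  have iz2 : Int z2 by exact: Ccinfty_integrable.
  have mz2 : measurable_fun setT z2 by apply: smooth_measurable; case: cz2.
  have ssv j : smooth (fun x => sneg (e_ j) (v j x)).
    exact: smooth_comp (smooth1_sneg (e0 j)) (sv j).
  have if_ j : Int (fun x => sneg (e_ j) (v j x) * z2 x).
    by under eq_fun do rewrite mulrC; exact: Ccinfty_integrable (CcinftyMl cz2 (ssv j)).
  have iWz : Int (fun x => W x * z2 x).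
    by under eq_fun do rewrite mulrC; exact: (bounded_mul_Int mz2 z2M iW).
  apply: cvg_Rintegral_L1 => //.
  have iG1 j : Int (fun x => e_ j * `|z2 x|) by apply: IntZ; exact: integrable_norm.
  have iG2 j : Int (fun x => M2 * `|v j x - U x|).
    by apply: IntZ; apply: integrable_norm => //; exact: IntB.
  have mf_ j : measurable_fun setT (fun x => sneg (e_ j) (v j x) * z2 x - W x * z2 x).
    by have /integrableP[/measurable_EFinP] := IntB (if_ j) iWz.
  apply: (near_L1norm_le (C := 1) mf_ (fun j => IntD (iG1 j) (iG2 j))) => //.
    move=> j x; rewrite mul1r [leRHS]ger0_norm; last first.
      by rewrite addr_ge0// mulr_ge0// ltW.
    rewrite -mulrBl normrM.
    apply: (@le_trans _ _ ((e_ j + `|v j x - U x|) * `|z2 x|)).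
      by apply: ler_wpM2r => //; exact: sneg_approx.
    rewrite mulrDl lerD2l mulrC; apply: ler_wpM2r => //; exact: z2M.
  apply: near_L1normD => //; last first.
    apply: (near_L1norm_le (C := M2) (g_ := fun j x => v j x - U x)) => //.
    - by move=> j; have /integrableP[/measurable_EFinP] := iG2 j.
    - by move=> j; exact: IntB.
    - by move=> j x; rewrite normrM (ger0_norm M20) normr_id.
  move=> e e_gt0.
  pose A := \int[leb]_x `|z2 x|.
  have A0 : 0 <= A by exact: Rintegral_ge0.
  have AE : L1norm (fun x => `|z2 x|) = A%:E.
    rewrite /A /L1norm /Rintegral fineK; first by apply: eq_integral => x _; rewrite normr_id.
    by apply: integrable_fin_num => //; exact: integrable_norm.
  have eA : 0 < e / (A + 1) by rewrite divr_gt0// ltr_wpDl.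
  near=> j; rewrite L1normZ; last exact: integrable_norm.
  rewrite AE -EFinM lee_fin (gtr0_norm (e0 j)).
  have ej : e_ j < e / (A + 1).
    by near: j; exact: (near_infty_natSinv_lt (PosNum eA)).
  apply: (@le_trans _ _ (e / (A + 1) * A)); first by apply: ler_wpM2r => //; exact: ltW.
  by rewrite -mulrA ler_piMr ?(ltW e_gt0)// mulrC ler_pdivrMr ?ltr_wpDl// mul1r lerDl.
have cb : b_ j @[j --> \oo] --> \int[leb]_x (z x * (C x * W x)).
  have mdh j : measurable_fun setT (fun x => derive1 (sneg (e_ j)) (v j x)).
    exact: smooth_measurable (smooth_comp (smooth1_derive (smooth1_sneg (e0 j))) (sv j)).
  have dh1 j x : `|derive1 (sneg (e_ j)) (v j x)| <= 1 by exact: derive1_sneg_norm.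
  have iP j p : Int p -> Int (fun x => z x * (derive1 (sneg (e_ j)) (v j x) * p x)).
    by move=> ip; apply: (bounded_mul_Int mz zM); exact: (bounded_mul_Int (mdh j) (dh1 j)).
  have zK x : z x != 0 -> K x.
    move=> zx; have xr : sqnorm x <= r by apply: zr; exact: subset_closure.
    exact: le_trans xr (ltW rs).
  have mCW : measurable_fun setT (fun x => z x * (C x * W x)).
    by apply: measurable_funM => //; exact: measurable_funM.
  have iCW : Int (fun x => z x * (C x * W x)).
    apply: (@le_integrable _ _ _ leb _ measurableT _ (EFin \o (fun x => M * q x))).
    - exact/measurable_EFinP.
    - move=> x _; rewrite /= lee_fin.
      have [->|zx] := eqVneq (z x) 0; first by rewrite mul0r normr0.
      rewrite /q indicE mem_set ?mulr1; last exact: zK.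
      rewrite normrM [X in _ <= X]normrM (ger0_norm M0); apply: ler_pM (zM x) _ => //.
      rewrite normrM [X in _ <= X]normrM.
      by apply: ler_wpM2l; [exact: normr_ge0|exact: WU].
    - exact: IntZ.
  apply: cvg_Rintegral_L1 => //; first by move=> j; exact: iP.
  (* The first part is a bounded factor times [Q j - q], which tends to 0 in L^1; the second has the
     fixed [q], so dominated convergence applies, [v j] converging almost everywhere. *)
  have E j : (fun x => z x * (derive1 (sneg (e_ j)) (v j x) * Q j x) - z x * (C x * W x)) =
    (fun x => z x * (derive1 (sneg (e_ j)) (v j x) * (Q j x - q x)) +
       (z x * (derive1 (sneg (e_ j)) (v j x) * q x) - z x * (C x * W x))).
    by apply/funext => x; ring.
  have iQq j : Int (fun x => Q j x - q x) by exact: IntB.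
  suff S (e : R) : 0 < e -> \forall j \near \oo, (L1norm (fun x =>
      (z x * (derive1 (sneg (e_ j)) (v j x) * (Q j x - q x)) +
       (z x * (derive1 (sneg (e_ j)) (v j x) * q x) - z x * (C x * W x)))%R) <= e%:E)%E.
    by move=> e e_gt0; have := S e e_gt0; apply: filterS => j; rewrite E.
  move: e.
  apply: near_L1normD => [j|j||].
  - exact: iP.
  - by apply: IntB => //; exact: iP.
  - apply: (near_L1norm_le (C := M) _ iQq) => //.
      by move=> j; have /integrableP[/measurable_EFinP] := iP j _ (iQq j).
    move=> j x; rewrite !normrM ler_pM ?mulr_ge0//.
    by rewrite ler_piMl.
  - move=> e e_gt0; apply: (dominated_L1 (f_ := fun j x => z x * (derive1 (sneg (e_ j)) (v j x) * q x))
      (g := fun x => M * `|q x|) _ _ _ _ _ e_gt0) => //.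
    + by move=> j; have /integrableP[/measurable_EFinP] := iP j _ iq.
    + apply: filterS aeU => x cx.
      have [->|zx] := eqVneq (z x) 0.
        by under eq_fun do rewrite mul0r; rewrite mul0r; exact: cvg_cst.
      have qx : q x = C x * U x by rewrite /q indicE mem_set ?mulr1//; exact: zK.
      rewrite qx; have [Ux|Ux] := eqVneq (U x) 0.
        rewrite /W /neg_part Ux normr0 subrr !mulr0.
        by under eq_fun do rewrite !mulr0; exact: cvg_cst.
      have -> : z x * (C x * W x) = z x * (2^-1 * (Num.sg (U x) - 1) * (C x * U x)).
        by rewrite /W /neg_part normrEsg; ring.
      apply: cvgM; first exact: cvg_cst.
      apply: cvgM; last exact: cvg_cst.
      exact: cvg_derive1_sneg.
    + by apply: IntZ; exact: integrable_norm.
    + move=> j x; rewrite !normrM ler_pM ?mulr_ge0//.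
      by rewrite ler_piMl.
exact: ler_cvg_to cb ca ba.
Unshelve. all: by end_near. Qed.

End kato_inequality.

(** * The energy estimate *)

Section coefficient.
Context {R : realType}.
Local Notation leb := (@lebesgue_rV R).
Local Notation Int U := ((leb _).-integrable setT (EFin \o U)).

(** The conjugate of n/2 is half the Sobolev exponent, so a coefficient in L^(n/2) pairs exactly
    with a product of two functions in L^q. *)
Lemma conjugate_exponents m (p p' : R) : p = m.+3%:R / 2 -> p' = m.+3%:R / m.+1%:R ->
  [/\ 1 <= p, 1 <= p' & p^-1 + p'^-1 = 1].
Proof.
move=> -> ->; split.
- by rewrite ler_pdivlMr// mul1r ler_nat.
- by rewrite ler_pdivlMr// mul1r ler_nat (leq_trans (leqnSn _)).
- rewrite !invf_div -mulrDl -natrD add2n mulfV// pnatr_eq0//.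
Qed.

(** Young's inequality on the ball: |c| |f u| <= |c|^p + |f u|^p', and |f u|^p' <= 1 + |f u|^q
    because q = 2 p'. Each term is integrable, the last by [local_Lq]. *)
Lemma supersolution_Int m (p : R) (c u f : 'rV[R]_m.+3 -> R) (g : 'I_m.+3 -> 'rV[R]_m.+3 -> R) :
  p = m.+3%:R / 2 -> Lp_on unit_ball p c -> H1_gradient unit_ball u g ->
  test_function unit_ball f ->
  Int (fun x => (c \_ unit_ball) x * (u \_ unit_ball) x * f x).
Proof.
move=> pE Lc Hu tf; set B := unit_ball in Lc Hu tf *; set C := c \_ B; set U := u \_ B.
pose p' : R := m.+3%:R / m.+1%:R.
have [p1 p'1 pp'] := conjugate_exponents pE (erefl p').
have p0 : 0 < p by exact: lt_le_trans p1.
have p'0 : 0 < p' by exact: lt_le_trans p'1.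
have [mC Cy] := Lp_onP p0 Lc.
have [LU _] := Hu; have [mU _] := Lp_on_L2 LU.
have Fy := local_Lq erefl Hu tf; rewrite -/B -/U in Fy.
have cf := Ccinfty_test tf.
have mf : measurable_fun setT f by apply: smooth_measurable; case: cf.
set q : R := 2 * m.+3%:R / m.+1%:R in Fy.
have mCp : measurable_fun setT (fun x => (`|C x| `^ p)%:E).
  by apply/measurable_EFinP; apply: measurable_fun_powR; exact: measurableT_comp.
have mFq : measurable_fun setT (fun x => (`|f x * U x| `^ q)%:E).
  apply/measurable_EFinP; apply: measurable_fun_powR; apply: measurableT_comp => //.
  exact: measurable_funM.
have mB : measurable_fun setT (fun x => (\1_B x : R)%:E).
  by apply/measurable_EFinP; apply: measurable_indic; exact: measurable_unit_ball.
apply/integrableP; split.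
  by apply/measurable_EFinP; apply: measurable_funM => //; exact: measurable_funM.
apply: (@le_lt_trans _ _ (\int[leb _]_x ((`|C x| `^ p)%:E + ((\1_B x : R)%:E + (`|f x * U x| `^ q)%:E)))%E).
  apply: ge0_le_integral => //.
  - apply: measurableT_comp => //; apply/measurable_EFinP.
    by apply: measurable_funM => //; exact: measurable_funM.
  - by apply: emeasurable_funD => //; exact: emeasurable_funD.
  - move=> x _; rewrite -!EFinD lee_fin.
    have [xB|xB] := boolP (x \in B); last first.
      by rewrite /C /U !patchE (negbTE xB) !mul0r normr0 !addr_ge0// powR_ge0.
    rewrite indicE xB -mulrA [U x * _]mulrC normrM.
    have := conjugate_powR (normr_ge0 (C x)) (normr_ge0 (f x * U x)) p0 p'0 pp'.
    move/le_trans; apply; apply: lerD.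
      by rewrite ler_pdivrMr// ler_peMr ?powR_ge0.
    apply: (@le_trans _ _ (`|f x * U x| `^ p')); first by rewrite ler_pdivrMr// ler_peMr ?powR_ge0.
    rewrite (_ : q = p' * 2%:R); last by rewrite /q /p'; ring.
    rewrite powRrM powR_mulrn ?powR_ge0// mulr1n; set t := _ `^ p'.
    by have := sqr_ge0 (t - 2^-1); rewrite !expr2; nra.
rewrite ge0_integralD//; last 2 first.
- by move=> x _; rewrite -EFinD lee_fin addr_ge0// powR_ge0.
- exact: emeasurable_funD.
have By : (\int[leb m.+3]_x (\1_B x)%:E < +oo)%E.
  rewrite integral_indic//; last exact: measurable_unit_ball.
  by rewrite setIT; exact: unit_ball_fin.
apply: lte_add_pinfty; first exact: Cy.
by rewrite ge0_integralD//; apply: lte_add_pinfty; [exact: By|exact: Fy].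
Qed.

End coefficient.

Section negative_part.
Context {R : realType} {n : nat}.
Local Notation V := 'rV[R]_n.
Local Notation leb := (@lebesgue_rV R n).
Local Notation B := (@unit_ball R n).

Lemma funrneg_patch (D : set V) (u : V -> R) : (u^\-)%R \_ D = neg_part (u \_ D).
Proof.
apply/funext => x; rewrite /neg_part !patchE; case: ifP => _; last by rewrite normr0 subrr mulr0.
rewrite /funrneg; have [u0|u0] := leP 0 (u x).
  by rewrite ger0_norm// subrr mulr0 max_r// oppr_le0.
by rewrite ltr0_norm// max_l ?oppr_ge0 ?ltW//; field.
Qed.

Lemma neg_part_ge0 (U : V -> R) x : 0 <= neg_part U x.
Proof. by rewrite /neg_part mulr_ge0// subr_ge0 ler_norm. Qed.

Lemma measurable_neg_part (U : V -> R) :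
  measurable_fun setT U -> measurable_fun setT (neg_part U).
Proof.
move=> mU; apply: measurable_funM => //; apply: measurable_funB => //.
exact: measurableT_comp.
Qed.

Lemma neg_part_norm (U : V -> R) x : `|neg_part U x| <= `|U x|.
Proof.
rewrite ger0_norm ?neg_part_ge0// /neg_part.
by have := ler_norm (- U x); rewrite normrN => ?; lra.
Qed.

Lemma H1_norm_lt (D : set V) (v : V -> R) (h : 'I_n -> V -> R) (e : R) :
  (H1_norm D v h < e%:E)%E ->
  (\int[leb]_x ((v \_ D) x ^+ 2)%:E <= (e ^+ 2)%:E)%E /\
  forall i, (\int[leb]_x ((h i \_ D) x ^+ 2)%:E <= (e ^+ 2)%:E)%E.
Proof.
have LE w : (Lnorm_on D 2 w `^ 2 = \int[leb]_x ((w \_ D) x ^+ 2)%:E)%E.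
  rewrite poweR_Lnorm//; apply: eq_integral => x _.
  by rewrite poweR_EFin powR_mulrn// real_normK ?num_real.
have L0 w : (0 <= Lnorm_on D 2 w `^ 2)%E by exact: poweR_ge0.
rewrite /H1_norm => He.
have e0 : 0 <= e by rewrite -lee_fin (le_trans _ (ltW He))// poweR_ge0.
have S0 : (0 <= \sum_(i < n) Lnorm_on D 2 (h i) `^ 2)%E by apply: sume_ge0.
have : (Lnorm_on D 2 v `^ 2 + \sum_(i < n) Lnorm_on D 2 (h i) `^ 2 <= (e ^+ 2)%:E)%E.
  set X := (_ + _)%E in He *; have X0 : (0 <= X)%E by rewrite adde_ge0.
  have <- : ((X `^ 2^-1) `^ 2 = X)%E by rewrite -poweRrM mulVf// poweRe1.
  apply: le_trans (le_poweR _ _ (ltW He)) _ => //; first exact: poweR_ge0.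
  by rewrite poweR_EFin powR_mulrn.
move=> H; split; first by rewrite -LE; apply: le_trans H; rewrite leeDl.
move=> i; rewrite -LE; apply: le_trans H; rewrite (bigD1 i)//= addeCA leeDl// adde_ge0//.
by apply: sume_ge0.
Qed.

Lemma patch_test_functionB (v f : V -> R) : test_function B f ->
  (v \- f)%R \_ B = (fun x => (v \_ B) x - f x).
Proof.
move=> tf; apply/funext => x; rewrite !patchE; case: ifPn => [//|xB].
by rewrite (test_function_out tf) ?subr0// => Bx; rewrite mem_set in xB.
Qed.

(** Subtracting [e] restores the value 0 wherever [f] vanishes, so the support does not grow. *)
Lemma test_function_sabs (e : R) (f : V -> R) : 0 < e -> test_function B f ->
  test_function B (fun x => sabs e (f x) + - e).
Proof.
move=> e0 /test_functionP[[sf [M fM]] fB]; apply/test_functionP.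
have s0 x : sabs e (f x) + - e != 0 -> f x != 0.
  apply: contra_neq => ->; rewrite sabsE expr0n add0r sqrtr_sqr gtr0_norm// subrr//.
split; last first.
  by apply: subset_trans fB; apply: closure_subset => x; exact: s0.
split; last by exists M => x zx; apply: fM; exact: s0.
apply: (@smooth_comp _ _ (fun t => sabs e t + - e)) => //.
apply: (@smooth1_power_algebra _ (e ^+ 2)); first exact: exprn_gt0.
by apply: power_algebraD; [exact: power_algebra_powR|exact: power_algebra_cst].
Qed.

End negative_part.

(** * Sobolev bounds for limits and the triple Hoelder inequality *)

Section sobolev_limit.
Context {R : realType}.
Local Notation leb := (@lebesgue_rV R).

Lemma sobolev_power m (q g D : R) (f : 'rV[R]_m.+3 -> R) :
  q = 2 * m.+3%:R / m.+1%:R -> g = 2 * m.+2%:R / m.+1%:R -> Ccinfty f ->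
  (forall i, \int[leb m.+3]_x (partial i f x ^+ 2)%:E <= D%:E)%E ->
  (\int[leb m.+3]_x (`|f x| `^ q)%:E <= ((g * D `^ 2^-1) `^ q)%:E)%E.
Proof.
move=> qE gE cf fD; have [_ q0 _ _ _] := sobolev_exponents qE gE.
have I0 : (0 <= \int[leb m.+3]_x (`|f x| `^ q)%:E)%E.
  by apply: integral_ge0 => x _; rewrite lee_fin powR_ge0.
have -> : (\int[leb m.+3]_x (`|f x| `^ q)%:E)%E =
    ((\int[leb m.+3]_x (`|f x| `^ q)%:E) `^ q^-1 `^ q)%E.
  by rewrite -poweRrM mulVf ?gt_eqF// poweRe1.
rewrite -poweR_EFin; apply: le_poweR; rewrite ?(ltW q0)// ?poweR_ge0//.
by apply: le_trans (sobolev qE gE cf fD) _; rewrite poweR_EFin -EFinM.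
Qed.

(** The squares of [W - f_ j] tend to 0 in L^1, so a subsequence converges almost everywhere, and
    Fatou's lemma carries the bound over to [W]. *)
Lemma sobolev_limit m (q g D : R) (f_ : nat -> 'rV[R]_m.+3 -> R) (W : 'rV[R]_m.+3 -> R) :
  q = 2 * m.+3%:R / m.+1%:R -> g = 2 * m.+2%:R / m.+1%:R ->
  (forall j, Ccinfty (f_ j)) -> measurable_fun setT W ->
  (forall e : R, 0 < e -> \forall j \near \oo, (\int[leb _]_x ((W x - f_ j x) ^+ 2)%:E <= e%:E)%E) ->
  (\forall j \near \oo, forall i, (\int[leb m.+3]_x (partial i (f_ j) x ^+ 2)%:E <= D%:E)%E) ->
  (\int[leb m.+3]_x (`|W x| `^ q)%:E <= ((g * D `^ 2^-1) `^ q)%:E)%E.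
Proof.
move=> qE gE cf mW cfW fD; have [g1 q0 gq _ _] := sobolev_exponents qE gE.
have q1 : 1 < q.
  by rewrite qE ltr_pdivlMr// mul1r -natrM ltr_nat mulSn (leq_trans _ (leq_addr _ _)).
have mf j : measurable_fun setT (f_ j) by apply: smooth_measurable; case: (cf j).
have mWf j : measurable_fun setT (fun x => (W x - f_ j x) ^+ 2).
  by apply: measurable_funX; exact: measurable_funB.
have [phi [phiE cphi]] : exists phi : nat -> nat, (forall j, (j <= phi j)%N) /\
    {ae leb m.+3, forall x, (W x - f_ (phi j) x) ^+ 2 @[j --> \oo] --> (0 : R)}.
  apply: (@L1_cvg_ae_subseq _ _ _ _ (fun j x => (W x - f_ j x) ^+ 2) (fun=> 0)) => //.
  move=> e e0; have := cfW e e0; apply: filterS => j; congr (_ <= _)%E.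
  by apply: eq_integral => x _; rewrite subr0 ger0_norm// sqr_ge0.
apply: (fatou_bound (f_ := fun j x => `|f_ (phi j) x| `^ q)).
- by move=> j; apply: measurable_fun_powR; exact: measurableT_comp.
- by apply: measurable_fun_powR; exact: measurableT_comp.
- by move=> j x; exact: powR_ge0.
- apply: filterS cphi => x cx; apply: cvg_norm_powR => //.
  apply/cvgrPdist_lt => e e0; have e2 : 0 < e ^+ 2 by rewrite exprn_gt0.
  move/cvgrPdist_lt : cx => /(_ _ e2); apply: filterS => j.
  rewrite sub0r normrN normrX => H.
  by rewrite -(ltr_pXn2r (n := 2))// nnegrE ltW.
- have := near_subseq phiE fD; apply: filterS => j Hj.
  exact: (sobolev_power qE gE).
Qed.

(** Here 1/p + 1/q + 1/q = 1. Cauchy-Schwarz first bounds [W z] in L^p' with p' = q/2, then Hoelder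
    with p and p' brings in [C]. *)
Lemma hoelder_triple m (p q k S : R) (C W z : 'rV[R]_m.+3 -> R) :
  p = m.+3%:R / 2 -> q = 2 * m.+3%:R / m.+1%:R -> 0 <= S ->
  measurable_fun setT C -> measurable_fun setT W -> measurable_fun setT z ->
  ((\int[leb _]_x (`|C x| `^ p)%:E) `^ p^-1 <= k%:E)%E ->
  (\int[leb _]_x (`|W x| `^ q)%:E <= (S `^ q)%:E)%E ->
  (\int[leb _]_x (`|z x| `^ q)%:E <= (S `^ q)%:E)%E ->
  (\int[leb _]_x `|z x * (C x * W x)|%:E <= (k * S ^+ 2)%:E)%E.
Proof.
move=> pE qE S0 mC mW mz kC SW Sz; pose p' : R := m.+3%:R / m.+1%:R.
have [p1 p'1 pp'] := conjugate_exponents pE (erefl p').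
have p0 : 0 < p by exact: lt_le_trans p1.
have p'0 : 0 < p' by exact: lt_le_trans p'1.
have qp' : p' = q * 2^-1 by rewrite qE /p'; field.
have mpow a (f : 'rV[R]_m.+3 -> R) : measurable_fun setT f ->
    measurable_fun setT (fun x => (`|f x| `^ a)%:E).
  move=> mf; apply/measurable_EFinP; apply: measurable_fun_powR.
  exact: measurableT_comp.
have mWz : measurable_fun setT (fun x => W x * z x) by exact: measurable_funM.
have SWz : (\int[leb m.+3]_x (`|W x * z x| `^ p')%:E <= (S `^ q)%:E)%E.
  have E x : (`|W x * z x| `^ p')%:E = ((`|W x| `^ q)%:E `^ 2^-1 * (`|z x| `^ q)%:E `^ 2^-1)%E.
    by rewrite !poweR_EFin -EFinM -!powRrM -qp' -powRM// normrM.
  under eq_integral do rewrite E.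
  apply: le_trans (@ge0_hoelder _ _ _ (leb m.+3) (fun x => (`|W x| `^ q)%:E) (fun x => (`|z x| `^ q)%:E)
    2^-1 2^-1 _ _ _ _ _ _ _) _ => //; try exact: mpow.
  - by rewrite [RHS](splitr 1) !mul1r.
  have I0 f : (0 <= \int[leb m.+3]_x (`|f x| `^ q)%:E)%E.
    by apply: integral_ge0 => x _; rewrite lee_fin powR_ge0.
  apply: (@le_trans _ _ ((S `^ q)%:E `^ 2^-1 * (S `^ q)%:E `^ 2^-1)%E).
    apply: lee_pmul; [exact: poweR_ge0|exact: poweR_ge0| |].
    - by apply: le_poweR; [|exact: I0|exact: SW].
    - by apply: le_poweR; [|exact: I0|exact: Sz].
  rewrite !poweR_EFin -EFinM -!powRrM -qp' -powRD ?(gt_eqF (addr_gt0 p'0 p'0))// qp'.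
  by rewrite -mulrDr -[2^-1]mul1r -splitr mulr1.
have E x : `|z x * (C x * W x)|%:E =
    ((`|C x| `^ p)%:E `^ p^-1 * (`|W x * z x| `^ p')%:E `^ p'^-1)%E.
  rewrite !poweR_EFin -EFinM -!powRrM !mulfV ?gt_eqF// !powRr1// -normrM.
  by congr (`|_|%:E); ring.
under eq_integral do rewrite E.
apply: le_trans (@ge0_hoelder _ _ _ (leb m.+3) (fun x => (`|C x| `^ p)%:E)
  (fun x => (`|W x * z x| `^ p')%:E) p^-1 p'^-1 _ _ _ _ _ _ _) _ => //.
- exact: mpow.
- exact: mpow.
- by rewrite invr_gt0.
- by rewrite invr_gt0.
rewrite EFinM; apply: lee_pmul; rewrite ?poweR_ge0//.
have -> : (S ^+ 2)%:E = ((S `^ q)%:E `^ p'^-1)%E.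
  rewrite poweR_EFin -powRrM (_ : q = 2%:R * p'); last by rewrite qp'; field.
  by rewrite mulfK ?gt_eqF// powR_mulrn.
apply: le_poweR => //; first by rewrite invr_ge0 ltW.
by apply: integral_ge0 => x _; rewrite lee_fin powR_ge0.
Qed.

End sobolev_limit.

(** * Lower bound for the tested energy *)

Section energy.
Context {R : realType} {n : nat}.
Local Notation V := 'rV[R]_n.
Local Notation leb := (@lebesgue_rV R n).
Local Notation B := (@unit_ball R n).
Local Notation Int U := (leb.-integrable setT (EFin \o U)).

Lemma integral_sqr_perturb (a b : V -> R) (A E : R) :
  measurable_fun setT a -> measurable_fun setT b ->
  (\int[leb]_x (a x ^+ 2)%:E <= A%:E)%E -> (\int[leb]_x ((a x - b x) ^+ 2)%:E <= E%:E)%E ->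
  (\int[leb]_x (b x ^+ 2)%:E <= (2 * A + 2 * E)%:E)%E.
Proof.
move=> ma mb aA abE.
have m1 : measurable_fun setT (fun x => (a x ^+ 2)%:E).
  by apply/measurable_EFinP; exact: measurable_funX.
have m2 : measurable_fun setT (fun x => ((a x - b x) ^+ 2)%:E).
  by apply/measurable_EFinP; apply: measurable_funX; exact: measurable_funB.
apply: (@le_trans _ _ (\int[leb]_x (2%:E * ((a x ^+ 2)%:E + ((a x - b x) ^+ 2)%:E)))%E).
  apply: ge0_le_integral => //.
  - by move=> x _; rewrite lee_fin sqr_ge0.
  - by apply/measurable_EFinP; exact: measurable_funX.
  - by apply: emeasurable_funM => //; exact: emeasurable_funD.
  - move=> x _; rewrite -EFinD -EFinM lee_fin.
    have := sqr_ge0 (2 * a x - b x); rewrite !expr2; nra.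
rewrite ge0_integralZl//; last 2 first.
- exact: emeasurable_funD.
- by move=> x _; rewrite -EFinD lee_fin addr_ge0// sqr_ge0.
rewrite ge0_integralD//; [|by move=> x _; rewrite lee_fin sqr_ge0..].
rewrite -mulrDr EFinM [(A + E)%:E]EFinD; apply: lee_wpmul2l => //; exact: leeD.
Qed.

Lemma partial_sabs (e : R) (f : V -> R) i : 0 < e -> smooth f ->
  partial i (fun x => sabs e (f x) + - e) = (fun x => dsabs e (f x) * partial i f x).
Proof.
move=> e0 sf; apply: partialE => x; rewrite -[X in is_derive _ _ _ X]addr0.
apply: is_deriveD; apply: is_derive_comp1; first exact: is_derive_sabs.
exact: smooth_is_derive.
Qed.

Lemma partial_sabs_norm (e : R) (f : V -> R) i x : 0 < e -> smooth f ->
  `|partial i (fun x => sabs e (f x) + - e) x| <= `|partial i f x|.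
Proof.
by move=> e0 sf; rewrite partial_sabs// normrM ler_piMl// dsabs_le1.
Qed.

Lemma sabs_ge_eps (e t : R) : 0 < e -> e <= sabs e t.
Proof.
by move=> e0; rewrite sabsE -[leLHS](gtr0_norm e0) -sqrtr_sqr ler_wsqrtr// lerDr sqr_ge0.
Qed.

Lemma sabs_sub_norm (e t : R) : 0 < e -> `|sabs e t + - e| <= `|t|.
Proof.
move=> e0; have H1 := sabs_ge e t; have H2 := sabs_le t e0.
by rewrite ger0_norm; [lra|rewrite subr_ge0 sabs_ge_eps].
Qed.

Lemma sabs_sub_approx (e t w : R) : 0 < e -> 0 <= w ->
  `|sabs e t + - e - w| <= e + `|w - t|.
Proof.
move=> e0 w0; have H1 := sabs_ge e t; have H2 := sabs_le t e0.
have H3 : `|t| <= w + `|w - t|.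
  by rewrite distrC -{1}(subrK w t) addrC (le_trans (ler_normD _ _))// (ger0_norm w0).
have H4 := ler_norm (w - t); have H5 := ler_norm t.
by rewrite ler_norml; apply/andP; split; lra.
Qed.

(** The equations give [Z - A = I1 - I2 + (I4 - I3)], whose parts are bounded by [k], [a] and
    [l]. *)
Lemma energy_arithmetic (d I1 I2 I3 I4 I5 J Z a k l A : R) :
  `|I1| <= k -> `|I2| <= a -> `|I3 - I4| <= l -> k + a <= d / 2 -> l <= d / 2 ->
  I4 = - I5 -> A = I2 + I5 -> Z = I1 + J -> J = - I3 -> A - d <= Z.
Proof. by rewrite !ler_norml => /andP[? _] /andP[_ ?] /andP[_ ?] *; lra. Qed.

(* G - partial i f_m is small in L^2, and testing with the fixed function
   partial i f_m only involves the L^2 limit of the functions under the gradient. *)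
Lemma energy_liminf (i : 'I_n) (W G : V -> R) (f_ : nat -> V -> R) (e_ : nat -> R) :
  (forall j, e_ j = j.+1%:R^-1) -> L2 leb W -> L2 leb G -> (forall x, 0 <= W x) ->
  (forall h, test_function B h ->
    \int[leb]_x (W x * partial i h x) = - \int[leb]_x (G x * h x)) ->
  (forall j, test_function B (f_ j)) ->
  (forall j, \int[leb]_x ((W x - f_ j x) ^+ 2)%:E <= (e_ j ^+ 2)%:E)%E ->
  (forall j, \int[leb]_x ((G x - partial i (f_ j) x) ^+ 2)%:E <= (e_ j ^+ 2)%:E)%E ->
  forall d : R, 0 < d -> \forall j \near \oo,
    \int[leb]_x (G x ^+ 2) - d <=
    \int[leb]_x (G x * partial i (fun x => sabs (e_ j) (f_ j x) + - e_ j) x).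
Proof.
move=> eE LW LG W0 weak tf cW cG d d0.
have e0 j : 0 < e_ j by rewrite eE invr_gt0.
have e1 j : e_ j <= 1 by rewrite eE invf_le1// ler1n.
have sm (x : R) : 0 < x -> \forall j \near \oo, e_ j <= x.
  move=> x0; have := near_infty_natSinv_lt (PosNum x0).
  by apply: filterS => j /=; rewrite eE; exact: ltW.
set A := \int[leb]_x (G x ^+ 2).
have A0 : 0 <= A by apply: Rintegral_ge0 => x _; exact: sqr_ge0.
have AE : (\int[leb]_x (G x ^+ 2)%:E <= A%:E)%E by rewrite (L2_bound LG).
pose z j x := sabs (e_ j) (f_ j x) + - e_ j.
have tz j : test_function B (z j) by exact: test_function_sabs.
have cz j := Ccinfty_test (tz j); have cf j := Ccinfty_test (tf j).
have sf j : smooth (f_ j) by case: (cf j).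
have Lz j : L2 leb (partial i (z j)) by exact: Ccinfty_L2 (Ccinfty_partial i (cz j)).
have Lf j : L2 leb (partial i (f_ j)) by exact: Ccinfty_L2 (Ccinfty_partial i (cf j)).
pose K := 2 * A + 2.
have K0 : 0 <= K by rewrite addr_ge0// mulr_ge0.
(* Regularizing does not increase the gradient, and [partial i (f_ j)] is within [e_ j <= 1] of [G]
   in L^2. *)
have zK j : (\int[leb]_x (partial i (z j) x ^+ 2)%:E <= K%:E)%E.
  apply: (@le_trans _ _ (\int[leb]_x (partial i (f_ j) x ^+ 2)%:E)%E).
    apply: ge0_le_integral => //.
    - by move=> x _; rewrite lee_fin sqr_ge0.
    - by apply/measurable_EFinP; apply: measurable_funX; case: (Lz j).
    - by apply/measurable_EFinP; apply: measurable_funX; case: (Lf j).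
    - move=> x _; rewrite lee_fin -(real_normK (num_real (partial i (z j) x))).
      rewrite -(real_normK (num_real (partial i (f_ j) x))) ler_sqr ?nnegrE//.
      exact: partial_sabs_norm.
  apply: le_trans (integral_sqr_perturb _ _ AE (cG j)) _; [by case: LG|by case: (Lf j)|].
  by rewrite lee_fin /K lerD2l -[leRHS]mulr1 ler_wpM2l// exprn_ile1// ltW.
have c0 : 0 < Num.sqrt K + Num.sqrt A + 1 by rewrite ltr_wpDl// addr_ge0 ?sqrtr_ge0.
(* [m] is fixed before [j]: it depends on bounds uniform in [j], while the threshold for [j] depends
   on [m] through the norms of the second derivative [P] of [f_ m]. *)
have [m _ /(_ m (leqnn m)) em] := sm (d / 2 / (Num.sqrt K + Num.sqrt A + 1))
  (divr_gt0 (divr_gt0 d0 (ltr0Sn _ _)) c0).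
have {em} em : e_ m * (Num.sqrt K + Num.sqrt A) <= d / 2.
  move: em; rewrite ler_pdivlMr// => em; apply: le_trans em.
  by rewrite ler_wpM2l ?(ltW (e0 m))// lerDl.
pose P := partial i (partial i (f_ m)).
have cP : Ccinfty P by exact: Ccinfty_partial i (Ccinfty_partial i (cf m)).
have LP : L2 leb P by exact: Ccinfty_L2.
have iP : Int P by exact: Ccinfty_integrable.
pose N := \int[leb]_x `|P x|; pose M := \int[leb]_x (P x ^+ 2).
have N0 : 0 <= N by exact: Rintegral_ge0.
have b0 : 0 < N + Num.sqrt M + 1 by rewrite ltr_wpDl// addr_ge0 ?sqrtr_ge0.
have := sm (d / 2 / (N + Num.sqrt M + 1)) (divr_gt0 (divr_gt0 d0 (ltr0Sn _ _)) b0).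
apply: filterS => j; rewrite ler_pdivlMr// => ej.
have {}ej : e_ j * (N + Num.sqrt M) <= d / 2.
  by apply: le_trans ej; rewrite ler_wpM2l ?(ltW (e0 j))// lerDl.
have LGf : L2 leb (fun x => G x - partial i (f_ m) x) by exact: (L2B LG (Lf m)).
have sqe (l : nat) X : Num.sqrt (e_ l ^+ 2 * X) = e_ l * Num.sqrt X.
  by rewrite sqrtrM ?sqr_ge0// sqrtr_sqr gtr0_norm.
have H1 : `|\int[leb]_x ((G x - partial i (f_ m) x) * partial i (z j) x)| <= e_ m * Num.sqrt K.
  by rewrite -sqe; exact: (Rintegral_mul_le LGf (Lz j) (cG m) (zK j)).
have H2 : `|\int[leb]_x ((G x - partial i (f_ m) x) * G x)| <= e_ m * Num.sqrt A.
  by rewrite -sqe; exact: (Rintegral_mul_le LGf LG (cG m) AE).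
have LWf : L2 leb (fun x => W x - f_ j x) by exact: (L2B LW (Ccinfty_L2 (cf j))).
have iWP : Int (fun x => W x * P x) by exact: (L2_mul LW LP).
have izP : Int (fun x => z j x * P x) by exact: (L2_mul (Ccinfty_L2 (cz j)) LP).
(* As [W >= 0], [z j] differs from [W] by at most [e_ j + |W - f_ j|]; the first term pairs with [P]
   in L^1, the second in L^2. *)
have H3 : `|\int[leb]_x (z j x * P x) - \int[leb]_x (W x * P x)| <= e_ j * (N + Num.sqrt M).
  rewrite -RintegralB//.
  have iD : Int (fun x => z j x * P x - W x * P x) by exact: (IntB izP iWP).
  apply: le_trans (le_normr_Rintegral measurableT iD) _.
  have iWfP := L2_mul LWf LP.
  have iN1 : Int (fun x => e_ j * `|P x|) by apply: IntZ; exact: integrable_norm.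
  have iN2 : Int (fun x => `|(W x - f_ j x) * P x|) by exact: integrable_norm.
  apply: (@le_trans _ _ (\int[leb]_x (e_ j * `|P x| + `|(W x - f_ j x) * P x|))).
    apply: le_Rintegral => //; [exact: integrable_norm|exact: IntD|].
    move=> x _; rewrite -mulrBl !normrM -mulrDl ler_wpM2r// /z.
    exact: sabs_sub_approx.
  rewrite RintegralD// RintegralZl//; last exact: integrable_norm.
  rewrite mulrDr lerD2l -sqe -lee_fin /Rintegral fineK; last exact: integrable_fin_num.
  apply: integral_mul_le => //; [by case: LWf|by case: LP|by rewrite (L2_bound LP)].
have H4 : \int[leb]_x (partial i (f_ m) x * partial i (z j) x) = - \int[leb]_x (z j x * P x).
  exact: (Rintegral_by_parts i (Ccinfty_partial i (cf m)) (cz j).1).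
have H5 := weak _ (test_function_partial i (tf m)).
have H6 : \int[leb]_x (G x * partial i (z j) x) =
   \int[leb]_x ((G x - partial i (f_ m) x) * partial i (z j) x) +
   \int[leb]_x (partial i (f_ m) x * partial i (z j) x).
  rewrite -(RintegralD measurableT (L2_mul LGf (Lz j)) (L2_mul (Lf m) (Lz j))).
  by apply: eq_Rintegral => x _; rewrite -mulrDl subrK.
have H7 : A = \int[leb]_x ((G x - partial i (f_ m) x) * G x) +
   \int[leb]_x (G x * partial i (f_ m) x).
  rewrite -(RintegralD measurableT (L2_mul LGf LG) (L2_mul LG (Lf m))).
  by apply: eq_Rintegral => x _; rewrite [X in _ + X]mulrC -mulrDl subrK expr2.
rewrite mulrDr in em.
exact: (energy_arithmetic H1 H2 H3 em ej H5 H7 H6 H4).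
Qed.

End energy.

(** * The weak maximum principle *)

Section supersolution_energy.
Context {R : realType} {n : nat}.
Local Notation V := 'rV[R]_n.
Local Notation leb := (@lebesgue_rV R n).
Local Notation B := (@unit_ball R n).
Local Notation Int U := (leb.-integrable setT (EFin \o U)).

(** [G] is the weak gradient of the negative part; testing it with [partial i z] moves one
    derivative back in Kato's inequality. Then -c is bounded by its negative part, and the absolute
    value prepares for Hoelder. *)
Lemma supersolution_energy (c u : V -> R) (g G : 'I_n -> V -> R) (z : V -> R) :
  H1_gradient B u g ->
  (forall f, test_function B f -> (forall x, 0 <= f x) ->
    0 <= \int[leb]_(x in B) (\sum_(i < n) g i x * partial i f x) +
         \int[leb]_(x in B) (c x * u x * f x)) ->
  measurable_fun setT (c \_ B) ->
  (forall f, test_function B f -> Int (fun x => (c \_ B) x * (u \_ B) x * f x)) ->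
  (forall i h, test_function B h ->
    \int[leb]_x (neg_part (u \_ B) x * partial i h x) = - \int[leb]_x (G i x * h x)) ->
  test_function B z -> (forall x, 0 <= z x) ->
  \sum_i \int[leb]_x (G i x * partial i z x) <=
  \int[leb]_x `|z x * (neg_part (c \_ B) x * neg_part (u \_ B) x)|.
Proof.
move=> Hu sup mC hloc weak tz z0.
set C := c \_ B in mC hloc *; set W := neg_part (u \_ B) in weak *.
have LU : L2 leb (u \_ B) by apply: Lp_on_L2; case: Hu.
have mU : measurable_fun setT (u \_ B) by case: LU.
have mW := measurable_neg_part mU; have mN := measurable_neg_part mC.
have mz : measurable_fun setT z by apply: smooth_measurable; case: (Ccinfty_test tz).
have iN : Int (fun x => z x * (neg_part C x * W x)).
  apply: (@le_integrable _ _ _ leb _ measurableT _ _ _ _ (hloc _ tz)).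
  - by apply/measurable_EFinP; apply: measurable_funM => //; exact: measurable_funM.
  - move=> x _; rewrite /= lee_fin normrM [X in _ <= X]normrM mulrC.
    by rewrite ler_wpM2r// normrM [X in _ <= X]normrM; apply: ler_pM => //; exact: neg_part_norm.
have iC : Int (fun x => z x * (C x * W x)).
  apply: (@le_integrable _ _ _ leb _ measurableT _ _ _ _ (hloc _ tz)).
  - by apply/measurable_EFinP; apply: measurable_funM => //; exact: measurable_funM.
  - move=> x _; rewrite /= lee_fin normrM [X in _ <= X]normrM mulrC.
    by rewrite ler_wpM2r// normrM [X in _ <= X]normrM; apply: ler_wpM2l => //; exact: neg_part_norm.
have K := kato_negative_part Hu sup mC hloc tz z0.
have -> : \sum_i \int[leb]_x (G i x * partial i z x) =
    - \sum_i \int[leb]_x (W x * partial i (partial i z) x).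
  rewrite -sumrN; apply: eq_bigr => i _.
  by rewrite (weak i _ (test_function_partial i tz)) opprK.
apply: (@le_trans _ _ (- \int[leb]_x (z x * (C x * W x)))); first by rewrite lerN2.
have -> : - (\int[leb]_x (z x * (C x * W x))) = \int[leb]_x (-1 * (z x * (C x * W x))).
  by rewrite RintegralZl// mulN1r.
apply: le_Rintegral => //; [exact: IntZ|exact: integrable_norm|].
move=> x _; rewrite mulN1r -mulrN -mulNr ger0_norm; last first.
  by rewrite mulr_ge0// mulr_ge0// neg_part_ge0.
rewrite ler_wpM2l// ler_wpM2r ?neg_part_ge0// /neg_part.
by have := ler_norm (- C x); rewrite normrN => ?; lra.
Qed.

End supersolution_energy.

(** All estimates carry a slack [d > 0], and for each [d] a single approximant [f_ j] is used.
    Letting [d] tend to 0 first gives [E = 0] for the Dirichlet energy [E] of the negative part;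
    [S d] is then arbitrarily small and bounds its L^q norm. *)
Lemma weak_maximum_principle (R : realType) (m : nat) (k : R) (c u : 'rV[R]_m.+3 -> R) :
  k = (8 * (2 * m.+2%:R / m.+1%:R) ^+ 2)^-1 ->
  Lp_on unit_ball (m.+3%:R / 2) c ->
  weak_supersolution unit_ball c u ->
  H10 unit_ball (u^\-)%R ->
  (Lnorm_on unit_ball (m.+3%:R / 2) (c^\-)%R <= k%:E)%E ->
  {ae lebesgue_rV m.+3, forall x, unit_ball x -> 0 <= u x}.
Proof.
move=> kE Lc [gu Hu sup] [g' Hg' appr] ck.
set B := unit_ball in Lc Hu sup Hg' appr ck *.
pose leb := @lebesgue_rV R m.+3.
pose p : R := m.+3%:R / 2; pose q : R := 2 * m.+3%:R / m.+1%:R.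
pose g : R := 2 * m.+2%:R / m.+1%:R; rewrite -/p in Lc ck; rewrite -/g in kE.
have [g1 q0 _ _ _] := sobolev_exponents (erefl q) (erefl g).
have [p1 _ _] := conjugate_exponents (erefl p) erefl.
have p0 : 0 < p by exact: lt_le_trans p1.
have g0 : 0 < g by exact: lt_trans g1.
have [mC _] := Lp_onP p0 Lc; set C := c \_ B in mC.
have hloc := supersolution_Int (erefl p) Lc Hu.
have LU : L2 leb (u \_ B) by apply: Lp_on_L2; case: Hu.
have mU : measurable_fun setT (u \_ B) by case: LU.
have mW := measurable_neg_part mU; have mN := measurable_neg_part mC.
have W0 := neg_part_ge0 (u \_ B).
have LW : L2 leb (neg_part (u \_ B)) by exact: L2_le mW (neg_part_norm (u \_ B)) LU.
set W := neg_part (u \_ B) in mW W0 LW.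
have WE : (u^\-)%R \_ B = W by exact: funrneg_patch.
pose G i := g' i \_ B.
have LG i : L2 leb (G i) by apply: Lp_on_L2; case: Hg' => _ /(_ i) [].
have weak i h : test_function B h ->
    \int[leb]_x (W x * partial i h x) = - \int[leb]_x (G i x * h x).
  by move=> th; rewrite -WE; apply: weak_partialE => //; case: Hg' => _ /(_ i) [].
pose e_ (j : nat) : R := j.+1%:R^-1.
have e0 j : 0 < e_ j by rewrite invr_gt0.
have /choice[f_ fP] : forall j, exists f, test_function B f /\
    (H1_norm B ((u^\-) \- f)%R (fun i => g' i \- partial i f)%R < (e_ j)%:E)%E.
  by move=> j; have [f tf Hf] := appr _ (e0 j); exists f.
have tf j : test_function B (f_ j) by case: (fP j).
have cf j := Ccinfty_test (tf j); have sf j : smooth (f_ j) by case: (cf j).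
have cW j : (\int[leb]_x ((W x - f_ j x) ^+ 2)%:E <= (e_ j ^+ 2)%:E)%E.
  by have [_ /H1_norm_lt[+ _]] := fP j; rewrite patch_test_functionB// WE.
have cG i j : (\int[leb]_x ((G i x - partial i (f_ j) x) ^+ 2)%:E <= (e_ j ^+ 2)%:E)%E.
  have [_ /H1_norm_lt[_ /(_ i)]] := fP j.
  by rewrite (patch_test_functionB _ (test_function_partial i (tf j))).
pose E := \sum_i \int[leb]_x (G i x ^+ 2).
have G0 i : 0 <= \int[leb]_x (G i x ^+ 2) by apply: Rintegral_ge0 => x _; exact: sqr_ge0.
have GE i : (\int[leb]_x (G i x ^+ 2)%:E <= E%:E)%E.
  by rewrite (L2_bound (LG i)) lee_fin /E (bigD1 i)//= lerDl sumr_ge0.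
have E0 : 0 <= E by exact: sumr_ge0.
have sme (d : R) : 0 < d -> \forall j \near \oo, e_ j ^+ 2 <= d.
  move=> d0; have d2 : 0 < Num.min d 1 by rewrite lt_min d0/=.
  have := near_infty_natSinv_lt (PosNum d2); apply: filterS => j /=.
  rewrite lt_min => /andP[/ltW jd /ltW j1]; rewrite expr2.
  by apply: le_trans jd; rewrite ler_piMr// ltW.
have fD (d : R) : 0 < d -> \forall j \near \oo,
    forall i, (\int[leb]_x (partial i (f_ j) x ^+ 2)%:E <= (2 * E + 2 * d)%:E)%E.
  move=> d0; have := sme d d0; apply: filterS => j ejd i.
  have mf : measurable_fun setT (partial i (f_ j)).
    by apply: smooth_measurable; case: (Ccinfty_partial i (cf j)).
  have mG : measurable_fun setT (G i) by case: (LG i).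
  apply: le_trans (integral_sqr_perturb mG mf (GE i) (cG i j)) _.
  by rewrite lee_fin lerD2l ler_wpM2l.
(* The L^q bound from Sobolev's inequality, common to [W] and to the regularized [f_ j] for large
   [j]. *)
pose S (d : R) := g * (2 * E + 2 * d) `^ 2^-1.
have SW (d : R) : 0 < d -> (\int[leb]_x (`|W x| `^ q)%:E <= (S d `^ q)%:E)%E.
  move=> d0; apply: (sobolev_limit (erefl q) (erefl g) cf mW _ (fD d d0)) => e e_gt0.
  have := sme e e_gt0; apply: filterS => j je; apply: le_trans (cW j) _.
  by rewrite lee_fin.
have NE : ((\int[leb]_x (`|neg_part C x| `^ p)%:E) `^ p^-1 <= k%:E)%E.
  by move: ck; rewrite /Lnorm_on funrneg_patch unlock.
have Ed (d : R) : 0 < d -> E - m.+3%:R * d <= k * S d ^+ 2.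
  move=> d0.
  have low : \forall j \near \oo, forall i, \int[leb]_x (G i x ^+ 2) - d <=
      \int[leb]_x (G i x * partial i (fun x => sabs (e_ j) (f_ j x) + - e_ j) x).
    apply: filter_forall => i.
    exact: (energy_liminf (e_ := e_) (fun=> erefl) LW (LG i) W0 (weak i) tf cW (cG i) d0).
  have [j _ /(_ j (leqnn j)) [lowj fj]] := filterI low (fD d d0).
  pose z x := sabs (e_ j) (f_ j x) + - e_ j.
  have tz : test_function B z by exact: test_function_sabs.
  have z0 x : 0 <= z x by rewrite subr_ge0 sabs_ge_eps.
  have mz : measurable_fun setT z by apply: smooth_measurable; case: (Ccinfty_test tz).
  have S0 : 0 <= S d by rewrite mulr_ge0 ?powR_ge0// ltW.
  have mf : measurable_fun setT (f_ j) by exact: smooth_measurable.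
  have mpow (f : 'rV[R]_m.+3 -> R) : measurable_fun setT f ->
      measurable_fun setT (fun x => (`|f x| `^ q)%:E).
    move=> ?; apply/measurable_EFinP; apply: measurable_fun_powR.
    exact: measurableT_comp.
  have zq : (\int[leb]_x (`|z x| `^ q)%:E <= (S d `^ q)%:E)%E.
    apply: le_trans (sobolev_power (erefl q) (erefl g) (cf j) fj).
    apply: ge0_le_integral => //; [exact: mpow|exact: mpow|].
    move=> x _; rewrite lee_fin ge0_ler_powR ?nnegrE ?(ltW q0)//.
    exact: sabs_sub_norm.
  have H := hoelder_triple (erefl p) (erefl q) S0 mN mW mz NE (SW d d0) zq.
  apply: (@le_trans _ _ (\sum_i \int[leb]_x (G i x * partial i z x))).
    have -> : m.+3%:R * d = \sum_(i < m.+3) d.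
      by rewrite sumr_const card_ord mulr_natl.
    by rewrite /E -sumrB; apply: ler_sum => i _; exact: lowj.
  apply: le_trans (supersolution_energy Hu sup mC hloc weak tz z0) _.
  rewrite -lee_fin /Rintegral fineK//.
  rewrite ge0_fin_numE; last by apply: integral_ge0.
  exact: le_lt_trans H (ltry _).
have kS (d : R) : 0 < d -> k * S d ^+ 2 = (E + d) / 4.
  move=> d0; rewrite /S exprMn -[(_ `^ _) ^+ 2]powR_mulrn ?powR_ge0// -powRrM mulVf// powRr1; last first.
    by rewrite addr_ge0// mulr_ge0// ltW.
  by rewrite kE; field; rewrite gt_eqF.
have {Ed} E_eq0 : E = 0.
  apply/eqP; rewrite eq_le E0 andbT; apply/ler_addgt0Pr => t t0; rewrite add0r.
  have n0 : 0 < (m.+3%:R + 1 : R) by rewrite ltr_wpDl.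
  (* With n = m + 3, E - n d <= (E + d) / 4 gives E <= (4 n d + d) / 3, and n d + d = t / 2 makes
     this at most 2t/3. *)
  have d0 : 0 < t / 2 / (m.+3%:R + 1) by rewrite !divr_gt0.
  have := Ed _ d0; rewrite kS//; set d := _ / (_ + 1) in d0 *.
  have : m.+3%:R * d + d = t / 2.
    by rewrite -[X in _ + X]mul1r -mulrDl /d mulrC divfK// gt_eqF.
  by move: (m.+3%:R * d) => md ?; lra.
have IW0 : (\int[leb]_x (`|W x| `^ q)%:E = 0)%E.
  apply/eqP; rewrite eq_le; apply/andP; split; last first.
    by apply: integral_ge0 => x _; rewrite lee_fin powR_ge0.
  apply/lee_addgt0Pr => t t0; rewrite add0e.
  (* Solves [S d = t^(1/q)] when [E = 0]. *)
  pose d := (t `^ q^-1 / g) ^+ 2 / 2.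
  have tg : 0 < t `^ q^-1 / g by rewrite divr_gt0// powR_gt0.
  have d0 : 0 < d by rewrite divr_gt0// exprn_gt0.
  apply: le_trans (SW d d0) _; rewrite lee_fin /S E_eq0 mulr0 add0r /d.
  rewrite [2 * _]mulrC divfK// -[(_ / g) ^+ 2]powR_mulrn ?(ltW tg)//.
  rewrite -powRrM mulfV// powRr1 ?(ltW tg)//.
  by rewrite [g * _]mulrC divfK ?gt_eqF// -powRrM mulVf ?gt_eqF// powRr1 ?(ltW t0).
have mWq : measurable_fun setT (fun x => (`|W x| `^ q)%:E).
  by apply/measurable_EFinP; apply: measurable_fun_powR; exact: measurableT_comp.
have Wq0 x : (0 <= (`|W x| `^ q)%:E)%E by rewrite lee_fin powR_ge0.
have := integral_eq0_ae mWq Wq0 IW0; apply: filterS => x [/eqP].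
rewrite powR_eq0 => /andP[/eqP/normr0_eq0 Wx _] Bx.
have := normr_ge0 (u x); move: Wx; rewrite /W /neg_part patchE mem_set// => Wx.
by move=> ?; lra.
Qed.

Theorem theorem1p2 (R : realType) (n : nat) (hn : (3 <= n)%N) :
  exists2 k : R, 0 < k &
    forall c u : 'rV[R]_n -> R,
      Lp_on unit_ball (n%:R / 2) c ->
      H1 unit_ball u ->
      weak_supersolution unit_ball c u ->
      H10 unit_ball (u^\-) ->
      (Lnorm_on unit_ball (n%:R / 2) (c^\-)%R <= k%:E)%E ->
      {ae lebesgue_rV n, forall x, unit_ball x -> 0 <= u x}.
Proof.
case: n hn => [|[|[|m]]]// _.
exists (8 * (2 * m.+2%:R / m.+1%:R) ^+ 2)^-1.
  by rewrite invr_gt0 mulr_gt0// exprn_gt0// divr_gt0// mulr_gt0.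
by move=> c u Lc _; exact: weak_maximum_principle.
Qed.
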